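(* Let $0<q<1$ be fixed. For each $n\geq 1$ let $\lambda=(\lambda_1\geq\lambda_2\geq\cdots)$ be a random Young diagram of size $n$ distributed according to the $q$-Plancherel measure $M_{n,q}$, and for $i\geq 1$ set $$Y_{n,q,i}=\sqrt{n}\left(\frac{\lambda_i}{n}-(1-q)\,q^{i-1}\right).$$ Then, as $n\to\infty$, the finite-dimensional laws of the random process $(Y_{n,q,i})_{i\geq1}$ converge to those of a gaussian process $(Y_{q,i})_{i\geq 1}$ with $$\mathbb{E}[Y_{q,i}]=0,\qquad \mathbb{E}[Y_{q,i}^2]=(1-q)\,q^{i-1}-(1-q)^2\,q^{2(i-1)},\qquad \mathrm{cov}(Y_{q,i},Y_{q,j})=-(1-q)^2\,q^{i+j-2}\ \ (i\neq j).$$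
   Context: $\mathscr{Y}_n$ is the set of partitions (Young diagrams) $\lambda=(\lambda_1\geq\lambda_2\geq\cdots)$ of size $n$, with $\lambda_i=0$ for $i$ larger than the number of parts $\ell(\lambda)$; $\lambda'$ is the conjugate partition. For a box $\square=(i,j)$ in row $i$ and column $j$ of $\lambda$, the hook length is $h(\square)=\lambda_i-j+\lambda'_j-i+1$. Put $b(\lambda)=\sum_{i}(i-1)\lambda_i$ and $\{m\}_q=\frac{q^m-1}{q-1}=1+q+\cdots+q^{m-1}$. Let $\dim\lambda$ be the dimension of the irreducible representation of the symmetric group $\mathfrak{S}_n$ indexed by $\lambda$ (the number of standard Young tableaux of shape $\lambda$). The $q$-Plancherel measure is the probability measure on $\mathscr{Y}_n$ given by $$M_{n,q}(\lambda)=\dim\lambda\cdot\frac{q^{b(\lambda)}}{\prod_{\square\in\lambda}\{h(\square)\}_q}.$$ *)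

(* Defs.v *)
From HB Require Import structures.
From mathcomp Require Export all_boot all_order all_algebra.
From mathcomp Require Export all_classical all_reals all_analysis.
Export Order.TTheory GRing.Theory Num.Theory.
Export numFieldNormedType.Exports.

Set Implicit Arguments.
Unset Strict Implicit.
Unset Printing Implicit Defensive.

Local Open Scope classical_set_scope.
Local Open Scope ring_scope.

(* Rows, columns and the components of the processes are numbered from 0:
   [nth 0 l i] is the part usually written lambda_(i+1), and the 0-based box
   (i, j) is the box (i+1, j+1) of the usual numbering. *)

Definition is_intpart (n : nat) (l : seq nat) : bool :=
  [&& sorted geq l, 0%N \notin l & sumn l == n].

Record intpart (n : nat) :=
  IntPart { parts :> seq nat; _ : is_intpart n parts }.

HB.instance Definition _ n := [isSub for @parts n].
HB.instance Definition _ n := [Choice of intpart n by <:].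

Lemma is_intpart_ones n : is_intpart n (nseq n 1%N).
Proof.
apply/and3P; split; last by rewrite sumn_nseq mul1n.
  by case: n => // n; elim: n => //= n ->.
by rewrite mem_nseq andbF.
Qed.

HB.instance Definition _ n :=
  isPointed.Build (intpart n) (IntPart (is_intpart_ones n)).

HB.instance Definition _ n := @isMeasurable.Build default_measure_display
  (intpart n) discrete_measurable discrete_measurable0
  discrete_measurableC discrete_measurableU.

(* length of the (0-based) column j, i.e. the part j of the conjugate *)
Definition conj_part (l : seq nat) (j : nat) : nat :=
  count (fun r => j < r)%N l.

(* On a box (i, j) of l neither subtraction is truncated. *)
Definition hook (l : seq nat) (i j : nat) : nat :=
  ((nth 0 l i - j.+1) + (conj_part l j - i.+1) + 1)%N.

Definition b_stat (l : seq nat) : nat :=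
  (\sum_(i < size l) i * nth 0 l i)%N.

(* A partition l of n has all its (0-based) boxes in 'I_n * 'I_n. *)
Definition box (l : seq nat) :=
  {u : 'I_(sumn l) * 'I_(sumn l) | (u.2 < nth 0 l u.1)%N}.

(* Fillings of the n boxes by distinct labels among n, hence bijective. *)
Definition is_SYT (l : seq nat) (t : {ffun box l -> 'I_(sumn l)}) : bool :=
  [&& injectiveb t,
      [forall u : box l, forall v : box l, ((val u).1 == (val v).1) &&
         ((val u).2 < (val v).2)%N ==> (t u < t v)%N]
    & [forall u : box l, forall v : box l, ((val u).2 == (val v).2) &&
         ((val u).1 < (val v).1)%N ==> (t u < t v)%N]].

Definition dim_part (l : seq nat) : nat := #|[set t | @is_SYT l t]%SET|.

Definition qint (F : fieldType) (q : F) (m : nat) : F :=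
  (q ^+ m - 1) / (q - 1).

Definition qplancherel (F : fieldType) (q : F) (l : seq nat) : F :=
  (dim_part l)%:R *
  (q ^+ b_stat l /
     \prod_(i < size l) \prod_(j < nth 0%N l i) qint q (hook l i j)).

Definition scaled_row (R : realType) (q : R) (n i : nat) (l : intpart n) : R :=
  Num.sqrt n%:R * ((nth 0%N l i)%:R / n%:R - (1 - q) * q ^+ i).

Lemma measurable_scaled_row (R : realType) (q : R) (n i : nat) :
  measurable_fun setT (@scaled_row R q n i).
Proof. by []. Qed.

HB.instance Definition _ (R : realType) (q : R) (n i : nat) :=
  isMeasurableFun.Build _ _ _ _ (@scaled_row R q n i)
    (@measurable_scaled_row R q n i).

(* Gaussian laws on the line, including the degenerate ones;
   the library's [normal_prob m 0] is not the Dirac mass at m. *)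
Definition gaussian_law (R : realType) (m s : R) : set R -> \bar R :=
  if s == 0 then \d_m else normal_prob m s.

Definition gaussian_process (R : realType) (d : measure_display)
    (T : measurableType d) (P : probability T R) (Y : nat -> {RV P >-> R}) :=
  forall (k : nat) (c : nat -> R), exists m s : R,
    forall A : set R, measurable A ->
      P ((fun w => \sum_(i < k) c i * Y i w) @^-1` A) = gaussian_law m s A.

(* Convergence in law of (X n (s j))_(j < k) to (Y (s j))_(j < k), for every
   finite family s of indices; the X n may live on different spaces. *)
Definition fdd_cvg (R : realType)
    (dX : nat -> measure_display) (TX : forall n, measurableType (dX n))
    (PX : forall n, probability (TX n) R)
    (X : forall n, nat -> {RV (PX n) >-> R})
    (dY : measure_display) (TY : measurableType dY) (PY : probability TY R)
    (Y : nat -> {RV PY >-> R}) :=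
  forall (k : nat) (s : 'I_k -> nat) (f : 'rV[R]_k -> R),
    continuous f -> (exists M : R, forall x, `|f x| <= M) ->
    'E_(PX n)[fun w => f (\row_j X n (s j) w)]%E @[n --> \oo] -->
    'E_PY[fun w => f (\row_j Y (s j) w)]%E.

(* Main.v *)
From HB Require Import structures.
Require Import Defs.
From mathcomp Require Import measurable_realfun ring lra zify.

(** Write [p = 1 - q] and [alpha i = p * q ^+ i]. Removing the first row [j]
    of a partition [j :: mu] of [n] leaves the hooks of the other rows
    unchanged, so the q-Plancherel weight of [j :: mu] is the binomial weight
    of [j] with parameters [n] and [p], times the q-Plancherel weight of [mu],
    times a correction [row_corr j mu] ([qplancherel_cons]). If the correction
    were 1, the rows would be obtained by successive binomial sampling: the
    first row takes each of the [n] boxes with probability [p], the second one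
    does the same with the boxes left over, and so on; their fluctuations
    would be those of a multinomial law with probabilities [alpha i], which is
    the Gaussian process of the theorem. The proof makes this exact in the
    limit.

    The correction. It is bounded ([row_corr_ub]), so a row is dominated by a
    binomial variable and satisfies a law of large numbers ([qpl_row_lln]).
    Where all rows are near their expected size, the correction is at least
    [1 - eps] ([row_corr_ge]); its mean is 1, both sides of the factorisation
    being probability weights. Hence it tends to 1 in mean
    ([row_corr_dev_cvg0]), and the law of the first [k] rows is close in total
    variation to successive binomial sampling ([qpl_first_rows]).

    The coupling. On the unit interval with its uniform measure, the binary
    digits of even and of odd rank of a point form two independent uniform
    variables ([integral_digits]); one point therefore drives a whole sequence
    of independent draws. Each draw is a quantile of a binomial law, and the
    central limit theorem for quantiles ([bin_quantile_cvg]) makes the rescaled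
    rows converge at every point ([row_rv_cvg]) to the variables [limit_rv],
    given by [Y 0 = sigma * Z] and
    [Y i.+1 = sqrt q * Y' i - alpha i * Y 0], where [sigma ^+ 2 = p * q], [Z]
    is standard Gaussian and [Y'] is an independent copy of [Y]. Dominated
    convergence then gives the convergence of the finite-dimensional laws
    ([fdd_limit]).

    The Gaussian input. The function [Phi (y / sqrt r)] solves the heat
    equation, and averaging it over one step of a random walk amounts to
    letting the time [r] increase by the variance of the step, up to third
    order ([heat_step]). Summing over [n] steps of size [1 / sqrt n] yields the
    binomial central limit theorem, and also the convolution rule for Gaussian
    laws ([gauss_rv_convolution]). By that rule every linear combination of the
    limit variables is Gaussian, of variance
    [\sum_i alpha i * c i ^+ 2 - (\sum_i alpha i * c i) ^+ 2] ([lin_rv_law]);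
    its mean and second moment give the moments of the process.

    The dimension factor of the measure enters through a row-by-row form of the
    hook length formula ([dim_part_cons]), obtained from the recursion of
    standard tableaux over corners and a Lagrange interpolation identity
    ([shift_identity]). *)

Set Implicit Arguments.
Unset Strict Implicit.
Unset Printing Implicit Defensive.

(** * Linear extensions of a finite relation *)

Section LinearExtensions.
Import mathcomp.boot.finset.
Variables (T : finType) (e : rel T) (M : nat).
Local Open Scope nat_scope.

(** The labels vanish outside [A] and live in a type that does not depend on
    [A], so that extensions of [A] and of its subsets are functions of one
    type. *)
Definition is_linext (A : {set T}) (t : {ffun T -> 'I_M.+1}) : bool :=
  [&& [forall u in A, t u < #|A|], [forall u in ~: A, t u == ord0],
      [forall u in A, forall v in A, (t u == t v) ==> (u == v)] &
      [forall u in A, forall v in A, e u v ==> (t u < t v)]].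

Definition linext (A : {set T}) : nat := #|[set t | is_linext A t]%SET|.

Definition maximal (A : {set T}) (x : T) : bool :=
  (x \in A) && [forall v in A, ~~ e x v].

Lemma linextP (A : {set T}) (t : {ffun T -> 'I_M.+1}) :
  reflect [/\ forall u, u \in A -> t u < #|A|, forall u, u \notin A -> t u = ord0,
     {in A &, injective t} & forall u v, u \in A -> v \in A -> e u v -> t u < t v]
   (is_linext A t).
Proof.
apply: (iffP and4P) => -[h1 h2 h3 h4]; split.
- by move=> u uA; exact: (forall_inP h1).
- by move=> u uA; apply/eqP; apply: (forall_inP h2); rewrite inE.
- move=> u v uA vA tuv; apply/eqP.
  by move/forall_inP: h3 => /(_ u uA) /forall_inP /(_ v vA) /implyP; apply; apply/eqP.
- move=> u v uA vA; apply/implyP.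
  by move/forall_inP: h4 => /(_ u uA) /forall_inP /(_ v vA).
- exact/forall_inP.
- by apply/forall_inP => u; rewrite inE => /h2 ->.
- by apply/forall_inP => u uA; apply/forall_inP => v vA; apply/implyP => /eqP /h3 ->.
- by apply/forall_inP => u uA; apply/forall_inP => v vA; apply/implyP => /h4; apply.
Qed.

Lemma linext0 : linext set0 = 1.
Proof.
rewrite /linext -(cards1 ([ffun=> ord0] : {ffun T -> 'I_M.+1})).
apply: eq_card => t; rewrite !inE; apply/idP/eqP.
  by case/linextP => _ h _ _; apply/ffunP => u; rewrite ffunE h ?inE.
by move=> ->; apply/linextP; split => u; rewrite ?inE // ffunE.
Qed.

(** The labels below [#|A|] are injective on [A], hence all of them occur. *)
Lemma linext_top (A : {set T}) t : is_linext A t -> A != set0 ->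
  exists2 x, x \in A & t x = #|A|.-1 :> nat.
Proof.
case/linextP => h1 h2 h3 h4 A0.
have Agt0 : 0 < #|A| by rewrite card_gt0.
pose f (u : T) : 'I_#|A| := insubd (Ordinal Agt0) (t u : nat).
have fE u : u \in A -> f u = t u :> nat by move=> uA; rewrite /f val_insubd h1.
have finj : {in A &, injective f}.
  move=> u v uA vA /(congr1 val) /=; rewrite !fE // => tuv; apply: h3 => //.
  exact: val_inj.
have : f @: A = setT.
  apply/eqP; rewrite eqEcard subsetT cardsT card_ord card_in_imset /= ?leqnn //.
have lt : #|A|.-1 < #|A| by rewrite ltn_predL.
move=> /setP /(_ (Ordinal lt)); rewrite inE => /imsetP [x xA].
by move/(congr1 val) => /= ->; exists x; rewrite ?fE.
Qed.

Let restr x (t : {ffun T -> 'I_M.+1}) : {ffun T -> 'I_M.+1} :=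
  [ffun u => if u == x then ord0 else t u].

Lemma linext_rem_top (A : {set T}) x t : x \in A -> is_linext A t ->
  t x = #|A|.-1 :> nat ->
  maximal A x && is_linext (A :\ x) (restr x t).
Proof.
move=> xA /linextP [h1 h2 h3 h4] tx; apply/andP; split.
  rewrite /maximal xA; apply/forall_inP => v vA; apply/negP => exv.
  have := h4 _ _ xA vA exv; have := h1 _ vA; lia.
have cA : #|A :\ x| = #|A|.-1 by rewrite (cardsD1 x A) xA.
apply/linextP; split.
- move=> u; rewrite !inE ffunE cA => /andP [/negbTE ux uA]; rewrite ux.
  have := h1 _ uA; rewrite leq_eqVlt => /orP [/eqP h|]; last by lia.
  suff : u = x by move/eqP; rewrite ux.
  apply: h3 => //; apply: val_inj => /=; lia.
- by move=> u; rewrite !inE ffunE; case: eqP => //= _ /h2.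
- move=> u v; rewrite !inE !ffunE => /andP [/negbTE -> uA] /andP [/negbTE -> vA].
  exact: h3.
- move=> u v; rewrite !inE !ffunE => /andP [/negbTE -> uA] /andP [/negbTE -> vA].
  exact: h4.
Qed.

Let extend (k : nat) x (t : {ffun T -> 'I_M.+1}) : {ffun T -> 'I_M.+1} :=
  [ffun u => if u == x then inord k else t u].

Lemma linext_add_top (A : {set T}) x t : #|A| <= M.+1 -> maximal A x ->
  is_linext (A :\ x) t -> is_linext A (extend #|A|.-1 x t).
Proof.
move=> AM /andP [xA mx] /linextP [h1 h2 h3 h4].
have A0 : 0 < #|A| by apply/card_gt0P; exists x.
have cA : #|A :\ x| = #|A|.-1 by rewrite (cardsD1 x A) xA.
have iE : (inord #|A|.-1 : 'I_M.+1) = #|A|.-1 :> nat.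
  by rewrite inordK // prednK.
have h1' u : u \in A -> u != x -> t u < #|A|.-1.
  by move=> uA ux; rewrite -cA; apply: h1; rewrite !inE ux.
apply/linextP; split.
- move=> u uA; rewrite ffunE; case: eqP => [_|/eqP ux]; first by rewrite iE ltn_predL.
  by have := h1' _ uA ux; lia.
- move=> u uA; rewrite ffunE; case: eqP => [E|/eqP ux]; first by rewrite E xA in uA.
  by apply: h2; rewrite !inE negb_and uA orbT.
- move=> u v uA vA; rewrite !ffunE; case: eqP => [->|/eqP ux]; case: eqP => [->|/eqP vx] //.
  + move/(congr1 val) => /=; rewrite iE => E; have := h1' _ vA vx; lia.
  + move/(congr1 val) => /=; rewrite iE => E; have := h1' _ uA ux; lia.
  + by apply: h3; rewrite !inE ?ux ?vx.
- move=> u v uA vA euv; rewrite !ffunE; case: eqP => [E|/eqP ux].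
    by move/forall_inP: mx => /(_ v vA); rewrite -E euv.
  case: eqP => [_|/eqP vx]; first by rewrite iE; exact: h1'.
  by apply: h4 => //; rewrite !inE ?ux ?vx.
Qed.

(** The largest label of a linear extension sits on a maximal element, and
    erasing it leaves a linear extension of the rest. *)
Lemma linext_rec (A : {set T}) : A != set0 -> #|A| <= M.+1 ->
  linext A = \sum_(x | maximal A x) linext (A :\ x).
Proof.
move=> A0 AM.
have Agt0 : 0 < #|A| by rewrite card_gt0.
pose S x := [set t | is_linext A t && (t x == #|A|.-1 :> nat)]%SET.
have -> : linext A = \sum_(x in A) #|S x|.
  rewrite /linext -sum1_card.
  under [RHS]eq_bigr => x _ do rewrite -sum1_card.
  rewrite (exchange_big_dep (mem [set t | is_linext A t]%SET)) /=; last first.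
    by move=> x t _; rewrite !inE => /andP [].
  apply: eq_bigr => t; rewrite inE => tA.
  have [x xA tx] := linext_top tA A0.
  rewrite (bigD1 x) /=; last by rewrite xA inE tA tx eqxx.
  rewrite big1 ?addn0 // => y; rewrite inE tA /= => /andP [/andP [yA /eqP ty] yx].
  case/linextP: tA => _ _ h3 _; case/negP: yx; apply/eqP; apply: h3 => //.
  by apply: val_inj; rewrite /= ty tx.
rewrite [RHS](eq_bigl (fun x => (x \in A) && maximal A x)); last first.
  by move=> x; rewrite /maximal andbA andbb.
rewrite [RHS]big_mkcondr /=; apply: eq_bigr => x xA.
case: ifP => mx; last first.
  apply/eqP; rewrite cards_eq0; apply/eqP/setP => t; rewrite !inE.
  apply/negP => /andP [tA /eqP tx].
  by have := linext_rem_top xA tA tx; rewrite mx.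
have -> : S x = extend #|A|.-1 x @: [set t | is_linext (A :\ x) t]%SET.
  apply/setP => t; rewrite inE; apply/idP/imsetP.
    case/andP => tA /eqP tx; exists (restr x t).
      by rewrite inE; case/andP: (linext_rem_top xA tA tx).
    apply/ffunP => u; rewrite !ffunE; case: eqP => [->|//].
    by apply: val_inj; rewrite /= tx inordK // prednK.
  move=> [t']; rewrite inE => t'A ->; rewrite linext_add_top //= ffunE eqxx.
  by rewrite inordK // prednK.
rewrite card_in_imset // => t t'; rewrite !inE => /linextP [_ h _ _] /linextP [_ h' _ _].
move/ffunP => E; apply/ffunP => u; have := E u; rewrite !ffunE.
by case: eqP => // -> _; rewrite h ?h' // !inE eqxx.
Qed.
End LinearExtensions.

(** * An interpolation identity for unit shifts *)

Section Lagrange.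
Import mathcomp.boot.finset.
Variable (R : fieldType).
Local Open Scope ring_scope.

(** The interpolation polynomial of [p] at the nodes [x i] is [p] itself; both
    sides are its coefficient of degree [N.-1]. *)
Lemma lagrange_coef (N : nat) (x : 'I_N -> R) (p : {poly R}) : injective x ->
  (size p <= N)%N ->
  \sum_i p.[x i] * \prod_(k | k != i) (x i - x k)^-1 = p`_N.-1.
Proof.
move=> xinj sp.
pose L i := \prod_(k | k != i) ('X - (x k)%:P) : {poly R}.
pose r := \sum_i (p.[x i] * \prod_(k | k != i) (x i - x k)^-1) *: L i.
have LE i : L i = \prod_(k <- enum [set k | k != i]%SET) ('X - (x k)%:P).
  by rewrite big_enum /=; apply: eq_bigl => k; rewrite inE.
have cardE i : size (enum [set k : 'I_N | k != i]%SET) = N.-1.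
  rewrite -cardE (_ : [set _ | _]%SET = ~: [set i])%SET; last first.
    by apply/setP => k; rewrite !inE.
  by rewrite cardsC1 card_ord.
have sL i : size (L i) = N.
  by rewrite LE size_prod_XsubC cardE prednK // (leq_ltn_trans _ (ltn_ord i)).
have pr : p = r.
  apply/eqP; rewrite -subr_eq0; apply/eqP.
  apply: (@roots_geq_poly_eq0 _ _ [seq x i | i <- enum 'I_N]).
  - apply/allP => _ /mapP [i _ ->]; rewrite rootE hornerD hornerN subr_eq0; apply/eqP.
    rewrite /r horner_sum (bigD1 i) //= [X in _ + X]big1 ?addr0; last first.
      move=> k ki; rewrite hornerZ /L [X in _ * X.[_]](bigD1 i) //=; last by rewrite eq_sym.
      by rewrite hornerM hornerXsubC subrr mul0r mulr0.
    rewrite hornerZ /L horner_prod -mulrA -big_split /= big1 ?mulr1 // => k ki.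
    by rewrite hornerXsubC mulVf // subr_eq0 (inj_eq xinj) eq_sym.
  - by rewrite map_inj_uniq // enum_uniq.
  - rewrite size_map size_enum_ord.
    apply: (leq_trans (size_polyD _ _)); rewrite geq_max sp size_polyN.
    apply: (leq_trans (size_sum _ _ _)); apply/bigmax_leqP => i _.
    by apply: (leq_trans (size_scale_leq _ _)); rewrite sL.
rewrite {2}pr /r coef_sum; apply: eq_bigr => i _; rewrite coefZ.
suff -> : (L i)`_N.-1 = 1 by rewrite mulr1.
have : L i \is monic by apply: monic_prod_XsubC.
by rewrite monicE lead_coefE sL => /eqP.
Qed.

(** [X - size s] is the quotient of [X * \prod (X - y - 1)] by [\prod (X - y)]:
    the two leading terms cancel in [D], and its next coefficient follows by
    induction on [s]. *)
Lemma shift_remainder (s : seq R)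
  (D := 'X * \prod_(y <- s) ('X - (y + 1)%:P)
        - ('X - (size s)%:R%:P) * \prod_(y <- s) ('X - y%:P)) :
  (size D <= size s)%N /\
  D`_(size s).-1 = 'C(size s, 2)%:R - \sum_(y <- s) y.
Proof.
have ringE (P : comNzRingType) (X A B a b : P) :
    X * ((X - (b + 1)) * B) - (X - (a + 1)) * ((X - b) * A) =
    X * (X * B - (X - a) * A) - (b + 1) * (X * B - (X - a) * A) + (a - b) * A.
  by ring.
rewrite {}/D; elim: s => [|y s [IH1 IH2]].
  by rewrite !big_nil !mulr1 subr0 subrr size_poly0 coef0 subrr.
rewrite !big_cons /=.
set A := \prod_(y <- s) ('X - y%:P) in IH1 IH2 *.
set B := \prod_(y <- s) ('X - (y + 1)%:P) in IH1 IH2 *.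
set D := 'X * B - _ in IH1 IH2.
have -> : 'X * (('X - (y + 1)%:P) * B) - ('X - (size s).+1%:R%:P) * (('X - y%:P) * A)
  = 'X * D - (y + 1) *: D + ((size s)%:R - y) *: A.
  rewrite /D -!mul_polyC -natr1 !(polyCD, polyCN, polyC1). exact: ringE.
have sA : size A = (size s).+1 by rewrite size_prod_XsubC.
split.
  apply: (leq_trans (size_polyD _ _)); rewrite geq_max; apply/andP; split; last first.
    by apply: (leq_trans (size_scale_leq _ _)); rewrite sA.
  apply: (leq_trans (size_polyD _ _)); rewrite geq_max size_polyN; apply/andP; split.
    apply: (leq_trans (size_polyMleq _ _)); rewrite size_polyX addSn /=; exact: IH1.
  by apply: (leq_trans (size_scale_leq _ _)); exact: leqW.
have An : A`_(size s) = 1.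
  have : A \is monic by apply: monic_prod_XsubC.
  by rewrite monicE lead_coefE sA => /eqP.
rewrite coefD coefB coefXM !coefZ An (nth_default 0 IH1) mulr0 subr0 mulr1.
rewrite binS bin1 natrD.
case: eqP => [s0|_]; last by rewrite IH2; ring.
by move/size0nil: s0 => ->; rewrite big_nil /= !addr0 bin0n /= !add0r.
Qed.

(** Lagrange interpolation for the polynomial [D] of [shift_remainder]. At the
    node [x i] the subtracted term of [D] vanishes, and the factor of index [i]
    of the other one is [-1]. *)
Lemma shift_identity (N : nat) (x : 'I_N -> R) : injective x ->
  \sum_i x i * \prod_(k | k != i) ((x i - x k - 1) / (x i - x k))
  = \sum_i x i - 'C(N, 2)%:R.
Proof.
move=> xinj.
have sN : size (index_enum 'I_N) = N by rewrite [index_enum _]unlock -enumT size_enum_ord.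
have := shift_remainder [seq x i | i <- index_enum 'I_N].
rewrite size_map sN !big_map.
set D := _ - _ => -[sD cD].
have := lagrange_coef xinj sD; rewrite {}cD => E.
rewrite -[RHS]opprB -E -sumrN; apply: eq_bigr => i _.
rewrite big_split /= mulrA -mulNr; congr (_ * _).
rewrite /D hornerD hornerN !hornerM hornerX !horner_prod.
rewrite [X in _ - _ * X](bigD1 i) //= [('X - (x i)%:P).[_]]hornerXsubC subrr mul0r mulr0 subr0.
rewrite [in RHS](bigD1 i) //= hornerXsubC (_ : x i - _ = -1); last by ring.
rewrite mulN1r mulrN opprK; congr (_ * _).
by apply: eq_bigr => k _; rewrite hornerXsubC opprD addrA.
Qed.

End Lagrange.

(** * Young diagrams and their corners *)

Section Diagrams.
Import mathcomp.boot.finset.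
Local Open Scope nat_scope.

Lemma sorted_geq_nth (l : seq nat) i j : sorted geq l -> i <= j ->
  nth 0 l j <= nth 0 l i.
Proof.
move=> sl ij; case: (ltnP j (size l)) => jl; last by rewrite nth_default.
have tr : transitive geq by move=> a b c /= h1 h2; exact: leq_trans h2 h1.
by apply: (sorted_leq_nth tr leqnn 0 sl) => //; rewrite inE // (leq_ltn_trans ij).
Qed.

Lemma sumn_nth_widen (l : seq nat) K : (forall i, K <= i -> nth 0 l i = 0) ->
  \sum_(i < K) nth 0 l i = sumn l.
Proof.
move=> h; rewrite sumnE (big_nth 0) big_mkord.
rewrite (big_ord_widen (maxn K (size l)) (nth 0 l)) ?leq_maxl //.
rewrite [RHS](big_ord_widen (maxn K (size l)) (nth 0 l)) ?leq_maxr //.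
rewrite big_mkcond [RHS]big_mkcond /=; apply: eq_bigr => i _.
case: ltnP => [iK|/h ->]; case: ltnP => // /(nth_default 0) -> //.
Qed.

(** The rows up to [i] are at least as long as row [i]. *)
Lemma sorted_geq_sumn (l : seq nat) i : sorted geq l -> i.+1 * nth 0 l i <= sumn l.
Proof.
elim: l i => [|j l IH] i sl; first by rewrite nth_nil muln0.
case: i => [|i]; first by rewrite mul1n leq_addr.
rewrite /= mulSn leq_add ?IH ?(path_sorted sl) //.
exact: (@sorted_geq_nth (j :: l) 0 i.+1).
Qed.

Definition diagram (M : nat) (l : seq nat) : {set 'I_M * 'I_M} :=
  [set u : 'I_M * 'I_M | u.2 < nth 0 l u.1].

Definition box_lt (M : nat) (u v : 'I_M * 'I_M) : bool :=
  ((u.1 == v.1) && (u.2 < v.2)) || ((u.2 == v.2) && (u.1 < v.1)).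

Definition remove_box (l : seq nat) (i : nat) : seq nat := set_nth 0 l i (nth 0 l i).-1.

Lemma nth_remove_box l i k : i < size l ->
  nth 0 (remove_box l i) k = nth 0 l k - (k == i).
Proof.
move=> il; rewrite nth_set_nth /=; case: eqP => [->|]; lia.
Qed.

Lemma row_le_sumn (l : seq nat) i : nth 0 l i <= sumn l.
Proof.
elim: l i => [|j l IH] [|i] //=; first by rewrite leq_addr.
exact: leq_trans (IH i) (leq_addl _ _).
Qed.

Lemma sorted_row0 (l : seq nat) i M : sorted geq l -> sumn l <= M -> M <= i ->
  nth 0 l i = 0.
Proof. move=> sl sM Mi; have := sorted_geq_sumn i sl; nia. Qed.

Lemma card_diagram (l : seq nat) M : sorted geq l -> sumn l <= M ->
  #|diagram M l| = sumn l.
Proof.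
move=> sl sM; rewrite -sum1_card.
under eq_bigl => u do rewrite inE.
rewrite -(pair_big_dep xpredT (fun i j : 'I_M => j < nth 0 l i) (fun _ _ => 1)) /=.
rewrite -(@sumn_nth_widen l M); last by move=> i; apply: sorted_row0.
apply: eq_bigr => i _.
rewrite -(big_ord_widen M (fun=> 1)) ?sum_nat_const ?card_ord ?muln1 //.
exact: leq_trans (row_le_sumn _ _) sM.
Qed.

Lemma diagram_remove_box l i M (x : 'I_M * 'I_M) : i < size l ->
  x.1 = i :> nat -> x.2 = (nth 0 l i).-1 :> nat -> 0 < nth 0 l i ->
  diagram M (remove_box l i) = diagram M l :\ x.
Proof.
move=> il x1 x2 li; apply/setP => u; rewrite !inE nth_remove_box //.
have -> : (u == x) = (u.1 == i :> nat) && (u.2 == (nth 0 l i).-1 :> nat).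
  by case: u x x1 x2 => a b [c d] /= <- <-; rewrite xpair_eqE.
case: eqP => [->|] /=; lia.
Qed.

Lemma sumn_remove_box l i : i < size l -> 0 < nth 0 l i ->
  sumn (remove_box l i) = (sumn l).-1.
Proof.
elim: l i => [|j l IH] [|i] //= il li; first lia.
rewrite IH //; have := row_le_sumn l i; lia.
Qed.

Lemma size_remove_box l i : i < size l -> size (remove_box l i) = size l.
Proof. by move=> il; rewrite size_set_nth; apply/maxn_idPr. Qed.

Lemma sorted_remove_box l i : sorted geq l -> i < size l ->
  nth 0 l i.+1 < nth 0 l i -> sorted geq (remove_box l i).
Proof.
move=> sl il li; apply/(sortedP 0) => k; rewrite size_remove_box // => kl /=.
rewrite !nth_remove_box //.
have := sorted_geq_nth sl (leqnSn k).
case: (eqVneq k i) => [->|]; case: (eqVneq k.+1 i) => [E|]; lia.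
Qed.

(** The maximal boxes of a diagram are its corners, which sit at the end of the
    rows longer than the next one. *)
Lemma linext_diagram_rec (l : seq nat) M : sorted geq l -> 0 < sumn l <= M ->
  linext (@box_lt M) M (diagram M l) =
  \sum_(i < size l | nth 0 l i.+1 < nth 0 l i)
     linext (@box_lt M) M (diagram M (remove_box l i)).
Proof.
move=> sl /andP [s0 sM].
have row0 := @sorted_row0 l _ M sl sM.
rewrite linext_rec; last 2 first.
- by rewrite -card_gt0 card_diagram.
- by rewrite card_diagram // ltnW.
have lM i : nth 0 l i <= M := leq_trans (row_le_sumn l i) sM.
pose h (i : 'I_M) : 'I_M * 'I_M := (i, insubd i (nth 0 l i).-1).
have hE (i : 'I_M) : 0 < nth 0 l i -> (h i).2 = (nth 0 l i).-1 :> nat.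
  by move=> li; rewrite val_insubd prednK // lM.
have maxE x : maximal (@box_lt M) (diagram M l) x =
    (nth 0 l x.1.+1 < nth 0 l x.1) && (x == h x.1).
  case: x => a b; rewrite /maximal !inE /=; apply/andP/andP => /=.
    case=> bl /forall_inP mx.
    have b2 : (b = (nth 0 l a).-1 :> nat).
      apply/eqP; rewrite eqn_leq; apply/andP; split; first lia.
      rewrite leqNgt; apply/negP => bl'.
      have b'M : b.+1 < M by have := lM a; lia.
      have := mx (a, Ordinal b'M); rewrite !inE /box_lt /= eqxx ltnSn /=.
      by move=> /(_ ltac:(lia)).
    split; last first.
      by rewrite -pair_eqE /= eqxx /=; apply/eqP/val_inj; rewrite /= hE ?b2 //; lia.
    rewrite ltnNge; apply/negP => la.
    have a'M : a.+1 < M.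
      by rewrite ltnNge; apply/negP => /row0; lia.
    have := mx (Ordinal a'M, b); rewrite !inE /box_lt /= eqxx ltnSn /= orbT.
    by move=> /(_ ltac:(lia)).
  case=> la /eqP [Eb]; have l0 : 0 < nth 0 l a by lia.
  have b2 := hE _ l0; rewrite /h /= -Eb in b2; rewrite b2; split; first lia.
  apply/forall_inP => -[c d]; rewrite inE /box_lt /= => dl; apply/negP.
  case/orP => /andP [/eqP E lt]; first by rewrite -E in dl; lia.
  have := sorted_geq_nth sl lt; rewrite -E in dl; lia.
rewrite (reindex_onto h fst) /=; last first.
  by move=> x; rewrite maxE => /andP [_ /eqP <-].
under eq_bigl => i do rewrite maxE /= !eqxx !andbT.
transitivity (\sum_(i < M | (nth 0 l i.+1 < nth 0 l i) && (i < size l))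
   linext (@box_lt M) M (diagram M (remove_box l i))).
  apply: eq_big => i.
    case: (ltnP i (size l)); rewrite ?andbT // => /(nth_default 0) ->; lia.
  move=> li; have il : i < size l by rewrite ltnNge; apply/negP => /(nth_default 0); lia.
  by rewrite (diagram_remove_box (x := h i) il) ?hE //; lia.
pose F i := linext (@box_lt M) M (diagram M (remove_box l i)).
pose P i := nth 0 l i.+1 < nth 0 l i.
rewrite -[LHS]/(\sum_(i < M | P i && (i < size l)) F i).
rewrite -[RHS]/(\sum_(i < size l | P i) F i).
rewrite (big_ord_widen_cond (maxn M (size l)) (fun i => P i && (i < size l)) F)
  ?leq_maxl //.
rewrite (big_ord_widen_cond (maxn M (size l)) P F) ?leq_maxr //.
apply: eq_bigl => i; rewrite andbAC; case: (ltnP i M) => [|/row0]; rewrite ?andbT //.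
by rewrite /P => ->; rewrite ltn0.
Qed.

End Diagrams.

(** * The hook length formula in terms of shifted parts *)

Section HookLengthFormula.
Import mathcomp.boot.finset.
Variable R : numFieldType.
Local Open Scope ring_scope.

(** The first-column hook lengths, when no part is 0. They are distinct for
    every partition, and removing a corner lowers one of them by 1. *)
Fixpoint shifted (l : seq nat) : seq nat :=
  if l is j :: mu then (j + size mu)%N :: shifted mu else [::].

(** The Frobenius form of the hook length formula, without its factor [n`!]. *)
Fixpoint syt_weight (x : seq nat) : R :=
  if x is x0 :: xs then (\prod_(y <- xs) (x0%:R - y%:R)) / x0`!%:R * syt_weight xs
  else 1.

Lemma size_shifted l : size (shifted l) = size l.
Proof. by elim: l => //= j l ->. Qed.

Lemma nth_shifted l i : (i < size l)%N ->
  nth 0%N (shifted l) i = (nth 0%N l i + (size l - i.+1))%N.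
Proof. by elim: l i => [|j l IH] [|i] //= il; rewrite ?IH // ?subSS ?subn0. Qed.

Lemma shifted_remove_box l i : (i < size l)%N -> (0 < nth 0%N l i)%N ->
  shifted (remove_box l i) = remove_box (shifted l) i.
Proof.
elim: l i => [|j l IH] [|i] //= il li; first by rewrite /remove_box /=; congr (_ :: _); lia.
rewrite /remove_box /= in IH *; rewrite IH // size_set_nth; congr (_ :: _).
by rewrite (maxn_idPr _).
Qed.

Lemma uniq_shifted l : sorted geq l -> uniq (shifted l).
Proof.
elim: l => [//|j l IH] sl /=; rewrite IH ?(path_sorted sl) // andbT.
apply/negP => /(nthP 0%N) [i]; rewrite size_shifted => il.
rewrite nth_shifted // => E.
have /= := @sorted_geq_nth (j :: l) 0%N i.+1 sl (leq0n _). lia.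
Qed.

Lemma prod_remove_box (x : seq nat) i (f : nat -> R) : (i < size x)%N ->
  (\prod_(y <- remove_box x i) f y) * f (nth 0%N x i) =
  (\prod_(y <- x) f y) * f (nth 0%N x i).-1.
Proof.
elim: x i => [//|x0 xs IH] [|i] /= il; rewrite /remove_box /= !big_cons.
  by rewrite mulrAC [RHS]mulrAC mulrC [in RHS]mulrC [f _.-1 * _]mulrC !mulrA.
by rewrite -!mulrA -/(remove_box xs i) IH.
Qed.

Lemma syt_weight_remove_box (x : seq nat) i (a := nth 0%N x i) : uniq x ->
  (i < size x)%N -> (0 < a)%N ->
  syt_weight (remove_box x i) = syt_weight x * (a%:R *
    \prod_(y <- x | y != a) ((a%:R - y%:R - 1) / (a%:R - y%:R))).
Proof.
rewrite {}/a; elim: x i => [//|x0 xs IH] i /= /andP [x0xs uxs].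
have natrB0 (b c : nat) : b != c -> b%:R - c%:R != 0 :> R.
  by move=> bc; rewrite subr_eq0 eqr_nat.
case: i => [|i] /= ix a0.
  case: x0 x0xs a0 => // x0 x0xs _.
  rewrite big_cons /= eqxx /= /remove_box /=.
  have -> : \prod_(y <- xs | y != x0.+1) ((x0.+1%:R - y%:R - 1) / (x0.+1%:R - y%:R))
     = (\prod_(y <- xs) (x0%:R - y%:R)) / \prod_(y <- xs) (x0.+1%:R - y%:R) :> R.
    rewrite -prodfV -big_split big_seq_cond [RHS]big_seq_cond.
    apply: eq_big => y.
      by rewrite andbT; case: (boolP (y \in xs)) => //= yx; apply: contra x0xs => /eqP <-.
    by move=> _; congr (_ / _); rewrite -natr1; ring.
  have P0 : \prod_(y <- xs) (x0.+1%:R - y%:R) != 0 :> R.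
    rewrite prodf_seq_neq0; apply/allP => y yx; apply/implyP => _; apply: natrB0.
    by apply: contra x0xs => /eqP ->.
  rewrite factS natrM; field.
  by rewrite P0 addrC natr1 !pnatr_eq0 -lt0n fact_gt0.
set a := nth 0%N xs i.
have ax : a \in xs by apply: mem_nth.
have x0a : x0 != a by apply: contra x0xs => /eqP ->.
rewrite big_cons /= x0a /remove_box /= -/(remove_box xs i) IH // -/a.
have /(canRL (mulfK (natrB0 _ _ x0a))) -> :=
  prod_remove_box (fun y => x0%:R - y%:R) (ix : (i < size xs)%N).
rewrite -/a; set Q := \prod_(y <- xs | _) _.
have -> : a.-1%:R = a%:R - 1 :> R by rewrite -subn1 natrB.
have h1 := natrB0 _ _ x0a; have h2 : a%:R - x0%:R != 0 :> R by rewrite -opprB oppr_eq0.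
have h3 : x0`!%:R != 0 :> R by rewrite pnatr_eq0 -lt0n fact_gt0.
field; rewrite h1 h3 h2 //.
Qed.

(** By the shift identity; the rows which end no corner contribute a vanishing
    factor, since the next shifted part is smaller by 1. *)
Lemma syt_weight_rec (l : seq nat) : sorted geq l ->
  \sum_(i < size l | (nth 0%N l i.+1 < nth 0%N l i)%N)
     syt_weight (shifted (remove_box l i)) =
  (sumn l)%:R * syt_weight (shifted l).
Proof.
move=> sl; set x := shifted l; pose N := size l.
have ux : uniq x by exact: uniq_shifted.
have sx : size x = N by exact: size_shifted.
pose X (i : 'I_N) : R := (nth 0%N x i)%:R.
have Xinj : injective X.
  move=> i k /eqP; rewrite eqr_nat nth_uniq ?sx // => /eqP E; exact: val_inj.
pose T (i : 'I_N) := X i * \prod_(k | k != i) ((X i - X k - 1) / (X i - X k)).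
transitivity (\sum_(i < N) syt_weight x * T i).
  rewrite big_mkcond; apply: eq_bigr => i _; case: ifPn => [li|].
    have xi : (0 < nth 0%N x i)%N by rewrite nth_shifted //; lia.
    rewrite shifted_remove_box //; last lia.
    rewrite syt_weight_remove_box ?sx //; congr (_ * (_ * _)).
    rewrite (big_nth 0%N) big_mkord sx; apply: eq_bigl => k.
    by rewrite nth_uniq ?sx.
  rewrite -leqNgt => li; have {}li : nth 0%N l i.+1 = nth 0%N l i.
    by apply/eqP; rewrite eqn_leq li andbT; apply: sorted_geq_nth.
  case: (ltnP i.+1 N) => iN; last first.
    have l0 : nth 0%N l i = 0%N by rewrite -li nth_default.
    have x0 : nth 0%N x i = 0%N by rewrite nth_shifted // l0; lia.
    by rewrite /T /X x0 mul0r mulr0.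
  have ki : Ordinal iN != i by rewrite -val_eqE /= neq_ltn ltnSn orbT.
  rewrite /T (bigD1 (Ordinal iN) ki) /= (_ : X i - _ - 1 = 0) ?mul0r ?mulr0 //.
  rewrite /X !nth_shifted //= li (_ : size l - i.+1 = (size l - i.+2).+1)%N; last by lia.
  by rewrite !natrD -[in X in X - _ - _](natr1 _); ring.
rewrite -mulr_sumr mulrC shift_identity //; congr (_ * _).
apply/eqP; rewrite subr_eq -natrD /X -natr_sum eqr_nat; apply/eqP.
rewrite -sx -(big_mkord xpredT (nth 0%N x)) -(big_nth 0%N xpredT id) -sumnE sx /N /x.
elim: {sl X Xinj T ux sx x N} l => //= j l ->; rewrite binS bin1; lia.
Qed.

(** Removing all boxes leaves the rows behind, with length 0. *)
Lemma syt_weight_zeros n : syt_weight (shifted (nseq n 0%N)) = 1.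
Proof.
have H m a : (\prod_(y <- shifted (nseq m 0%N)) ((m + a)%:R - y%:R)) * a`!%:R
     = (m + a)`!%:R :> R.
  elim: m a => [|m IH] a; first by rewrite big_nil mul1r.
  rewrite /= big_cons size_nseq add0n.
  rewrite (_ : (m.+1 + a)%:R - m%:R = a.+1%:R); last first.
    by rewrite -natrB; [congr (_%:R); lia|lia].
  by rewrite mulrAC -natrM -factS mulrC addSnnS IH.
elim: n => //= n ->; rewrite size_nseq add0n mulr1.
have := H n 0%N; rewrite addn0 fact0 mulr1 => ->.
by rewrite divff // pnatr_eq0 -lt0n fact_gt0.
Qed.

(** Both sides satisfy the same recursion over corners. *)
Lemma linext_diagram (l : seq nat) M : sorted geq l -> (sumn l <= M)%N ->
  (linext (@box_lt M) M (diagram M l))%:R =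
  (sumn l)`!%:R * syt_weight (shifted l).
Proof.
move En : (sumn l) => n; elim: n l En => [|n IH] l En sl nM.
  have l0 : l = nseq (size l) 0%N.
    apply: (@eq_from_nth _ 0%N); rewrite ?size_nseq // => i il.
    by rewrite nth_nseq il; have := row_le_sumn l i; lia.
  rewrite l0 syt_weight_zeros fact0 mulr1 (_ : diagram M _ = set0) ?linext0 //.
  apply/setP => u; rewrite !inE nth_nseq; case: ifP; rewrite ltn0 //.
rewrite linext_diagram_rec ?En // natr_sum.
rewrite factS natrM mulrAC -En -syt_weight_rec // mulr_suml.
apply: eq_bigr => i li; rewrite IH //; first by rewrite mulrC.
- by rewrite sumn_remove_box // ?En //; lia.
- exact: sorted_remove_box.
- exact: ltnW.
Qed.
End HookLengthFormula.

(** * Standard tableaux as linear extensions *)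

Section Dimension.
Import mathcomp.boot.finset.
Local Open Scope nat_scope.

Lemma dim_part_linext (l : seq nat) : sorted geq l ->
  dim_part l = linext (@box_lt (sumn l)) (sumn l) (diagram (sumn l) l).
Proof.
move=> sl; set n := sumn l.
have cD : #|diagram n l| = n by exact: card_diagram.
pose psi (t : {ffun box l -> 'I_n}) : {ffun 'I_n * 'I_n -> 'I_n.+1} :=
  [ffun u => if insub u is Some b then widen_ord (leqnSn n) (t b) else ord0].
have psiE t (b : box l) : psi t (val b) = t b :> nat by rewrite ffunE valK.
have psi_inj : injective psi.
  move=> t t' E; apply/ffunP => b; apply: val_inj => /=; by rewrite -!psiE E.
have inD (u : 'I_n * 'I_n) : (u \in diagram n l) = (u.2 < nth 0 l u.1) by rewrite inE.
have subD u : u \in diagram n l -> exists b : box l, val b = u.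
  by rewrite inD => ub; exists (exist _ u ub).
have boxD (b : box l) : val b \in diagram n l by rewrite inD (valP b).
rewrite /dim_part -(card_imset _ psi_inj); apply: eq_card => t.
rewrite [in RHS]inE; apply/imsetP/idP => [[s]|].
  rewrite inE => /and3P [/injectiveP sinj /forallP srow /forallP scol ->].
  apply/linextP; split.
  - by move=> u /subD [b <-]; rewrite psiE cD.
  - by move=> u; rewrite inD ffunE => ub; rewrite insubN.
  - move=> u v /subD [b <-] /subD [c <-] /(congr1 val) /=; rewrite !psiE => E.
    by congr (val _); apply: sinj; apply: val_inj.
  - move=> u v /subD [b <-] /subD [c <-] /orP [] h; rewrite !psiE.
      by have /forallP /(_ c) := srow b; rewrite h.
    by have /forallP /(_ c) := scol b; rewrite h.
move=> /linextP; rewrite cD => -[h1 h2 h3 h4].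
pose s : {ffun box l -> 'I_n} := [ffun b => insubd (val b).1 (t (val b) : nat)].
have sE b : s b = t (val b) :> nat by rewrite ffunE val_insubd h1.
exists s; last first.
  apply/ffunP => u; apply: val_inj => /=; case: (boolP (u \in diagram n l)).
    by move=> /subD [b <-]; rewrite psiE sE.
  by move=> uD; rewrite h2 // ffunE insubN // -inD.
rewrite inE; apply/and3P; split.
- apply/injectiveP => b c /(congr1 val) /=; rewrite !sE => E.
  by apply: val_inj; apply: h3 => //; apply: val_inj.
- apply/forallP => b; apply/forallP => c; apply/implyP => h.
  by rewrite !sE h4 // /box_lt h.
- apply/forallP => b; apply/forallP => c; apply/implyP => h.
  by rewrite !sE h4 // /box_lt h orbT.
Qed.

Local Open Scope ring_scope.

Lemma dim_partE (R : numFieldType) (l : seq nat) : sorted geq l ->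
  (dim_part l)%:R = (sumn l)`!%:R * syt_weight R (shifted l) :> R.
Proof. by move=> sl; rewrite dim_part_linext // linext_diagram. Qed.

(** Deleting the first entry of the shifted parts deletes from [syt_weight] the
    differences with that entry; comparing them with a quotient of factorials
    leaves the product over the remaining rows. *)
Lemma dim_part_cons (R : numFieldType) j mu : sorted geq (j :: mu) ->
  (dim_part (j :: mu))%:R = 'C(j + sumn mu, j)%:R * (dim_part mu)%:R *
    \prod_(r < size mu) (1 - (nth 0%N mu r)%:R / (j + r.+1)%:R) :> R.
Proof.
move=> sl; have smu := path_sorted sl.
rewrite !dim_partE //= -(bin_fact (leq_addr (sumn mu) j)) addKn.
have fact0 k : k`!%:R != 0 :> R by rewrite pnatr_eq0 -lt0n fact_gt0.
have -> : \prod_(y <- shifted mu) ((j + size mu)%:R - y%:R) =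
   j`!%:R^-1 * (j + size mu)`!%:R *
   \prod_(r < size mu) (1 - (nth 0%N mu r)%:R / (j + r.+1)%:R) :> R.
  have -> : j`!%:R^-1 * (j + size mu)`!%:R = \prod_(r < size mu) (j + r.+1)%:R :> R.
    elim: (size mu) => [|N IH]; first by rewrite addn0 big_ord0 mulVf.
    by rewrite big_ord_recr /= -IH addnS factS natrM mulrA mulrAC.
  rewrite -big_split /= (big_nth 0%N) big_mkord size_shifted; apply: eq_bigr => r _.
  rewrite nth_shifted // mulrBr mulr1 mulrCA divff ?mulr1; last first.
    by rewrite pnatr_eq0 addnS.
  have := ltn_ord r; move: (nat_of_ord r) => k kN.
  by rewrite !natrD natrB //; ring.
rewrite !natrM; field; by rewrite !fact0.
Qed.
End Dimension.

(** * Removing the first row of a partition *)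

Section RowDecomposition.
Local Open Scope classical_set_scope.
Local Open Scope ring_scope.
Variables (R : realType) (q : R).
Hypotheses (q0 : 0 < q) (q1 : q < 1).

Lemma qX_bounds m : 0 < q ^+ m <= 1.
Proof. by rewrite exprn_gt0 //= exprn_ile1 // ltW. Qed.

Lemma one_sub_qX_gt0 m : (0 < m)%N -> 0 < 1 - q ^+ m.
Proof. by move=> m0; rewrite subr_gt0 exprn_ilt1 // ?ltW // -lt0n. Qed.

Lemma b_stat_cons j mu : b_stat (j :: mu) = (sumn mu + b_stat mu)%N.
Proof.
rewrite /b_stat /= big_ord_recl mul0n add0n sumnE (big_nth 0%N) big_mkord -big_split.
by apply: eq_bigr => i _; rewrite /= /bump /= add1n mulSn.
Qed.

Lemma hook_cons j mu i c : (c < j)%N -> hook (j :: mu) i.+1 c = hook mu i c.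
Proof. by move=> cj; rewrite /hook /conj_part /= cj add1n subSS. Qed.

Lemma hook_first_row j mu c : (c < j)%N ->
  hook (j :: mu) 0 c = (j - c + conj_part mu c)%N.
Proof. move=> cj; rewrite /hook /conj_part /= cj; lia. Qed.

(** The weight by which the first row of a random partition deviates from a
    binomial variable independent of the remaining rows. *)
Definition row_corr (j : nat) (mu : seq nat) : R :=
  if (0 < j)%N && (head 0%N mu <= j)%N then
    (\prod_(r < size mu) (1 - (nth 0%N mu r)%:R / (j + r.+1)%:R)) *
    (\prod_(c < j) (1 - q ^+ (j - c + conj_part mu c)%N))^-1
  else 0.

Definition binom_weight (n j : nat) : R :=
  'C(n, j)%:R * ((1 - q) ^+ j * q ^+ (n - j)%N).

Lemma sorted_cons_head j mu : sorted geq (j :: mu) = (head 0%N mu <= j)%N && sorted geq mu.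
Proof. by case: mu. Qed.

(** The other rows keep their hooks. The hooks of the first row give the
    q-product of the correction, with a factor [(1 - q) ^+ j] from the
    q-integers, and the dimension gives the binomial coefficient and the other
    product. *)
Lemma qplancherel_cons j mu : (0 < j)%N -> sorted geq (j :: mu) ->
  qplancherel q (j :: mu) =
  binom_weight (j + sumn mu) j * (qplancherel q mu * row_corr j mu).
Proof.
move=> j0 sl; have := sl; rewrite sorted_cons_head => /andP [hj smu].
rewrite /qplancherel /row_corr /binom_weight j0 hj dim_part_cons // b_stat_cons /=.
rewrite big_ord_recl /= addKn.
under [X in q ^+ _ / (_ * X)]eq_bigr => i _.
  under eq_bigr => c _.
    rewrite hook_cons; last first.
      have /= := @sorted_geq_nth (j :: mu) 0%N i.+1 sl (leq0n _).
      by apply: leq_trans.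
    over.
  over.
have -> : \prod_(c < j) qint q (hook (j :: mu) 0 c) =
   (\prod_(c < j) (1 - q ^+ (j - c + conj_part mu c)%N)) / (1 - q) ^+ j.
  rewrite -[X in _ / _ ^+ X]card_ord -prodr_const -prodf_div; apply: eq_bigr => c _.
  by rewrite hook_first_row // /qint -mulrNN -invrN !opprB.
rewrite invfM invf_div exprD; ring.
Qed.

Lemma prod_one_sub_ge (I : Type) (s : seq I) (a : I -> R) :
  (forall i, 0 <= a i <= 1) -> 1 - \sum_(i <- s) a i <= \prod_(i <- s) (1 - a i) <= 1.
Proof.
move=> ha; elim: s => [|i s /andP [IH1 IH2]]; first by rewrite !big_nil subr0 lexx.
rewrite !big_cons; have /andP [h0 h1] := ha i.
have S0 : 0 <= \sum_(k <- s) a k by apply: sumr_ge0 => k _; case/andP: (ha k).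
have P0 : 0 <= \prod_(k <- s) (1 - a k).
  by apply: prodr_ge0 => k _; rewrite subr_ge0; case/andP: (ha k).
set S := \sum_(_ <- _) _ in IH1 S0 *; set P := \prod_(_ <- _) _ in IH1 IH2 P0 *.
by apply/andP; split; nra.
Qed.

(** Positivity of the infinite product of the [1 - q ^+ m.+1]: beyond a rank
    [m0] where the remaining powers sum to at most [1 / 2], the product bound
    [prod_one_sub_ge] applies. *)
Lemma qpoch_lb : exists2 kappa : R, 0 < kappa &
  forall n, kappa <= \prod_(m < n) (1 - q ^+ m.+1).
Proof.
have [m0 hm0] : exists m0, q ^+ m0.+1 / (1 - q) <= 1 / 2.
  have : (fun m => q ^+ m) @ \oo --> (0 : R).
    by apply: cvg_expr; rewrite ger0_norm // ltW.
  move=> /cvgrPdist_lt /(_ ((1 - q) / 2)).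
  have e0 : 0 < (1 - q) / 2 by rewrite divr_gt0 // subr_gt0.
  move=> /(_ e0) [m0 _ /(_ m0.+1 (leqnSn _))] /=.
  rewrite sub0r normrN ger0_norm ?exprn_ge0 ?ltW // => h; exists m0.
  by rewrite ler_pdivrMr ?subr_gt0 //; lra.
pose k0 := \prod_(m < m0) (1 - q ^+ m.+1).
have k00 : 0 < k0 by apply: prodr_gt0 => m _; exact: one_sub_qX_gt0.
have f01 m : 0 <= q ^+ m.+1 <= 1 by have /andP [/ltW -> ->] := qX_bounds m.+1.
have tail n : 1 / 2 <= \prod_(m < n) (1 - q ^+ (m0 + m).+1).
  have /andP [h _] := @prod_one_sub_ge _ (index_enum 'I_n) (fun m : 'I_n => q ^+ (m0 + m).+1) (fun i => f01 _).
  apply: le_trans h.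
  have -> : \sum_(m < n) q ^+ (m0 + m).+1 = q ^+ m0.+1 / (1 - q) * (1 - q ^+ n).
    have -> : 1 - q ^+ n = (1 - q) * \sum_(m < n) q ^+ m by rewrite -opprB subrX1 -mulNr opprB.
    rewrite mulrA divfK ?gt_eqF ?subr_gt0 // mulr_sumr; apply: eq_bigr => m _.
    by rewrite -addSn exprD.
  have /andP [h1 h2] := qX_bounds n.
  have := divr_ge0 (exprn_ge0 m0.+1 (ltW q0)) (_ : 0 <= 1 - q); rewrite subr_ge0 => /(_ (ltW q1)).
  set A := q ^+ m0.+1 / (1 - q) in hm0 *; move=> A0.
  have : A * (1 - q ^+ n) <= A by rewrite ler_piMr // gerBl ltW.
  by move: (A * _) hm0 => B; lra.
exists (k0 * (1 / 2)); first by rewrite mulr_gt0 // divr_gt0.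
move=> n.
apply: (@le_trans _ _ (\prod_(m < m0 + n) (1 - q ^+ m.+1))); last first.
  rewrite addnC big_split_ord /= ler_piMr //.
    by apply: prodr_ge0 => m _; rewrite subr_ge0; case/andP: (f01 m).
  by have /andP [_] := @prod_one_sub_ge _ (index_enum 'I_m0)
    (fun m : 'I_m0 => q ^+ (n + m).+1) (fun i => f01 _).
rewrite big_split_ord /= ler_pM2l //; exact: tail.
Qed.

Lemma prod_head_shift (f : nat -> R) n : \prod_(c < n) f (n - c)%N = \prod_(m < n) f m.+1.
Proof.
rewrite [LHS](reindex_inj rev_ord_inj) /=; apply: eq_bigr => m _; congr f.
by have := ltn_ord m; lia.
Qed.

Lemma conj_part_small mu c : sorted geq mu -> (head 0%N mu <= c)%N -> conj_part mu c = 0%N.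
Proof.
move=> smu h; rewrite /conj_part; apply/eqP; rewrite -leqn0 leqNgt -has_count.
apply/hasPn => r /(nthP 0%N) [i _ <-]; rewrite -leqNgt.
by apply: leq_trans h; rewrite -nth0; apply: sorted_geq_nth.
Qed.

(** The first product is at most 1. Raising the exponents by [conj_part] only
    increases the second one, so that it stays above the constant of
    [qpoch_lb]. *)
Lemma row_corr_ub : exists c : R, forall j mu, sorted geq mu -> 0 <= row_corr j mu <= c.
Proof.
have [kappa k0 hk] := qpoch_lb; exists kappa^-1 => j mu smu.
rewrite /row_corr; case: ifP => [/andP [j0 hj]|_]; last by rewrite lexx invr_ge0 ltW.
have f01 (r : 'I_(size mu)) : 0 <= ((nth 0%N mu r)%:R / (j + r.+1)%:R : R) <= 1.
  rewrite divr_ge0 //= ler_pdivrMr ?mul1r ?ltr0n ?addnS // ler_nat.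
  by rewrite (leq_trans (sorted_geq_nth smu (leq0n r))) // nth0; lia.
set P1 := \prod_(r < size mu) _; set P2 := \prod_(c < j) _.
have P1b : 0 <= P1 <= 1.
  apply/andP; split; last by case/andP: (prod_one_sub_ge (index_enum 'I_(size mu)) f01).
  by apply: prodr_ge0 => r _; rewrite subr_ge0; case/andP: (f01 r).
have P2b : kappa <= P2.
  apply: (le_trans (hk j)); rewrite -(@prod_head_shift (fun m => 1 - q ^+ m)).
  apply: ler_prod => c _; have := ltn_ord c => cj.
  have h1 k : q ^+ k <= 1 by case/andP: (qX_bounds k).
  have h0 k : 0 <= q ^+ k by rewrite exprn_ge0 // ltW.
  by apply/andP; split; rewrite ?subr_ge0 // lerB // exprD ler_piMr.
have P20 : 0 < P2 := lt_le_trans k0 P2b.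
have P2v : P2^-1 <= kappa^-1 by rewrite lef_pV2.
have P2v0 : 0 < P2^-1 by rewrite invr_gt0.
case/andP: P1b => P10 P11; apply/andP; split; first by rewrite mulr_ge0 // ltW.
by apply: le_trans P2v; rewrite ler_piMl // ltW.
Qed.

(** When the first row exceeds the second one by [K], its last [K] columns have
    hook lengths [1, ..., K]; their factors are paired with the first [K] rows
    of [mu]. The other columns are bounded by 1, and the other rows by
    [prod_one_sub_ge]. *)
Lemma row_corr_lb K j mu : sorted geq mu -> (0 < j)%N -> (head 0%N mu + K <= j)%N ->
  \prod_(r < K) ((1 - (nth 0%N mu r)%:R / j%:R) / (1 - q ^+ r.+1)) *
    (1 - (sumn mu - \sum_(r < K) nth 0%N mu r)%N%:R / j%:R) <= row_corr j mu.
Proof.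
move=> smu j0 hK; rewrite /row_corr j0 (leq_trans (leq_addr _ _) hK) /=.
have jR : 0 < j%:R :> R by rewrite ltr0n.
have muj r : (nth 0%N mu r <= j)%N.
  by apply: leq_trans (leq_trans (leq_addr K _) hK); rewrite -nth0 sorted_geq_nth.
pose a r : R := (nth 0%N mu r)%:R / (j + r.+1)%:R.
pose b r : R := (nth 0%N mu r)%:R / j%:R.
have b01 r : 0 <= b r <= 1 by rewrite divr_ge0 //= ler_pdivrMr ?mul1r // ler_nat.
have ab r : 0 <= a r <= b r.
  rewrite divr_ge0 //= ler_wpM2l ?ler0n // lef_pV2 ?posrE ?ltr0n ?addnS //.
  by rewrite ler_nat leqW // leq_addr.
have a01 r : 0 <= a r <= 1.
  by have /andP [-> /le_trans ->] := ab r; case/andP: (b01 r).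
have a_default r : (size mu <= r)%N -> nth 0%N mu r = 0%N by exact: nth_default.
set L := 1 - _ / _.
have LE : L = 1 - \sum_(r < size mu) b (K + r)%N.
  rewrite /L; congr (1 - _); rewrite /b -mulr_suml -natr_sum; congr (_%:R / _).
  rewrite -(@sumn_nth_widen mu (K + size mu)); last first.
    by move=> i h; apply: a_default; lia.
  by rewrite big_split_ord /= addKn.
have -> : \prod_(r < size mu) (1 - (nth 0%N mu r)%:R / (j + r.+1)%:R)
   = \prod_(r < K) (1 - a r) * \prod_(r < size mu) (1 - a (K + r)%N).
  rewrite -(@big_split_ord _ _ _ K (size mu) xpredT (fun r => 1 - a r)) /= addnC.
  rewrite big_split_ord /= [X in _ * X]big1 ?mulr1 // => i _.
  by rewrite /a a_default ?leq_addr // mul0r subr0.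
set A := \prod_(r < K) (1 - a r); set B := \prod_(r < size mu) _.
have A0 : 0 <= A by apply: prodr_ge0 => r _; rewrite subr_ge0; case/andP: (a01 r).
have LB : L <= B.
  have /andP [h _] := @prod_one_sub_ge _ (index_enum 'I_(size mu))
     (fun r : 'I_(size mu) => a (K + r)%N) (fun r => a01 _).
  apply: le_trans h; rewrite LE lerB // ler_sum // => r _; by case/andP: (ab (K + r)%N).
rewrite big_split /= prodfV.
set A' := \prod_(r < K) _; set Q := \prod_(r < K) _; set P2 := \prod_(c < j) _.
have A'A : 0 <= A' <= A.
  apply/andP; split; first by apply: prodr_ge0 => r _; rewrite subr_ge0; case/andP: (b01 r).
  apply: ler_prod => r _; case/andP: (ab r) => _ h; case/andP: (b01 r) => _ h'.
  by rewrite subr_ge0 h' /= lerB.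
have Q0 : 0 < Q by apply: prodr_gt0 => r _; exact: one_sub_qX_gt0.
have f0 c : (c < j)%N -> 0 < 1 - q ^+ (j - c + conj_part mu c)%N.
  by move=> cj; apply: one_sub_qX_gt0; lia.
have P20 : 0 < P2 by apply: prodr_gt0 => c _; exact: f0.
have P2Q : P2 <= Q.
  rewrite /P2 [leLHS](reindex_inj rev_ord_inj) /=.
  have E : (K + (j - K) = j)%N by lia.
  pose f c : R := 1 - q ^+ (j - (j - c.+1) + conj_part mu (j - c.+1))%N.
  rewrite -[leLHS]/(\prod_(c < j) f c) -[in leLHS]E big_split_ord /=.
  have fK r : (r < K)%N -> f r = 1 - q ^+ r.+1.
    move=> rK; rewrite /f conj_part_small //; last by lia.
    by congr (1 - q ^+ _); lia.
  have -> : \prod_(r < K) f r = Q by apply: eq_bigr => r _; exact: fK.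
  rewrite ler_piMr //; first exact: ltW.
  apply: prodr_ile1 => c _; case/andP: (qX_bounds (j - (j - (K + c).+1) + conj_part mu (j - (K + c).+1))).
  by rewrite /f subr_ge0 gerBl => /ltW -> ->.
have V : Q^-1 <= P2^-1 by rewrite lef_pV2.
have Qv : 0 < Q^-1 by rewrite invr_gt0.
case/andP: A'A => A'0 A'A.
have [L0|L0] := leP 0 L; last first.
  apply: (@le_trans _ _ 0); first by rewrite nmulr_lle0 // mulr_ge0 // ltW.
  apply: mulr_ge0; last by rewrite invr_ge0 ltW.
  apply: mulr_ge0 => //.
  by apply: prodr_ge0 => r _; rewrite subr_ge0; case/andP: (a01 (K + r)%N).
rewrite mulrAC; apply: ler_pM => //; first exact: mulr_ge0.
  exact: ltW.
exact: ler_pM.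
Qed.
End RowDecomposition.

(** * Averages under the q-Plancherel and binomial laws *)

Section PartitionSums.
Local Open Scope classical_set_scope.
Local Open Scope ring_scope.

(** The enumeration runs over all lists with at most [n] entries, each of them
    at most [n]; every partition of [n] is such a list. *)
Definition intparts (n : nat) : seq (seq nat) :=
  undup [seq l <- flatten [seq [seq map (@nat_of_ord n.+1) (tval t) | t : k.-tuple 'I_n.+1]
                          | k <- iota 0 n.+1] | is_intpart n l].

Lemma mem_intparts n l : (l \in intparts n) = is_intpart n l.
Proof.
rewrite mem_undup mem_filter; case: (boolP (is_intpart n l)) => // /and3P [sl l0 /eqP sn].
rewrite andTb; have sz : (size l <= n)%N.
  rewrite leqNgt; apply/negP => h.
  have l1 : (0 < nth 0%N l n)%N by rewrite lt0n; apply: contra l0 => /eqP <-; apply: mem_nth.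
  have := sorted_geq_sumn n sl; rewrite sn; nia.
apply/flattenP.
exists [seq map (@nat_of_ord n.+1) (tval t) | t : (size l).-tuple 'I_n.+1].
  by apply/mapP; exists (size l); rewrite // mem_iota.
apply/mapP; exists (map_tuple inord (in_tuple l)); first by rewrite mem_enum.
rewrite /= -map_comp -[LHS]map_id; apply/eq_in_map => x /(nthP 0%N) [i _ <-] /=.
by rewrite inordK // ltnS -[leqRHS]sn row_le_sumn.
Qed.

Lemma sum_intparts_cons (V : nmodType) n (F : seq nat -> V) : (0 < n)%N ->
  \sum_(l <- intparts n) F l = \sum_(j < n.+1) \sum_(mu <- intparts (n - j))
     (if (0 < j)%N && (head 0%N mu <= j)%N then F (nat_of_ord j :: mu) else 0).
Proof.
move=> n0.
pose L := [seq j :: mu | j <- iota 1 n, mu <- [seq mu <- intparts (n - j) | (head 0%N mu <= j)%N]].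
have -> : \sum_(l <- intparts n) F l = \sum_(l <- L) F l.
  apply: perm_big; apply: uniq_perm; first exact: undup_uniq.
    apply: allpairs_uniq_dep; first exact: iota_uniq.
    - by move=> j _; rewrite filter_uniq // undup_uniq.
    - by move=> [j mu] [j' mu'] _ _ /= [-> ->].
  move=> l; rewrite mem_intparts; apply/idP/allpairsPdep.
    case: l => [/and3P [_ _ /eqP /= E]|j mu]; first by rewrite -E in n0.
    case/and3P => sl l0 /eqP /= E; move: sl; rewrite sorted_cons_head => /andP [hj smu].
    move: l0; rewrite inE negb_or => /andP [j0 mu0].
    exists j, mu; split => //; first by rewrite mem_iota; lia.
    rewrite mem_filter hj mem_intparts /is_intpart smu mu0 /=; lia.
  case=> j [mu []]; rewrite mem_iota mem_filter mem_intparts => jn /andP [hj].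
  case/and3P => smu mu0 /eqP E ->.
  rewrite /is_intpart sorted_cons_head hj smu inE (negbTE mu0) orbF /= E; lia.
rewrite big_allpairs_dep /= -(big_mkord xpredT (fun j => \sum_(mu <- intparts (n - j))
     (if (0 < j)%N && (head 0%N mu <= j)%N then F (j :: mu) else 0))) big_ltn //=.
rewrite [X in X + _]big1 ?add0r // /index_iota subSS subn0; apply: eq_big_seq => j.
rewrite mem_iota => /andP [-> _]; rewrite big_filter big_mkcond; exact: eq_bigr.
Qed.

Variables (R : realType) (q : R).
Hypotheses (q0 : 0 < q) (q1 : q < 1).

Definition qpl_mean (n : nat) (g : seq nat -> R) : R :=
  \sum_(l <- intparts n) qplancherel q l * g l.

Definition bin_mean (n : nat) (g : nat -> R) : R :=
  \sum_(j < n.+1) binom_weight q n j * g j.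

Lemma intparts_sorted n mu : mu \in intparts n -> sorted geq mu /\ sumn mu = n.
Proof. by rewrite mem_intparts => /and3P [-> _ /eqP]. Qed.

Lemma qpl_mean_rec n (g : seq nat -> R) : (0 < n)%N ->
  qpl_mean n g = bin_mean n (fun j =>
    qpl_mean (n - j) (fun mu => row_corr q j mu * g (j :: mu))).
Proof.
move=> n0; rewrite /qpl_mean sum_intparts_cons //; apply: eq_bigr => j _.
rewrite mulr_sumr; apply: eq_big_seq => mu /intparts_sorted [smu sn].
case: ifPn => [/andP [j0 hj]|h]; last by rewrite /row_corr (negbTE h) mul0r !mulr0.
rewrite qplancherel_cons // ?sorted_cons_head ?hj // sn subnKC; first by rewrite !mulrA.
by rewrite -ltnS.
Qed.

Lemma qplancherel_ge0 (l : seq nat) : 0 <= qplancherel q l.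
Proof.
apply: mulr_ge0 => //; apply: divr_ge0; first by rewrite exprn_ge0 // ltW.
apply: prodr_ge0 => i _; apply: prodr_ge0 => j _.
rewrite /qint -mulrNN -invrN !opprB; apply: divr_ge0; rewrite subr_ge0; last exact: ltW.
by rewrite exprn_ile1 // ltW.
Qed.

Lemma le_qpl_mean n (g h : seq nat -> R) :
  (forall l, sorted geq l -> sumn l = n -> g l <= h l) -> qpl_mean n g <= qpl_mean n h.
Proof.
move=> gh; rewrite /qpl_mean big_seq [leRHS]big_seq; apply: ler_sum => l.
by move=> /intparts_sorted [sl sn]; rewrite ler_wpM2l ?qplancherel_ge0 // gh.
Qed.

Lemma eq_qpl_mean n (g h : seq nat -> R) :
  (forall l, sorted geq l -> sumn l = n -> g l = h l) -> qpl_mean n g = qpl_mean n h.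
Proof.
move=> gh; apply: eq_big_seq => l /intparts_sorted [sl sn]; by rewrite gh.
Qed.

Lemma qpl_meanZ n a (g : seq nat -> R) : qpl_mean n (fun l => a * g l) = a * qpl_mean n g.
Proof. by rewrite mulr_sumr; apply: eq_bigr => l _; rewrite mulrCA. Qed.

Lemma qpl_meanD n (g h : seq nat -> R) :
  qpl_mean n (fun l => g l + h l) = qpl_mean n g + qpl_mean n h.
Proof. by rewrite -big_split; apply: eq_bigr => l _; rewrite mulrDr. Qed.

Lemma qpl_meanB n (g h : seq nat -> R) :
  qpl_mean n (fun l => g l - h l) = qpl_mean n g - qpl_mean n h.
Proof. by rewrite -sumrB; apply: eq_bigr => l _; rewrite mulrBr. Qed.

Lemma ler_norm_qpl_mean n (g : seq nat -> R) : `|qpl_mean n g| <= qpl_mean n (fun l => `|g l|).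
Proof.
apply: le_trans (ler_norm_sum _ _ _) _; apply: ler_sum => l _.
by rewrite normrM ger0_norm // qplancherel_ge0.
Qed.

Lemma binom_weight_ge0 n j : 0 <= binom_weight q n j.
Proof.
apply: mulr_ge0 => //; apply: mulr_ge0; apply: exprn_ge0; rewrite ?subr_ge0; exact: ltW.
Qed.

Lemma le_bin_mean n (g h : nat -> R) :
  (forall j, (j <= n)%N -> g j <= h j) -> bin_mean n g <= bin_mean n h.
Proof.
move=> gh; apply: ler_sum => j _; rewrite ler_wpM2l ?binom_weight_ge0 // gh //.
by rewrite -ltnS.
Qed.

Lemma eq_bin_mean n (g h : nat -> R) :
  (forall j, (j <= n)%N -> g j = h j) -> bin_mean n g = bin_mean n h.
Proof. by move=> gh; apply: eq_bigr => j _; rewrite gh // -ltnS. Qed.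

Lemma bin_meanZ n a (g : nat -> R) : bin_mean n (fun l => a * g l) = a * bin_mean n g.
Proof. by rewrite mulr_sumr; apply: eq_bigr => l _; rewrite mulrCA. Qed.

Lemma bin_meanD n (g h : nat -> R) :
  bin_mean n (fun l => g l + h l) = bin_mean n g + bin_mean n h.
Proof. by rewrite -big_split; apply: eq_bigr => l _; rewrite mulrDr. Qed.

Lemma bin_meanB n (g h : nat -> R) :
  bin_mean n (fun l => g l - h l) = bin_mean n g - bin_mean n h.
Proof. by rewrite -sumrB; apply: eq_bigr => l _; rewrite mulrBr. Qed.

Lemma ler_norm_bin_mean n (g : nat -> R) : `|bin_mean n g| <= bin_mean n (fun l => `|g l|).
Proof.
apply: le_trans (ler_norm_sum _ _ _) _; apply: ler_sum => l _.
by rewrite normrM ger0_norm // binom_weight_ge0.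
Qed.

(** Conditioning on the first trial. *)
Lemma bin_meanS n (g : nat -> R) :
  bin_mean n.+1 g = (1 - q) * bin_mean n (g \o succn) + q * bin_mean n g.
Proof.
rewrite /bin_mean big_ord_recl [X in _ + q * X]big_ord_recl /=.
have -> : binom_weight q n.+1 0 = q * binom_weight q n 0.
  by rewrite /binom_weight !bin0 !subn0 exprS; ring.
rewrite mulrDr addrCA -mulrA; congr (_ + _).
have E (j : nat) : binom_weight q n.+1 j.+1 * g j.+1 =
   (1 - q) * (binom_weight q n j * g j.+1) + q * (binom_weight q n j.+1 * g j.+1).
  rewrite /binom_weight binS natrD subSS exprS.
  case: (ltnP j n) => jn; last by rewrite (@bin_small n j.+1) //; ring.
  rewrite (_ : n - j = (n - j.+1).+1)%N ?exprS; [ring|lia].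
under eq_bigr => j _ do rewrite /bump /= add1n E.
rewrite big_split /= !mulr_sumr; congr (_ + _).
rewrite big_ord_recr /= {2}/binom_weight bin_small // !mul0r mulr0 addr0.
by apply: eq_bigr => j _; rewrite /bump /= add1n.
Qed.

Lemma bin_mean0 (g : nat -> R) : bin_mean 0 g = g 0%N.
Proof. by rewrite /bin_mean big_ord1 /binom_weight bin0 expr0 subn0 expr0 !mul1r. Qed.

Lemma bin_mean_cst n c : bin_mean n (fun=> c) = c.
Proof. by elim: n => [|n IH]; rewrite ?bin_mean0 // bin_meanS /= !IH; ring. Qed.

Lemma bin_mean_id n : bin_mean n (fun j => j%:R) = n%:R * (1 - q).
Proof.
elim: n => [|n IH]; first by rewrite bin_mean0 mul0r.
rewrite bin_meanS /= IH (eq_bin_mean (h := fun j => j%:R + 1)); last first.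
  by move=> j _ /=; rewrite -natr1.
by rewrite bin_meanD bin_mean_cst IH -natr1; ring.
Qed.

Lemma bin_mean_var n :
  bin_mean n (fun j => (j%:R - n%:R * (1 - q)) ^+ 2) = n%:R * ((1 - q) * q).
Proof.
elim: n => [|n IH]; first by rewrite bin_mean0 !mul0r subrr expr0n.
have E1 : bin_mean n (fun j => j%:R - n%:R * (1 - q)) = 0.
  by rewrite bin_meanB bin_mean_id bin_mean_cst subrr.
have E (a : R) : bin_mean n (fun j => (j%:R - n%:R * (1 - q) + a) ^+ 2) =
   n%:R * ((1 - q) * q) + a ^+ 2.
  rewrite (eq_bin_mean (h := fun j => (j%:R - n%:R * (1 - q)) ^+ 2 +
    (2 * a * (j%:R - n%:R * (1 - q)) + a ^+ 2))); last by move=> j _; ring.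
  by rewrite !bin_meanD bin_meanZ E1 mulr0 add0r bin_mean_cst IH.
rewrite bin_meanS /=.
rewrite (eq_bin_mean (h := fun j => (j%:R - n%:R * (1 - q) + q) ^+ 2)); last first.
  by move=> j _ /=; rewrite -[j.+1%:R]natr1 -[n.+1%:R]natr1; ring.
rewrite (eq_bin_mean (g := fun j => (j%:R - n.+1%:R * (1 - q)) ^+ 2)
   (h := fun j => (j%:R - n%:R * (1 - q) + (q - 1)) ^+ 2)); last first.
  by move=> j _ /=; rewrite -[n.+1%:R]natr1; ring.
by rewrite !E -[n.+1%:R]natr1; ring.
Qed.

Lemma bin_mean_chebyshev n (eps : R) : 0 < eps -> (0 < n)%N ->
  bin_mean n (fun j => (eps * n%:R <= `|j%:R - n%:R * (1 - q)|)%R%:R) <=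
  ((1 - q) * q / eps ^+ 2) / n%:R.
Proof.
move=> e0 n0; have nR : 0 < n%:R :> R by rewrite ltr0n.
have en : 0 < eps * n%:R by rewrite mulr_gt0.
apply: (@le_trans _ _ (bin_mean n (fun j => (eps * n%:R) ^- 2 * (j%:R - n%:R * (1 - q)) ^+ 2))).
  apply: le_bin_mean => j _; case: (boolP (eps * n%:R <= _)) => h /=.
    rewrite mulrC ler_pdivlMr ?exprn_gt0 // mul1r -[leRHS]real_normK ?num_real //.
    by rewrite lerXn2r // nnegrE // ltW.
  by rewrite mulr_ge0 ?invr_ge0 ?exprn_even_ge0.
rewrite bin_meanZ bin_mean_var le_eqVlt; apply/orP; left; apply/eqP.
by field; rewrite !gt_eqF.
Qed.
End PartitionSums.

(** * Law of large numbers for the rows *)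

Section RowLLN.
Local Open Scope classical_set_scope.
Local Open Scope ring_scope.
Variables (R : realType) (q : R).
Hypotheses (q0 : 0 < q) (q1 : q < 1).
(** The total mass is 1, because the weights form the law of a random
    partition. *)
Hypothesis qpl_mean1 : forall n, qpl_mean q n (fun=> 1) = 1.

Let p := 1 - q.
Let p0 : 0 < p. Proof. by rewrite subr_gt0. Qed.
Let alpha r : R := (1 - q) * q ^+ r.

Lemma squeeze0 (u v : nat -> R) : (\forall n \near \oo, 0 <= u n <= v n) ->
  v @ \oo --> (0 : R) -> u @ \oo --> (0 : R).
Proof. by move=> uv v0; apply: (squeeze_cvgr uv) => //; exact: cvg_cst. Qed.

Lemma cvg0_scale (K : R) (u : nat -> R) : u @ \oo --> (0 : R) ->
  (fun n => K * u n) @ \oo --> (0 : R).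
Proof. by move=> u0; have := @cvgMl_tmp _ _ _ _ _ K _ u0; rewrite mulr0; apply. Qed.

Lemma cvg_cst_div_nat (K : R) : (fun n => K / n%:R) @ \oo --> (0 : R).
Proof.
rewrite -(cvg_shiftS (fun n => K / n%:R)).
exact: (cvg0_scale K cvg_harmonic).
Qed.

Definition is_dev (delta : R) (n j : nat) : R :=
  (delta * n%:R <= `|j%:R - n%:R * (1 - q)|)%R%:R.

Definition bin_dev (delta : R) (n : nat) : R := bin_mean q n (is_dev delta n).

Lemma bin_dev_cvg0 delta : 0 < delta -> bin_dev delta @ \oo --> (0 : R).
Proof.
move=> d0; apply: (squeeze0 _ (cvg_cst_div_nat ((1 - q) * q / delta ^+ 2))).
near=> n; rewrite bin_mean_chebyshev //; last by near: n; exact: nbhs_infty_gt.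
by rewrite andbT sumr_ge0 // => j _; rewrite mulr_ge0 // binom_weight_ge0.
Unshelve. all: by end_near. Qed.

(** What a binomial draw leaves over exceeds any given rank with probability
    tending to 1. *)
Lemma bin_mean_complement_cvg0 (u : nat -> R) (B : R) : (forall n, 0 <= u n <= B) ->
  u @ \oo --> (0 : R) -> (fun n => bin_mean q n (fun j => u (n - j)%N)) @ \oo --> (0 : R).
Proof.
move=> uB ucvg; apply/cvgrPdist_le => e e0.
have B0 : 0 <= B by case/andP: (uB 0%N) => h1 h2; exact: le_trans h2.
have q20 : 0 < q / 2 by rewrite divr_gt0.
have e20 : 0 < e / 2 by rewrite divr_gt0.
have [N _ hN] : \forall n \near \oo, u n <= e / 2 by apply: (cvgr_le _ ucvg).
have : (fun n => B * bin_dev (q / 2) n) @ \oo --> (0 : R).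
  by apply: cvg0_scale; exact: bin_dev_cvg0.
move=> /cvgr_le /(_ _ e20) h.
have h2 : \forall n \near \oo, N%:R <= q / 2 * n%:R.
  near=> n; rewrite mulrC -ler_pdivrMr //; near: n; exact: nbhs_infty_ger.
near=> n; rewrite sub0r normrN ger0_norm; last first.
  apply: sumr_ge0 => j _; rewrite mulr_ge0 // ?binom_weight_ge0 //.
  by case/andP: (uB (n - j)%N).
apply: (@le_trans _ _ (bin_mean q n (fun j => e / 2 +
   B * is_dev (q / 2) n j))); last first.
  rewrite bin_meanD bin_mean_cst // (bin_meanZ q n B (is_dev (q / 2) n)) -/(bin_dev _ _) [leRHS](splitr e) lerD2l.
  by near: n.
apply: le_bin_mean => // j jn; rewrite /is_dev.
case: (boolP (q / 2 * n%:R <= _)) => hj /=.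
  rewrite mulr1; apply: (@le_trans _ _ B); first by case/andP: (uB (n - j)%N).
  by rewrite lerDr ltW.
rewrite mulr0 addr0; apply: hN => /=.
rewrite -(ler_nat R) natrB //; have : N%:R <= q / 2 * n%:R by near: n.
move: hj; rewrite -ltNge ltr_norml => /andP [_ hj]; move: hj; rewrite -/p.
have -> : p = 1 - q by []. nra.
Unshelve. all: by end_near. Qed.

Definition row_dev (r : nat) (eps : R) (l : seq nat) : R :=
  (eps * (sumn l)%:R <= `|(nth 0%N l r)%:R - (sumn l)%:R * alpha r|)%R%:R.

Lemma row_dev01 r eps l : 0 <= row_dev r eps l <= 1.
Proof. by rewrite /row_dev; case: (eps * _ <= _); rewrite ?lexx ?ler01. Qed.

Lemma qpl_mean_ge0 n (g : seq nat -> R) : (forall l, 0 <= g l) -> 0 <= qpl_mean q n g.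
Proof. by move=> g0; apply: sumr_ge0 => l _; rewrite mulr_ge0 // qplancherel_ge0. Qed.

Lemma bin_mean_ge0 n (g : nat -> R) : (forall l, 0 <= g l) -> 0 <= bin_mean q n g.
Proof. by move=> g0; apply: sumr_ge0 => l _; rewrite mulr_ge0 // binom_weight_ge0. Qed.

Lemma qpl_mean_le1 n (g : seq nat -> R) : (forall l, g l <= 1) -> qpl_mean q n g <= 1.
Proof. by move=> g1; rewrite -(qpl_mean1 n); apply: le_qpl_mean. Qed.

(** The first row is dominated, up to a constant, by a binomial variable
    independent of the other rows, which again follow the q-Plancherel measure;
    the statement for row [r.+1] follows from the one for row [r] at the
    remaining size. *)
Lemma qpl_row_lln r eps : 0 < eps -> (fun n => qpl_mean q n (row_dev r eps)) @ \oo --> (0 : R).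
Proof.
have [c hc] := row_corr_ub q0 q1.
have c0 : 0 <= c by case/andP: (hc 0%N [::] isT) => h1; exact: le_trans.
have dom n (g : seq nat -> R) : (0 < n)%N -> (forall l, 0 <= g l) -> qpl_mean q n g <=
    c * bin_mean q n (fun j => qpl_mean q (n - j) (fun mu => g (j :: mu))).
  move=> n0 g0; rewrite qpl_mean_rec // -bin_meanZ; apply: le_bin_mean => // j _.
  rewrite -qpl_meanZ; apply: le_qpl_mean => // mu smu _.
  by rewrite ler_wpM2r //; case/andP: (hc j mu smu).
elim: r eps => [|r IH] eps e0.
  apply: (@squeeze0 _ (fun n => c * bin_dev eps n)); last first.
    by apply: cvg0_scale; exact: bin_dev_cvg0.
  near=> n; rewrite qpl_mean_ge0 /=; last by move=> l; case/andP: (row_dev01 0 eps l).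
  apply: le_trans (dom n _ _ _) _.
  - by near: n; exact: nbhs_infty_gt.
  - by move=> l; case/andP: (row_dev01 0 eps l).
  rewrite ler_wpM2l //; apply: le_bin_mean => // j jn.
  rewrite -[leRHS]mulr1 -(qpl_mean1 (n - j)) -qpl_meanZ; apply: le_qpl_mean => // mu smu sn.
  by rewrite /row_dev /= sn subnKC // mulr1 /alpha expr0 mulr1.
have e20 : 0 < eps / 2 by rewrite divr_gt0.
apply: (@squeeze0 _ (fun n => c * (bin_dev (eps / 2) n +
   bin_mean q n (fun j => qpl_mean q (n - j) (row_dev r (eps / 2)))))); last first.
  apply: cvg0_scale; rewrite -(addr0 (0 : R)).
  apply: cvgD; first exact: bin_dev_cvg0.
  apply: (@bin_mean_complement_cvg0 (fun m => qpl_mean q m (row_dev r (eps / 2))) 1); last exact: IH.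
  move=> n; rewrite qpl_mean_ge0 ?qpl_mean_le1 // => l; by case/andP: (row_dev01 r (eps/2) l).
near=> n; rewrite qpl_mean_ge0 /=; last by move=> l; case/andP: (row_dev01 r.+1 eps l).
apply: le_trans (dom n _ _ _) _.
- by near: n; exact: nbhs_infty_gt.
- by move=> l; case/andP: (row_dev01 r.+1 eps l).
rewrite ler_wpM2l // /bin_dev -bin_meanD; apply: le_bin_mean => // j jn.
rewrite -[X in X + _]mulr1 -[X in _ * X + _](qpl_mean1 (n - j)) -qpl_meanZ -qpl_meanD.
apply: le_qpl_mean => // mu smu sn.
rewrite mulr1 {1}/row_dev /= sn subnKC //.
case: (boolP (_ <= `|(nth 0%N mu r)%:R - _|)) => h1 //=; last first.
  by rewrite addr_ge0 //; case/andP: (row_dev01 r (eps / 2) mu).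
rewrite /is_dev; case: (boolP (_ <= `|j%:R - _|)) => h2 /=.
  by rewrite lerDl; case/andP: (row_dev01 r (eps / 2) mu).
rewrite add0r /row_dev sn; suff -> : eps / 2 * (n - j)%:R <= `|(nth 0%N mu r)%:R - (n - j)%:R * alpha r| by [].
apply: (@le_trans _ _ (eps / 2 * n%:R)); first by rewrite ler_wpM2l ?(ltW e20) // ler_nat leq_subr.
have ar : 0 <= alpha r <= 1.
  have := qX_bounds q0 q1 r => /andP [h3 h4]; rewrite /alpha.
  have p1 : 1 - q <= 1 by rewrite gerBl ltW.
  by apply/andP; split; [rewrite mulr_ge0 // ltW | rewrite mulr_ile1 // ltW].
have -> : (nth 0%N mu r)%:R - (n - j)%:R * alpha r =
   ((nth 0%N mu r)%:R - n%:R * alpha r.+1) + (j%:R - n%:R * (1 - q)) * alpha r.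
  by rewrite natrB // /alpha exprS; ring.
rewrite -ltNge in h2.
have h3 : `|(j%:R - n%:R * (1 - q)) * alpha r| <= eps / 2 * n%:R.
  case/andP: ar => ar0 ar1; rewrite normrM (ger0_norm ar0).
  by apply: le_trans (ltW h2); rewrite ler_piMr.
have := ler_normB ((nth 0%N mu r)%:R - n%:R * alpha r.+1 + (j%:R - n%:R * (1 - q)) * alpha r)
  ((j%:R - n%:R * (1 - q)) * alpha r); rewrite addrK => h4.
by move: (`|_|) (`|_|) (`|_|) h1 h3 h4 => x y z; lra.
Unshelve. all: by end_near. Qed.
End RowLLN.

(** * Lower bound for the row correction *)

Section RowCorrection.
Local Open Scope classical_set_scope.
Local Open Scope ring_scope.
Variables (R : realType) (q : R).
Hypotheses (q0 : 0 < q) (q1 : q < 1).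
Hypothesis qpl_mean1 : forall n, qpl_mean q n (fun=> 1) = 1.

Let p := 1 - q.
Let p0 : 0 < p. Proof. by rewrite subr_gt0. Qed.
Let alpha r : R := (1 - q) * q ^+ r.

(** With every frequency within [delta] of its limit, the ratio of row [r] of
    [mu] to the first row is at most [slack delta * (alpha r + delta)]. *)
Let slack (delta : R) := (q + delta) / (p - delta).
Let tail K (delta : R) := slack delta * (1 - \sum_(r < K) (alpha r - delta)).
Let psi K (delta : R) := \prod_(r < K) ((1 - slack delta * (alpha r + delta)) / (1 - q ^+ r.+1)).

Lemma cvg_to_eq (f : R -> R) (F : set_system R) (a b : R) :
  f @ F --> a -> a = b -> f @ F --> b.
Proof. by move=> + <-. Qed.

Lemma sum_alpha K : \sum_(r < K) alpha r = 1 - q ^+ K.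
Proof.
rewrite -mulr_sumr -[RHS]opprB subrX1 -mulNr opprB; by [].
Qed.

Lemma slack_cvg : slack @ (0 : R)^'+ --> q / p.
Proof.
apply: cvg_at_right_filter; have -> : q / p = (q + 0) / (p - 0) by rewrite addr0 subr0.
apply: cvgM; first by apply: cvgD; [exact: cvg_cst | exact: cvg_id].
by apply: cvgV; [rewrite subr0 gt_eqF | apply: cvgB; [exact: cvg_cst | exact: cvg_id]].
Qed.

Lemma tail_cvg K : tail K @ (0 : R)^'+ --> q / p * q ^+ K.
Proof.
apply: cvgM; first exact: slack_cvg.
have E d : 1 - \sum_(r < K) (alpha r - d) = q ^+ K + K%:R * d.
  by rewrite sumrB sum_alpha sumr_const card_ord -mulr_natl; ring.
under eq_fun do rewrite E.
suff : (fun d => q ^+ K + K%:R * d) @ (0 : R)^'+ --> q ^+ K + K%:R * 0.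
  by rewrite mulr0 addr0.
apply: cvg_at_right_filter; apply: cvgD; first exact: cvg_cst.
by apply: cvgMl_tmp; exact: cvg_id.
Qed.

Lemma row_bound_cvg r : (fun d => 1 - slack d * (alpha r + d)) @ (0 : R)^'+ --> 1 - q ^+ r.+1.
Proof.
apply: cvgB; first exact: cvg_cst.
have -> : q ^+ r.+1 = q / p * (alpha r + 0).
  by rewrite addr0 /alpha -/p exprS; field; rewrite gt_eqF.
apply: cvgM; first exact: slack_cvg.
by apply: cvg_at_right_filter; apply: cvgD; [exact: cvg_cst | exact: cvg_id].
Qed.

Lemma psi_cvg K : psi K @ (0 : R)^'+ --> (1 : R).
Proof.
elim: K => [|K IH].
  have -> : psi 0 = fun=> 1 by apply/funext => d; rewrite /psi big_ord0.
  exact: cvg_cst.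
have -> : psi K.+1 = fun d => psi K d * ((1 - slack d * (alpha K + d)) / (1 - q ^+ K.+1)).
  by apply/funext => d; rewrite /psi big_ord_recr.
have h : 1 - q ^+ K.+1 != 0 by rewrite gt_eqF // one_sub_qX_gt0.
apply: (@cvg_to_eq _ _ (1 * ((1 - q ^+ K.+1) / (1 - q ^+ K.+1)))); last by rewrite mul1r divff.
by apply: cvgM; [exact: IH | apply: cvgMr_tmp; exact: row_bound_cvg].
Qed.

(** As [delta] tends to 0, [psi K delta] tends to 1 and [tail K delta] to
    [q / p * q ^+ K], which is small for large [K]. The last condition leaves
    room in the first row for [K] more boxes than in the second one. *)
Lemma good_delta (eps : R) : 0 < eps -> exists K delta,
  [/\ 0 < delta < p, forall r, (r < K)%N -> 0 <= 1 - slack delta * (alpha r + delta),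
      0 <= 1 - tail K delta, 1 - eps <= psi K delta * (1 - tail K delta) &
      0 < (p - delta) - (q + delta) * (p + delta)].
Proof.
move=> e0.
have [K hK] : exists K, q / p * q ^+ K < Num.min eps 1.
  have : (fun m => q / p * q ^+ m) @ \oo --> (0 : R).
    by apply: cvg0_scale; apply: cvg_expr; rewrite ger0_norm // ltW.
  have m0 : 0 < Num.min eps 1 by rewrite lt_min e0 ltr01.
  by move=> /cvgr_lt /(_ _ m0) [K _ /(_ K (leqnn _))] h; exists K.
move: hK; rewrite lt_min => /andP [hK1 hK2].
have A1 : (fun d => psi K d * (1 - tail K d)) @ (0 : R)^'+ --> 1 - q / p * q ^+ K.
  apply: (@cvg_to_eq _ _ (1 * (1 - q / p * q ^+ K))); last by rewrite mul1r.
  apply: cvgM; first exact: psi_cvg.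
  by apply: cvgB; [exact: cvg_cst | exact: tail_cvg].
have A2 : (fun d => (p - d) - (q + d) * (p + d)) @ (0 : R)^'+ --> p - 0 - (q + 0) * (p + 0).
  apply: cvg_at_right_filter; apply: cvgB; first by apply: cvgB; [exact: cvg_cst | exact: cvg_id].
  by apply: cvgM; apply: cvgD; (exact: cvg_cst || exact: cvg_id).
have A3 : forall k, \forall d \near (0 : R)^'+, forall r, (r < k)%N -> 0 <= 1 - slack d * (alpha r + d).
  elim=> [|k IH]; first by near=> d.
  have := @row_bound_cvg k => /cvgr_ge /(_ _ (one_sub_qX_gt0 q0 q1 (ltn0Sn k))) h.
  near=> d => r; rewrite ltnS leq_eqVlt => /orP [/eqP ->|]; first by near: d.
  by move: r; near: d.
have : \forall d \near (0 : R)^'+,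
  [/\ 0 < d < p, forall r, (r < K)%N -> 0 <= 1 - slack d * (alpha r + d),
      0 <= 1 - tail K d, 1 - eps <= psi K d * (1 - tail K d) &
      0 < (p - d) - (q + d) * (p + d)].
  near=> d; split.
  - by apply/andP; split; near: d; [exact: nbhs_right_gt | exact: nbhs_right_lt].
  - by near: d; exact: A3.
  - rewrite subr_ge0; near: d; apply: (cvgr_le _ (@tail_cvg K)); exact: hK2.
  - by near: d; apply: (cvgr_ge _ A1); rewrite ltrD2l ltrN2.
  - near: d; apply: (cvgr_gt _ A2); rewrite subr0 !addr0 -[X in X - _]mul1r -mulrBl.
    by rewrite mulr_gt0 // subr_gt0.
by move=> /filter_ex [d hd]; exists K, d.
Unshelve. all: by end_near. Qed.

(** If the deviations are small, the bound of [row_corr_lb] is at least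
    [1 - eps]; otherwise an indicator on the right is 1, and the correction is
    nonnegative. *)
Lemma row_corr_ge eps : 0 < eps -> exists K delta N, 0 < delta /\ forall n j mu,
  (N <= n)%N -> (j <= n)%N -> sorted geq mu -> sumn mu = (n - j)%N ->
  1 - row_corr q j mu <= eps + (1 : R) * is_dev q delta n j + \sum_(r < K) row_dev q r delta mu.
Proof.
move=> e0; have [K [d [/andP [d0 dp] h1 h2 h3 h4]]] := good_delta e0.
have [N [N0 hN]] : exists N, (0 < N)%N /\ forall n, (N <= n)%N ->
   K%:R <= n%:R * ((p - d) - (q + d) * (p + d)).
  pose N := (Num.bound (K%:R / ((p - d) - (q + d) * (p + d)))).+1.
  exists N; split => // n Nn; rewrite -ler_pdivrMr //.
  apply: (@le_trans _ _ N%:R); last by rewrite ler_nat.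
  apply: ltW; apply: (lt_le_trans (archi_boundP _)); last by rewrite ler_nat.
  by rewrite divr_ge0 // ltW.
exists K.+1, d, N; split => // n j mu Nn jn smu sn.
have n0 : 0 < n%:R :> R by rewrite ltr0n (leq_trans N0).
have dev0 r : 0 <= row_dev q r d mu by case/andP: (row_dev01 q r d mu).
have [cub hc] := row_corr_ub q0 q1.
have c0 : 0 <= row_corr q j mu by case/andP: (hc j mu smu).
rewrite mul1r /is_dev.
case: (boolP (_ <= `|j%:R - _|)) => hj /=.
  rewrite -addrA addrC -addrA; apply: (@le_trans _ _ 1); first by rewrite gerBl.
  by rewrite lerDl addr_ge0 ?(ltW e0) // sumr_ge0.
rewrite addr0.
case: (boolP [forall r : 'I_K.+1, row_dev q r d mu == 0]) => [/forallP hr|]; last first.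
  move=> /forallPn [r hr].
  have E : row_dev q r d mu = 1 by move: hr; rewrite /row_dev; case: (d * _ <= _); rewrite ?eqxx.
  rewrite (bigD1 r) //= E addrCA; apply: (@le_trans _ _ 1); first by rewrite gerBl.
  by rewrite lerDl addr_ge0 ?(ltW e0) // sumr_ge0.
rewrite big1 ?addr0; last by move=> r _; exact/eqP.
have m_R : (n - j)%:R = n%:R - j%:R :> R by rewrite natrB.
have row r : (r < K.+1)%N -> `|(nth 0%N mu r)%:R - (n - j)%:R * alpha r| < d * (n - j)%:R.
  move=> rK; have := hr (Ordinal rK); rewrite /row_dev sn /= ltNge /alpha.
  by case: (d * _ <= _) => //; rewrite oner_eq0.
move: hj; rewrite -ltNge ltr_norml -/p => /andP [hj1 hj2].
have j_lb : n%:R * (p - d) < j%:R by lra.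
have pd : 0 < p - d by rewrite subr_gt0.
have j0 : 0 < j%:R :> R by apply: lt_trans j_lb; rewrite mulr_gt0.
have m_ub : (n - j)%:R <= n%:R * (q + d) by rewrite m_R; move: hj1 hj2; rewrite /p; lra.
have m0 : 0 <= (n - j)%:R :> R by [].
have ratio : (n - j)%:R / j%:R <= slack d.
  rewrite ler_pdivrMr // /slack mulrAC ler_pdivlMr //.
  apply: (@le_trans _ _ (n%:R * (q + d) * (p - d))); first by rewrite ler_wpM2r // ltW.
  by rewrite mulrAC mulrC ler_wpM2l ?addr_ge0 // ltW.
have a0 r : 0 <= alpha r by rewrite mulr_ge0 ?exprn_ge0 ?(ltW p0) // ltW.
have row_ub r : (r < K.+1)%N -> (nth 0%N mu r)%:R / j%:R <= slack d * (alpha r + d).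
  move=> rK; have := row r rK; rewrite ltr_norml => /andP [_ h].
  apply: (@le_trans _ _ ((n - j)%:R / j%:R * (alpha r + d))).
    rewrite mulrAC ler_wpM2r ?invr_ge0 ?(ltW j0) //; lra.
  by rewrite ler_wpM2r // addr_ge0 // ltW.
rewrite lerBlDl -lerBlDr; apply: (le_trans h3).
have jN : (0 < j)%N by rewrite -(ltr0n R).
have hK : (head 0%N mu + K <= j)%N.
  rewrite -(ler_nat R) natrD -nth0.
  have := row 0%N (ltn0Sn K); rewrite ltr_norml => /andP [_ h].
  have a0E : alpha 0 = p by rewrite /alpha expr0 mulr1.
  have := hN n Nn.
  have : (n - j)%:R * (p + d) <= n%:R * (q + d) * (p + d) by rewrite ler_wpM2r // addr_ge0 // ltW.
  rewrite a0E in h; lra.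
apply: le_trans (row_corr_lb q0 q1 smu jN hK).
have fpos r : 0 <= (1 - q ^+ r.+1)^-1.
  by rewrite invr_ge0 ltW // one_sub_qX_gt0.
apply: ler_pM.
- by apply: prodr_ge0 => r _; rewrite mulr_ge0 // h1.
- exact: h2.
- apply: ler_prod => r _; rewrite mulr_ge0 ?h1 //=.
  apply: ler_wpM2r => //; apply: lerB => //; apply: row_ub.
  by rewrite ltnS ltnW.
rewrite lerB // /tail.
have S : (\sum_(r < K) nth 0%N mu r <= sumn mu)%N.
  rewrite -(@sumn_nth_widen mu (K + size mu)) ?big_split_ord /= ?leq_addr //.
  by move=> i hi; rewrite nth_default // (leq_trans (leq_addl K _)).
have -> : (sumn mu - \sum_(r < K) nth 0%N mu r)%N%:R =
   \sum_(r < K) ((n - j)%:R * alpha r - (nth 0%N mu r)%:R) + (n - j)%:R * (1 - \sum_(r < K) alpha r).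
  by rewrite natrB // natr_sum sumrB -mulr_sumr sn; ring.
have SE : 1 - \sum_(r < K) (alpha r - d) = (1 - \sum_(r < K) alpha r) + \sum_(r < K) d.
  by rewrite sumrB; ring.
have T0 : 0 <= 1 - \sum_(r < K) (alpha r - d).
  rewrite SE sum_alpha addr_ge0 //; last by rewrite sumr_ge0 // => r _; rewrite ltW.
  by rewrite subKr exprn_ge0 // ltW.
apply: (@le_trans _ _ ((n - j)%:R / j%:R * (1 - \sum_(r < K) (alpha r - d)))); last first.
  by apply: ler_wpM2r.
rewrite [leRHS]mulrAC; apply: ler_wpM2r; first by rewrite invr_ge0 ltW.
rewrite SE [in leRHS]mulrDr addrC lerD2l mulr_sumr; apply: ler_sum => r _.
by have := row r (leqW (ltn_ord r)); rewrite ltr_norml => /andP [h _]; lra.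
Unshelve. all: by end_near. Qed.
End RowCorrection.

(** * The first rows as successive binomial draws *)

Section FirstRows.
Local Open Scope classical_set_scope.
Local Open Scope ring_scope.
Variables (R : realType) (q : R).
Hypotheses (q0 : 0 < q) (q1 : q < 1).
Hypothesis qpl_mean1 : forall n, qpl_mean q n (fun=> 1) = 1.

Lemma cvg0_add (u v : nat -> R) : u @ \oo --> (0 : R) -> v @ \oo --> (0 : R) ->
  (fun n => u n + v n) @ \oo --> (0 : R).
Proof. by move=> u0 v0; have := cvgD u0 v0; rewrite addr0; apply. Qed.

Lemma qpl_mean_cst n c : qpl_mean q n (fun=> c) = c.
Proof.
rewrite -[RHS]mulr1 -(qpl_mean1 n) -qpl_meanZ; apply: eq_qpl_mean => *.
by rewrite mulr1.
Qed.

Definition row_corr_dev (n : nat) : R := bin_mean q n (fun j =>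
  qpl_mean q (n - j) (fun mu => `|row_corr q j mu - 1|)).

(** Since the correction has mean 1, its distance to 1 has the same mean as
    twice its negative part, which [row_corr_ge] bounds. *)
Lemma row_corr_dev_cvg0 : row_corr_dev @ \oo --> (0 : R).
Proof.
apply/cvgrPdist_le => e e0; have e20 : 0 < e / 4 by rewrite divr_gt0.
have [K [d [N [d0 hN]]]] := row_corr_ge q0 q1 e20.
have rd0 r l : 0 <= row_dev q r d l by case/andP: (row_dev01 q r d l).
pose s m := \sum_(r < K) qpl_mean q m (row_dev q r d).
have s_cvg : s @ \oo --> (0 : R).
  rewrite /s; elim: {hN s} K => [|K IH].
    have -> : (fun m => \sum_(r < 0) qpl_mean q m (row_dev q r d)) = fun=> 0.
      by apply/funext => m; rewrite big_ord0.
    exact: cvg_cst.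
  have -> : (fun m => \sum_(r < K.+1) qpl_mean q m (row_dev q r d)) =
     fun m => \sum_(r < K) qpl_mean q m (row_dev q r d) + qpl_mean q m (row_dev q K d).
    by apply/funext => m; rewrite big_ord_recr.
  by apply: cvg0_add; [exact: IH | exact: qpl_row_lln].
pose v n := bin_dev q d n + bin_mean q n (fun j => s (n - j)%N).
have v0 : v @ \oo --> (0 : R).
  apply: cvg0_add; first exact: bin_dev_cvg0.
  apply: (@bin_mean_complement_cvg0 _ _ q0 q1 s K%:R); last exact: s_cvg.
  move=> n; rewrite sumr_ge0 /=; last first.
    by move=> r _; apply: qpl_mean_ge0.
  rewrite -[X in X%:R]card_ord -sum1_card natr_sum; apply: ler_sum => r _.
  by apply: qpl_mean_le1 => // l; case/andP: (row_dev01 q r d l).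
near=> n.
have n0 : (0 < n)%N by near: n; exact: nbhs_infty_gt.
have hv : v n <= e / 4 by near: n; apply: (cvgr_le _ v0).
have Nn : (N <= n)%N by near: n; exact: nbhs_infty_ge.
rewrite sub0r normrN ger0_norm; last first.
  by apply: bin_mean_ge0 => // j; apply: qpl_mean_ge0.
pose D j := qpl_mean q (n - j) (fun mu => row_corr q j mu - 1).
have mean0 : bin_mean q n D = 0.
  rewrite (@eq_bin_mean _ _ _ _ (fun j => qpl_mean q (n - j) (fun mu => row_corr q j mu * 1) - 1)).
    by rewrite bin_meanB bin_mean_cst // -(qpl_mean_rec q0 q1 (fun=> 1) n0) qpl_mean1 subrr.
  move=> j _; rewrite /D qpl_meanB qpl_mean1; congr (_ - _).
  by apply: eq_qpl_mean => mu _ _; rewrite mulr1.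
pose G j := e / 4 + (is_dev q d n j + s (n - j)%N).
apply: (@le_trans _ _ (bin_mean q n (fun j => D j + 2 * G j))); last first.
  have GE : bin_mean q n G = e / 4 + v n.
    by rewrite /v /bin_dev -bin_meanD -[X in X + _](bin_mean_cst q0 q1 n) -bin_meanD.
  by rewrite bin_meanD mean0 add0r (bin_meanZ q n 2 G) GE; lra.
apply: le_bin_mean => // j jn.
pose z mu : R := e / 4 + (is_dev q d n j + \sum_(r < K) row_dev q r d mu).
have -> : D j + 2 * G j = qpl_mean q (n - j) (fun mu => (row_corr q j mu - 1) + 2 * z mu).
  have sE : s (n - j)%N = qpl_mean q (n - j) (fun mu => \sum_(r < K) row_dev q r d mu).
    by rewrite /s /qpl_mean exchange_big; apply: eq_bigr => l _; rewrite mulr_sumr.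
  have zE : qpl_mean q (n - j) z = G j by rewrite !qpl_meanD !qpl_mean_cst -sE.
  by rewrite (qpl_meanD q (n - j) _ (fun mu => 2 * z mu)) (qpl_meanZ q (n - j) 2 z) zE.
apply: le_qpl_mean => // mu smu sn.
have := hN n j mu Nn jn smu sn; rewrite mul1r -addrA -/(z mu) => hz.
have z0 : 0 <= z mu.
  by rewrite /z addr_ge0 ?(ltW e20) // addr_ge0 ?sumr_ge0 //.
move: (row_corr q j mu) hz => C hz.
by have [C1|C1] := lerP 1 C; lra.
Unshelve. all: by end_near. Qed.

(** Expectation of a function of the first [k] draws in successive binomial
    sampling, each draw taking its share of what the previous ones left. *)
Fixpoint rows_mean (k n : nat) (g : seq nat -> R) : R :=
  if k is k'.+1 then bin_mean q n (fun j => rows_mean k' (n - j) (fun s => g (j :: s)))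
  else g [::].

Definition first_rows (k : nat) (l : seq nat) : seq nat := mkseq (nth 0%N l) k.

Lemma first_rows_cons k j mu : first_rows k.+1 (j :: mu) = j :: first_rows k mu.
Proof. by rewrite /first_rows /mkseq /= (iotaDl 1 0) -map_comp. Qed.

Lemma rows_mean_norm k n (g : seq nat -> R) B : (forall s, `|g s| <= B) ->
  `|rows_mean k n g| <= B.
Proof.
elim: k n g => [|k IH] n g gB //=.
apply: le_trans (ler_norm_bin_mean q0 q1 _ _) _.
rewrite -[leRHS](bin_mean_cst q0 q1 n); apply: le_bin_mean => // j _.
by apply: IH => s; apply: gB.
Qed.

Lemma qpl_mean_norm n (g : seq nat -> R) B : (forall s, `|g s| <= B) ->
  `|qpl_mean q n g| <= B.
Proof.
move=> gB; apply: le_trans (ler_norm_qpl_mean q0 q1 _ _) _.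
by rewrite -[leRHS](qpl_mean_cst n); apply: le_qpl_mean.
Qed.

(** Induction on [k]: replacing the correction of the first row by 1 costs
    [row_corr_dev n], and the other rows follow the q-Plancherel measure of size
    [n - j], which is large with high probability. *)
Lemma qpl_first_rows k : exists u : nat -> R, [/\ u @ \oo --> (0 : R),
  exists B, forall n, 0 <= u n <= B &
  forall n (g : seq nat -> R), (forall s, `|g s| <= 1) ->
    `|qpl_mean q n (fun l => g (first_rows k l)) - rows_mean k n g| <= u n].
Proof.
elim: k => [|k [u [u_cvg [B uB] hu]]].
  exists (fun=> 0); split; [exact: cvg_cst | by exists 0 => n; rewrite lexx |].
  by move=> n g g1; rewrite /first_rows /mkseq /= qpl_mean_cst subrr normr0.
have [c hc] := row_corr_ub q0 q1.
have dev0 n : 0 <= row_corr_dev n by apply: bin_mean_ge0 => // j; apply: qpl_mean_ge0.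
have devB n : row_corr_dev n <= c + 1.
  rewrite -[leRHS](bin_mean_cst q0 q1 n); apply: le_bin_mean => // j _.
  rewrite -[leRHS](qpl_mean_cst (n - j)); apply: le_qpl_mean => // mu smu _.
  apply: le_trans (ler_normB _ _) _; rewrite normr1 lerD2r.
  by case/andP: (hc j mu smu) => h1 h2; rewrite ger0_norm.
pose w n := row_corr_dev n + bin_mean q n (fun j => u (n - j)%N).
have w0 n : 0 <= w n.
  rewrite addr_ge0 //; apply: bin_mean_ge0 => // j; by case/andP: (uB (n - j)%N).
(* Size 0 has no first row to remove; there 2 bounds the difference. *)
pose w' n : R := if n is 0 then 2 else w n.
exists w'; split.
- rewrite -(cvg_shiftS w') -[X in X @ _]/(fun n => w n.+1) (cvg_shiftS w).
  apply: cvg0_add; first exact: row_corr_dev_cvg0.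
  exact: (bin_mean_complement_cvg0 q0 q1 uB).
- have B0 : 0 <= B by case/andP: (uB 0%N) => h1 h2; exact: le_trans h2.
  exists (2 + (c + 1 + B)) => -[|n]; rewrite ?w0 /=.
    rewrite ler0n lerDl addr_ge0 // (le_trans (dev0 0%N)) //.
  apply: (@le_trans _ _ (c + 1 + B)); last by rewrite lerDr.
  apply: lerD => //; rewrite -[leRHS](bin_mean_cst q0 q1 n.+1); apply: le_bin_mean => // j _.
  by case/andP: (uB (n.+1 - j)%N).
case=> [|n] g g1.
  apply: le_trans (ler_normB _ _) _; rewrite -[leRHS]/(1 + 1 : R).
  by apply: lerD; [apply: qpl_mean_norm | apply: rows_mean_norm].
rewrite qpl_mean_rec //.
rewrite (@eq_bin_mean _ _ _ _ (fun j => qpl_mean q (n.+1 - j) (fun mu =>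
   (row_corr q j mu - 1) * g (j :: first_rows k mu)) +
   qpl_mean q (n.+1 - j) (fun mu => g (j :: first_rows k mu)))); last first.
  move=> j _; rewrite -qpl_meanD; apply: eq_qpl_mean => mu _ _.
  by rewrite first_rows_cons; ring.
rewrite bin_meanD /= -addrA -bin_meanB; apply: le_trans (ler_normD _ _) _.
apply: lerD.
  apply: le_trans (ler_norm_bin_mean q0 q1 _ _) _; apply: le_bin_mean => // j _.
  apply: le_trans (ler_norm_qpl_mean q0 q1 _ _) _; apply: le_qpl_mean => // mu _ _.
  by rewrite normrM ler_piMr.
apply: le_trans (ler_norm_bin_mean q0 q1 _ _) _; apply: le_bin_mean => // j _.
exact: (hu (n.+1 - j)%N (fun s => g (j :: s))).
Qed.
End FirstRows.

(** * The normal distribution function *)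

Section Gaussian.
Local Open Scope classical_set_scope.
Local Open Scope ring_scope.
Variable R : realType.
Notation mu := (@lebesgue_measure R).

Definition gpdf (x : R) : R := normal_peak 1 * expR (- (x ^+ 2 / 2)).

Lemma normal_pdf01 : normal_pdf 0 1 = gpdf.
Proof.
rewrite normal_pdfE ?oner_neq0 //; apply/funext => x.
by rewrite /gpdf /normal_fun subr0 expr1n mulNr.
Qed.

Lemma gpdf_gt0 x : 0 < gpdf x.
Proof. by rewrite mulr_gt0 ?expR_gt0 // normal_peak_gt0 // oner_neq0. Qed.

Definition ncdf (s x : R) : R := fine (normal_prob 0 s `]-oo, x]%classic).

Lemma ncdfE s x : (ncdf s x)%:E = normal_prob 0 s `]-oo, x]%classic.
Proof. by rewrite /ncdf fineK // fin_num_measure. Qed.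

Lemma ncdf_derive (s x : R) : s != 0 -> is_derive x 1 (ncdf s) (normal_pdf 0 s x).
Proof.
move=> s0.
have [] := @continuous_FTC1 R (normal_pdf 0 s) -oo%O x (x + 1).
- by rewrite ltrDl.
- by apply: integrableS (integrable_normal_pdf 0 s) => //; exact: measurable_itv.
- by rewrite ltNyr.
- exact: continuous_normal_pdf.
move=> h1 h2; apply: DeriveDef; first exact: h1.
by rewrite -derive1E.
Qed.

(** As [b] may lie on either side of [a], the position of [c] is recorded by its
    distance to [a]. *)
Lemma mvt (f df : R -> R) (a b : R) : (forall x : R, is_derive x 1 f (df x)) ->
  exists c, `|c - a| <= `|b - a| /\ f b - f a = df c * (b - a).
Proof.
move=> fd; have cf : continuous f.
  by move=> x; apply/differentiable_continuous/derivable1_diffP; have [] := fd x.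
have [ab|ba] := leP a b.
  have [c] := MVT_segment ab (fun x _ => fd x) (continuous_subspaceT cf).
  rewrite in_itv /= => /andP [ac cb] E; exists c; split => //.
  by rewrite !ger0_norm ?subr_ge0 // lerD2r.
have [c] := MVT_segment (ltW ba) (fun x _ => fd x) (continuous_subspaceT cf).
rewrite in_itv /= => /andP [bc ca] E; exists c; split; last first.
  by rewrite -opprB E -mulrN opprB.
by rewrite !ler0_norm ?subr_le0 ?(ltW ba) // lerN2 lerD2r.
Qed.

Definition Phi : R -> R := ncdf 1.

Lemma Phi_derive (x : R) : is_derive x 1 Phi (gpdf x).
Proof. by rewrite -normal_pdf01; apply: ncdf_derive; exact: oner_neq0. Qed.

Lemma Phi_lt x y : x < y -> Phi x < Phi y.
Proof.
move=> xy; rewrite -subr_gt0; have [c [_ ->]] := mvt x y Phi_derive.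
by rewrite mulr_gt0 ?gpdf_gt0 // subr_gt0.
Qed.

Lemma Phi_le x y : x <= y -> Phi x <= Phi y.
Proof. by rewrite le_eqVlt => /orP [/eqP ->//|/Phi_lt/ltW]. Qed.

Lemma Phi_continuous : continuous Phi.
Proof. by move=> x; apply/differentiable_continuous/derivable1_diffP; have [] := Phi_derive x. Qed.

Lemma Phi_bounds x : 0 <= Phi x <= 1.
Proof.
rewrite -!lee_fin ncdfE; apply/andP; split; first exact: measure_ge0.
exact: probability_le1.
Qed.

Let idR : measurableTypeR R -> R := idfun.
#[local] HB.instance Definition _ :=
  @isMeasurableFun.Build _ _ _ _ idR (@measurable_id _ _ setT).

Lemma ncdf_cvgNy s : ncdf s (- n%:R) @[n --> \oo] --> (0 : R).
Proof.
have h : ncdf s @ -oo%R --> (0 : R).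
  exact: (fine_cvg (cvg_cdfNy0 (idR : {RV (normal_prob 0 s) >-> R}))).
apply: cvg_comp h.
by apply: (cvg_comp _ _ cvgr_idn); rewrite ninfty.
Qed.

Lemma ncdf_cvgy s : ncdf s n%:R @[n --> \oo] --> (1 : R).
Proof.
have h : ncdf s @ +oo%R --> (1 : R).
  exact: (fine_cvg (cvg_cdfy1 (idR : {RV (normal_prob 0 s) >-> R}))).
exact: (cvg_comp _ _ cvgr_idn h).
Qed.

Lemma zero_derive_cst (f : R -> R) : (forall x : R, is_derive x 1 f 0) -> forall a b, f a = f b.
Proof.
by move=> fd a b; have [c [_ /eqP]] := mvt a b fd; rewrite mul0r subr_eq0 => /eqP.
Qed.

(** Pointwise forms of the rules of differentiation, so that the derivative of an
    explicit expression is built by composing them. *)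
Lemma dvM (f g : R -> R) (x a b : R) : is_derive x 1 f a -> is_derive x 1 g b ->
  is_derive x 1 (fun y => f y * g y) (f x * b + g x * a).
Proof. by move=> fa gb; exact: (is_deriveM fa gb). Qed.

Lemma dvZ (f : R -> R) (k x a : R) : is_derive x 1 f a -> is_derive x 1 (fun y => k * f y) (k * a).
Proof. by move=> fa; exact: (is_deriveZ k fa). Qed.

Lemma dvD (f g : R -> R) (x a b : R) : is_derive x 1 f a -> is_derive x 1 g b ->
  is_derive x 1 (fun y => f y + g y) (a + b).
Proof. by move=> fa gb; exact: (is_deriveD fa gb). Qed.

Lemma dvB (f g : R -> R) (x a b : R) : is_derive x 1 f a -> is_derive x 1 g b ->
  is_derive x 1 (fun y => f y - g y) (a - b).
Proof. by move=> fa gb; exact: (is_deriveB fa gb). Qed.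

Lemma dvN (f : R -> R) (x a : R) : is_derive x 1 f a -> is_derive x 1 (fun y => - f y) (- a).
Proof. by move=> fa; exact: (is_deriveN fa). Qed.

Lemma dv_comp (f g : R -> R) (x a b : R) : is_derive (g x) 1 f a -> is_derive x 1 g b ->
  is_derive x 1 (fun y => f (g y)) (a * b).
Proof. by move=> fa gb; exact: (is_derive1_comp fa gb). Qed.

Lemma dv_id (x : R) : is_derive x 1 (fun y : R => y) 1.
Proof. exact: is_derive_id. Qed.

Lemma dv_cst (c x : R) : is_derive x 1 (fun=> c) 0.
Proof. exact: is_derive_cst. Qed.

Lemma dv_eq (f : R -> R) (x a b : R) : is_derive x 1 f a -> a = b -> is_derive x 1 f b.
Proof. by move=> ? <-. Qed.

Lemma gpdf_derive (x : R) : is_derive x 1 gpdf (- x * gpdf x).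
Proof.
have h1 : is_derive x 1 (fun y : R => y ^+ 2) (x + x).
  by apply: dv_eq (dvM (dv_id x) (dv_id x)) _; rewrite !mulr1.
have h2 := dvN (dvM h1 (dv_cst 2^-1 x)).
apply: dv_eq (dvZ (normal_peak 1) (dv_comp (is_derive_expR _) h2)) _.
by rewrite /gpdf; field.
Qed.

(** Both sides have the same derivative and vanish at minus infinity. *)
Lemma ncdf_scale s x : 0 < s -> ncdf s x = Phi (x / s).
Proof.
move=> s0; have s1 : s != 0 by rewrite gt_eqF.
have pdfE y : normal_pdf 0 s y = gpdf (y / s) * s^-1.
  rewrite normal_pdfE // /gpdf /normal_peak /normal_fun subr0 expr1n mul1r.
  rewrite -mulrnAr sqrtrM ?sqr_ge0 // sqrtr_sqr gtr0_norm // invfM.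
  rewrite (_ : - y ^+ 2 / (s ^+ 2 *+ 2) = - ((y / s) ^+ 2 / 2)); first by ring.
  by rewrite -mulr_natr; field.
pose D y := ncdf s y - Phi (y / s).
have D0 (y : R) : is_derive y 1 D 0.
  apply: dv_eq (dvB (ncdf_derive y s1) (dv_comp (Phi_derive _) (dvM (dv_id y) (dv_cst s^-1 y)))) _.
  by rewrite pdfE mulr1 mulr0 add0r subrr.
have lim1 : D (- n%:R) @[n --> \oo] --> (0 : R).
  have h1 := @ncdf_cvgNy s.
  have h2 : Phi (- n%:R / s) @[n --> \oo] --> (0 : R).
    apply/cvgrPdist_lt => e e0; have /cvgrPdist_lt /(_ e e0) [N _ hN] := @ncdf_cvgNy 1.
    near=> n; rewrite sub0r normrN ger0_norm; last by case/andP: (Phi_bounds (- n%:R / s)).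
    have := hN N (leqnn N); rewrite /= sub0r normrN ger0_norm; last by case/andP: (Phi_bounds (- N%:R)).
    apply: le_lt_trans; apply: Phi_le; rewrite mulNr lerN2 ler_pdivlMr //.
    by near: n; exact: nbhs_infty_ger.
  by have := cvgB h1 h2; rewrite subr0; apply.
have : D (- n%:R) @[n --> \oo] --> D x.
  rewrite (_ : (fun n => D (- n%:R)) = fun=> D x); first exact: cvg_cst.
  by apply/funext => n; exact: zero_derive_cst.
by move=> /(cvg_unique _ lim1) E; apply/eqP; rewrite -subr_eq0 -/(D x) -E.
Unshelve. all: by end_near. Qed.

(** The derivative of [Phi (- y) + Phi y] is zero, as the density is even, and
    its limit at infinity is 1. *)
Lemma PhiN x : Phi (- x) = 1 - Phi x.
Proof.
pose D y := Phi (- y) + Phi y.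
have D0 (y : R) : is_derive y 1 D 0.
  apply: dv_eq (dvD (dv_comp (Phi_derive _) (dvN (dv_id y))) (Phi_derive y)) _.
  by rewrite /gpdf sqrrN; ring.
have lim1 : D n%:R @[n --> \oo] --> (0 + 1 : R).
  by apply: cvgD; [exact: ncdf_cvgNy | exact: ncdf_cvgy].
have : D n%:R @[n --> \oo] --> D x.
  rewrite (_ : (fun n => D n%:R) = fun=> D x); first exact: cvg_cst.
  by apply/funext => n; exact: zero_derive_cst.
by move=> /(cvg_unique _ lim1) E; rewrite -(addrK (Phi x) (Phi (- x))) -/(D x) -E // add0r.
Qed.

Lemma Phi_surj u : 0 < u < 1 -> exists z, Phi z = u.
Proof.
case/andP=> u0 u1.
have [a ha] : exists a, Phi a < u.
  by have [N _ /(_ N (leqnn N)) h] := cvgr_lt _ (@ncdf_cvgNy 1) _ u0; exists (- N%:R).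
have [b hb] : exists b, u < Phi b.
  by have [N _ /(_ N (leqnn N)) h] := cvgr_gt _ (@ncdf_cvgy 1) _ u1; exists N%:R.
have ab : a <= b by rewrite leNgt; apply/negP => /ltW/Phi_le; rewrite leNgt (lt_trans ha hb).
have [c _ cu] := @IVT R Phi a b u ab (continuous_subspaceT Phi_continuous)
  ltac:(by rewrite ge_min le_max (ltW ha) (ltW hb) orbT).
by exists c.
Qed.
End Gaussian.

(** * Binomial averages and the heat flow *)

Section Heat.
Local Open Scope classical_set_scope.
Local Open Scope ring_scope.
Variable R : realType.

(** The second and third derivatives of [Phi]. *)
Let D2 (x : R) := - x * gpdf x.
Let D3 (x : R) := (x ^+ 2 - 1) * gpdf x.
Let c0 : R := normal_peak 1.

Lemma c0_gt0 : 0 < c0. Proof. by rewrite normal_peak_gt0 // oner_neq0. Qed.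

Lemma D2_derive (x : R) : is_derive x 1 D2 (D3 x).
Proof.
apply: dv_eq (dvM (dvN (dv_id x)) (gpdf_derive x)) _.
by rewrite /D3; ring.
Qed.

Let C : R := 16 * c0.

(** [expR (x ^+ 2 / 2)] is at least [(1 + x ^+ 2 / 4) ^+ 2], hence the
    constant. *)
Lemma gpdf_decay (x : R) : (1 + x ^+ 2 + x ^+ 4) * gpdf x <= C.
Proof.
rewrite /gpdf /C -/c0 mulrCA [leRHS]mulrC; apply: ler_wpM2l; first exact: ltW c0_gt0.
set t := x ^+ 2 / 2.
have t0 : 0 <= t by rewrite divr_ge0 // sqr_ge0.
have e1 : 1 + t / 2 <= expR (t / 2) by exact: expR_ge1Dx.
have eE : expR t = expR (t / 2) ^+ 2 by rewrite -expRM_natl; congr expR; field.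
have -> : 1 + x ^+ 2 + x ^+ 4 = 1 + 2 * t + 4 * t ^+ 2 by rewrite /t; field.
rewrite expRN ler_pdivrMr ?expR_gt0 // eE; move: (expR _) e1 => e e1; nra.
Qed.

Lemma ler_gpdf (x a : R) : `|a| <= 1 + x ^+ 2 + x ^+ 4 -> `|a * gpdf x| <= C.
Proof.
move=> h; rewrite normrM (gtr0_norm (gpdf_gt0 x)); apply: le_trans (gpdf_decay x).
by rewrite ler_wpM2r // ltW // gpdf_gt0.
Qed.

Lemma D2_bound x : `|D2 x| <= C.
Proof. by apply: ler_gpdf; rewrite ler_norml; apply/andP; split; nra. Qed.

Lemma D3_bound x : `|D3 x| <= C.
Proof. by apply: ler_gpdf; rewrite ler_norml; apply/andP; split; nra. Qed.

Lemma xD3_bound x : `|x * D3 x| <= C.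
Proof.
rewrite mulrA; apply: ler_gpdf; rewrite ler_norml.
by have := sqr_ge0 (x - 1); have := sqr_ge0 (x + 1); have := sqr_ge0 (x ^+ 2 - x);
  have := sqr_ge0 (x ^+ 2 + x); move=> *; apply/andP; split; nra.
Qed.

Lemma C_ge0 : 0 <= C. Proof. by rewrite mulr_ge0 // ltW // c0_gt0. Qed.

Lemma Phi_taylor w h :
  `|Phi (w + h) - Phi w - h * gpdf w - h ^+ 2 / 2 * D2 w| <= C * `|h| ^+ 3.
Proof.
pose f k := Phi (w + k) - Phi w - k * gpdf w - k ^+ 2 / 2 * D2 w.
pose df k := gpdf (w + k) - gpdf w - k * D2 w.
have fd (k : R) : is_derive k 1 f (df k).
  have h1 := dv_comp (Phi_derive _) (dvD (dv_cst w k) (dv_id k)).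
  have h2 := dvM (dv_id k) (dv_cst (gpdf w) k).
  have h3 := dvM (dvM (dvM (dv_id k) (dv_id k)) (dv_cst 2^-1 k)) (dv_cst (D2 w) k).
  apply: dv_eq (dvB (dvB (dvB h1 (dv_cst (Phi w) k)) h2) h3) _.
  by rewrite /df; field.
have dfb k : `|df k| <= C * `|k| ^+ 2.
  have [c [hc E]] := mvt w (w + k) (@gpdf_derive R).
  have [c' [hc' E']] := mvt w c D2_derive.
  rewrite (addrC w) addrK in hc.
  have -> : df k = D3 c' * (c - w) * k.
    by rewrite /df E -[- c * gpdf c]/(D2 c) -E' (addrC w) addrK; ring.
  rewrite normrM normrM expr2 -mulrA; apply: ler_pM => //; first exact: D3_bound.
  by apply: ler_wpM2r.
have f0 : f 0 = 0 by rewrite /f addr0 subrr; ring.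
have [c [hc E]] := mvt 0 h fd; rewrite f0 !subr0 in hc E.
rewrite -/(f h) E.
rewrite normrM exprSr mulrA; apply: ler_wpM2r => //; apply: (le_trans (dfb c)).
by rewrite ler_wpM2l ?C_ge0 // lerXn2r // nnegrE.
Qed.

Lemma mvt_pos (f df : R -> R) (a b : R) : (forall x : R, 0 < x -> is_derive x 1 f (df x)) ->
  0 < a <= b -> exists c, a <= c <= b /\ f b - f a = df c * (b - a).
Proof.
move=> fd /andP [a0 ab].
have [c] : exists2 c, c \in `[a, b] & f b - f a = df c * (b - a).
  apply: MVT_segment => //.
    by move=> x; rewrite in_itv /= => /andP [ax _]; apply: fd; exact: lt_trans ax.
  apply: derivable_within_continuous => x; rewrite in_itv /= => /andP [ax _].
  by have [] := fd x (lt_le_trans a0 ax).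
by rewrite in_itv /=; exists c.
Qed.

Lemma rescale_derive (y r : R) : 0 < r ->
  is_derive r 1 (fun r => y / Num.sqrt r) (- (y / Num.sqrt r) / (2 * r)).
Proof.
move=> r0; have s0 : 0 < Num.sqrt r by rewrite sqrtr_gt0.
have h := @is_deriveV R Num.sqrt r _ 1 (lt0r_neq0 s0) (is_derive1_sqrt r0).
apply: dv_eq (dvZ y h) _.
have rE : r = Num.sqrt r ^+ 2 by rewrite sqr_sqrtr // ltW.
have -> : 2 * r = 2 * Num.sqrt r ^+ 2 by rewrite -rE.
by rewrite /GRing.scale /=; field; rewrite gt_eqF.
Qed.

(** The heat equation: [Phi (y / sqrt r)] has derivative in [r] equal to half
    its second derivative in [y]. The bound is that of the second derivative in
    [r], away from [r = 0]. *)
Lemma Phi_time_taylor (eps r tau y : R) : 0 < eps <= r -> 0 <= tau ->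
  `|Phi (y / Num.sqrt (r + tau)) - Phi (y / Num.sqrt r) -
    tau * (D2 (y / Num.sqrt r) / (2 * r))| <= C / eps ^+ 2 * tau ^+ 2.
Proof.
case/andP => e0 er tau0; have r0 : 0 < r by exact: lt_le_trans er.
pose g rho := Phi (y / Num.sqrt rho).
pose dg rho := D2 (y / Num.sqrt rho) * (2 * rho)^-1.
pose ddg rho := - ((y / Num.sqrt rho) * D3 (y / Num.sqrt rho)) / (4 * rho ^+ 2)
                - D2 (y / Num.sqrt rho) / (2 * rho ^+ 2).
have gd (rho : R) : 0 < rho -> is_derive rho 1 g (dg rho).
  move=> h; apply: dv_eq (dv_comp (Phi_derive _) (rescale_derive y h)) _.
  by rewrite /dg /D2; ring.
have dgd (rho : R) : 0 < rho -> is_derive rho 1 dg (ddg rho).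
  move=> h.
  have h1 := @is_deriveV R (fun x => 2 * x) rho _ 1 (lt0r_neq0 (mulr_gt0 (ltr0n R 2) h)) (dvZ 2 (dv_id rho)).
  apply: dv_eq (dvM (dv_comp (D2_derive _) (rescale_derive y h)) h1) _.
  rewrite /ddg /GRing.scale /=; field; by rewrite ?gt_eqF ?sqrtr_gt0.
have ddgb rho : eps <= rho -> `|ddg rho| <= C / eps ^+ 2.
  move=> erho; have rho0 : 0 < rho by exact: lt_le_trans erho.
  have b1 := xD3_bound (y / Num.sqrt rho); have b2 := D2_bound (y / Num.sqrt rho).
  have ei : (rho ^+ 2)^-1 <= (eps ^+ 2)^-1.
    by rewrite lef_pV2 ?posrE ?exprn_gt0 // lerXn2r // nnegrE ltW.
  have ei0 : 0 < (rho ^+ 2)^-1 by rewrite invr_gt0 exprn_gt0.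
  have -> : ddg rho = (- ((y / Num.sqrt rho) * D3 (y / Num.sqrt rho)) / 4 -
     D2 (y / Num.sqrt rho) / 2) * (rho ^+ 2)^-1.
    by rewrite /ddg; field; rewrite ?gt_eqF ?sqrtr_gt0.
  rewrite normrM (gtr0_norm ei0); apply: ler_pM => //; first exact: ltW.
  move: (_ * D3 _) (D2 _) b1 b2 => u v; rewrite !ler_norml => /andP [? ?] /andP [? ?].
  by have := C_ge0; move=> ?; apply/andP; split; lra.
have rtau : 0 < r <= r + tau by rewrite r0 lerDl.
have [c [/andP [rc cr]]] := mvt_pos gd rtau.
rewrite (addrC r) addrK => E.
have rc0 : 0 < r <= c by rewrite r0.
have [c' [/andP [rc' cr']] E'] := mvt_pos dgd rc0.
rewrite -/(g (tau + r)) -/(g r) -/(dg r) E.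
have -> : dg c * tau - tau * dg r = tau * (ddg c' * (c - r)) by rewrite -E'; ring.
rewrite normrM (ger0_norm tau0) normrM [tau ^+ 2]expr2 [leRHS]mulrCA; apply: ler_wpM2l => //.
apply: ler_pM => //; first by apply: ddgb; exact: le_trans er rc'.
by rewrite ger0_norm ?subr_ge0 //; lra.
Qed.

Lemma sqrt_nat_ge (M : R) : \forall n \near \oo, M <= Num.sqrt n%:R.
Proof.
near=> n; apply: (le_trans (ler_norm M)).
rewrite -sqrtr_sqr ler_wsqrtr //; near: n; exact: nbhs_infty_ger.
Unshelve. all: by end_near. Qed.

Lemma inv_sqrt_nat_cvg0 : (fun n => (Num.sqrt n%:R)^-1) @ \oo --> (0 : R).
Proof.
apply/cvgrPdist_le => e e0; near=> n.
have h : e^-1 <= Num.sqrt n%:R by near: n; exact: sqrt_nat_ge.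
have ei : 0 < e^-1 by rewrite invr_gt0.
rewrite sub0r normrN ger0_norm ?invr_ge0 ?sqrtr_ge0 //.
by rewrite -[leRHS]invrK lef_pV2 // posrE (lt_le_trans ei).
Unshelve. all: by end_near. Qed.

Section Binomial.
Variable q : R.
Hypotheses (q0 : 0 < q) (q1 : q < 1).
Let p := 1 - q.
Let p0 : 0 < p. Proof. by rewrite subr_gt0. Qed.
Let F (r y : R) := Phi (y / Num.sqrt r).

(** One step of the random walk, against one step of the heat flow: the centred
    increment has variance [p q], so the expansions agree to second order. *)
Lemma heat_step eps : 0 < eps -> exists K, forall r y h, eps <= r -> `|h| <= 1 ->
  `|p * F r (y - h * q) + q * F r (y + h * p) - F (r + h ^+ 2 * (p * q)) y| <= K * `|h| ^+ 3.
Proof.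
move=> e0; pose S := Num.sqrt eps; have S0 : 0 < S by rewrite sqrtr_gt0.
pose K1 := C * (S ^- 1) ^+ 3; pose K2 := C / eps ^+ 2.
exists (2 * K1 + K2) => r y h er h1.
have r0 : 0 < r by exact: lt_le_trans er.
pose s := Num.sqrt r; have s0 : 0 < s by rewrite sqrtr_gt0.
have Ss : s^-1 <= S^-1 by rewrite lef_pV2 ?posrE // ler_wsqrtr.
have si0 : 0 < s^-1 by rewrite invr_gt0.
have rE : r = s ^+ 2 by rewrite sqr_sqrtr // ltW.
pose w := y / s; pose T x := Phi (w + x) - Phi w - x * gpdf w - x ^+ 2 / 2 * D2 w.
have p1 : p <= 1 by rewrite gerBl ltW.
have Tb x a : `|a| <= `|h| -> x = a / s -> `|T x| <= K1 * `|h| ^+ 3.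
  move=> ah ->; apply: (le_trans (Phi_taylor _ _)).
  rewrite /K1 -mulrA; apply: ler_wpM2l; first exact: C_ge0.
  rewrite mulrC -exprMn normrM (gtr0_norm si0) lerXn2r ?nnegrE ?mulr_ge0 ?(ltW si0) //.
    by rewrite invr_ge0 ltW.
  by rewrite ler_pM // ltW.
have T1 := Tb (- (h * q) / s) (- (h * q)) _ erefl.
have T2 := Tb (h * p / s) (h * p) _ erefl.
have {}T1 : `|T (- (h * q) / s)| <= K1 * `|h| ^+ 3.
  by apply: T1; rewrite normrN normrM ler_piMr // ger0_norm // ltW.
have {}T2 : `|T (h * p / s)| <= K1 * `|h| ^+ 3.
  by apply: T2; rewrite normrM ler_piMr // ger0_norm // ltW.
have tau0 : 0 <= h ^+ 2 * (p * q) by rewrite mulr_ge0 ?sqr_ge0 // mulr_ge0 // ltW.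
have T3 := @Phi_time_taylor eps r (h ^+ 2 * (p * q)) y _ tau0.
have {}T3 := T3 ltac:(by rewrite e0 er).
set U := (X in `|X| <= _) in T3.
have -> : p * F r (y - h * q) + q * F r (y + h * p) - F (r + h ^+ 2 * (p * q)) y =
  p * T (- (h * q) / s) + q * T (h * p / s) - U.
  rewrite /U /T /F -/s -/w (_ : (y - h * q) / s = w + - (h * q) / s); last by rewrite mulrDl.
  rewrite (_ : (y + h * p) / s = w + h * p / s); last by rewrite mulrDl.
  have -> : 2 * r = 2 * s ^+ 2 by rewrite -rE.
  have qE : q = 1 - p by rewrite /p; ring.
  move: (Phi _) (Phi _) (Phi _) (Phi w) (gpdf w) (D2 w) => x1 x2 x3 x4 x5 x6.
  by rewrite qE; field; rewrite gt_eqF.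
have h3 : 0 <= `|h| ^+ 3 by rewrite exprn_ge0.
have K10 : 0 <= K1 by rewrite mulr_ge0 ?C_ge0 // exprn_ge0 // invr_ge0 ltW.
have K20 : 0 <= K2 by rewrite divr_ge0 ?C_ge0 // exprn_ge0 // ltW.
have U3 : `|U| <= K2 * `|h| ^+ 3.
  apply: (le_trans T3); apply: ler_wpM2l => //.
  have -> : h ^+ 2 = `|h| ^+ 2 by rewrite real_normK // num_real.
  have pq1 : p * q <= 1 by rewrite mulr_ile1 // ltW.
  have pq0 : 0 <= p * q by rewrite mulr_ge0 // ltW.
  apply: (@le_trans _ _ ((`|h| ^+ 2) ^+ 2)).
    have h20 : 0 <= `|h| ^+ 2 by rewrite exprn_ge0.
    apply: lerXn2r; rewrite ?nnegrE //; first exact: mulr_ge0.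
    by rewrite ler_piMr.
  by rewrite -exprM; apply: ler_wiXn2l.
apply: le_trans (ler_normB _ _) _; rewrite [leRHS]mulrDl; apply: lerD => //.
apply: le_trans (ler_normD _ _) _; have -> : 2 * K1 * `|h| ^+ 3 = K1 * `|h| ^+ 3 + K1 * `|h| ^+ 3 by ring.
apply: lerD; rewrite normrM; [apply: le_trans T1|apply: le_trans T2].
  by rewrite ler_piMl // ger0_norm // ltW.
by rewrite ler_piMl // ger0_norm // ltW.
Qed.

(** Telescoping over the trials: each of them trades a step of variance
    [h ^+ 2 * (p * q)] for as much time of the heat flow. *)
Lemma bin_mean_heat eps : 0 < eps -> exists K, forall n r y h, eps <= r -> `|h| <= 1 ->
  `|bin_mean q n (fun j => F r (y - h * (j%:R - n%:R * p)))
     - F (r + n%:R * (h ^+ 2 * (p * q))) y| <= n%:R * (K * `|h| ^+ 3).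
Proof.
move=> e0; have [K hK] := heat_step e0; exists K => n r y h + h1.
have tau0 : 0 <= h ^+ 2 * (p * q) by rewrite mulr_ge0 ?sqr_ge0 // mulr_ge0 // ltW.
elim: n r => [|n IH] r er.
  by rewrite bin_mean0 !mul0r subrr mulr0 subr0 addr0 subrr normr0.
pose r' := r + h ^+ 2 * (p * q).
have er' : eps <= r' by rewrite (le_trans er) // lerDl.
have := IH r' er'.
set A := bin_mean q n _; set B := bin_mean q n.+1 _.
have -> : r' + n%:R * (h ^+ 2 * (p * q)) = r + n.+1%:R * (h ^+ 2 * (p * q)).
  by rewrite /r' -natr1; ring.
have BA : `|B - A| <= K * `|h| ^+ 3.
  have -> : B - A = bin_mean q n (fun j => let z := y - h * (j%:R - n%:R * p) in
     p * F r (z - h * q) + q * F r (z + h * p) - F r' z).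
    rewrite /B bin_meanS // /A /=.
    pose f (j : nat) := F r (y - h * (j.+1%:R - n.+1%:R * p)).
    pose g (j : nat) := F r (y - h * (j%:R - n.+1%:R * p)).
    pose k (j : nat) := F r' (y - h * (j%:R - n%:R * p)).
    rewrite -[(1 - q) * _]/(p * bin_mean q n f) -[q * _]/(q * bin_mean q n g).
    rewrite -[X in _ - X]/(bin_mean q n k) -(bin_meanZ q n p f) -(bin_meanZ q n q g).
    rewrite -(bin_meanD q n (fun j => p * f j) (fun j => q * g j)).
    rewrite -(bin_meanB q n _ k); apply: eq_bin_mean => j _ /=.
    congr (p * F r _ + q * F r _ - _); rewrite -?[j.+1%:R]natr1 -[n.+1%:R]natr1 /p; ring.
  apply: le_trans (ler_norm_bin_mean q0 q1 _ _) _.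
  rewrite -[leRHS](bin_mean_cst q0 q1 n); apply: le_bin_mean => // j _.
  exact: hK.
move=> hA; set G := F _ y in hA *.
have -> : B - G = (B - A) + (A - G) by ring.
apply: le_trans (ler_normD _ _) _.
by rewrite -natr1 mulrDl mul1r addrC; apply: lerD.
Qed.

(** With steps of size [c / sqrt n], the [n] errors of third order add up to a
    multiple of [1 / sqrt n]. *)
Lemma bin_mean_Phi_cvg (r c y : R) : 0 < r ->
  (fun n => bin_mean q n (fun j => F r (y - c * ((j%:R - n%:R * p) / Num.sqrt n%:R))))
    @ \oo --> F (r + c ^+ 2 * (p * q)) y.
Proof.
move=> r0; have [K hK] := bin_mean_heat r0.
apply/cvgrPdist_le => e e0.
have v0 : (fun n => K * `|c| ^+ 3 * (Num.sqrt n%:R)^-1) @ \oo --> (0 : R).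
  exact: cvg0_scale inv_sqrt_nat_cvg0.
near=> n.
have n0 : 0 < n%:R :> R by rewrite ltr0n; near: n; exact: nbhs_infty_gt.
pose s := Num.sqrt n%:R : R; have s0 : 0 < s by rewrite sqrtr_gt0.
have sE : n%:R = s ^+ 2 by rewrite sqr_sqrtr // ltW.
have c1 : `|c / s| <= 1.
  rewrite normrM [X in _ * X]gtr0_norm ?invr_gt0 // ler_pdivrMr // mul1r.
  by rewrite /s; near: n; exact: sqrt_nat_ge.
have := hK n r y (c / s) (lexx r) c1.
rewrite distrC.
have -> : n%:R * ((c / s) ^+ 2 * (p * q)) = c ^+ 2 * (p * q).
  by rewrite sE; field; rewrite gt_eqF.
rewrite (@eq_bin_mean _ _ _ _ (fun j => F r (y - c * ((j%:R - n%:R * p) / s)))); last first.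
  by move=> j _; congr (F r (y - _)); rewrite mulrAC mulrA.
move=> /le_trans; apply.
have -> : n%:R * (K * `|c / s| ^+ 3) = K * `|c| ^+ 3 * s^-1.
  rewrite sE normrM [`|s^-1|]gtr0_norm ?invr_gt0 //; field; by rewrite gt_eqF.
by rewrite /s; near: n; apply: (cvgr_le _ v0).
Unshelve. all: by end_near. Qed.
End Binomial.
End Heat.

(** * Normal limit of binomial quantiles *)

Section Quantile.
Local Open Scope classical_set_scope.
Local Open Scope ring_scope.
Variables (R : realType) (q : R).
Hypotheses (q0 : 0 < q) (q1 : q < 1).
Let p := 1 - q.
Let p0 : 0 < p. Proof. by rewrite subr_gt0. Qed.

Lemma leq_of_bool (b1 b2 : bool) : (b1 -> b2) -> (b1 <= b2)%N.
Proof. by case: b1 b2 => [] [] // /(_ isT). Qed.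

Lemma bin_mean_le_addr n (f g : nat -> R) c : (forall j, (j <= n)%N -> f j <= g j + c) ->
  bin_mean q n f <= bin_mean q n g + c.
Proof.
move=> h; rewrite -[X in _ + X](bin_mean_cst q0 q1 n) -(bin_meanD q n g (fun=> c)).
exact: le_bin_mean.
Qed.

Definition bin_cdf (n j : nat) : R := bin_mean q n (fun i => (i <= j)%N%:R).

(** The least [j] with [u <= bin_cdf n j], counted by the values below it; see
    [bin_quantileE]. *)
Definition bin_quantile (n : nat) (u : R) : nat := (\sum_(j < n) (bin_cdf n j < u)%R)%N.

Lemma bin_cdf_le n i j : (i <= j)%N -> bin_cdf n i <= bin_cdf n j.
Proof.
move=> ij; apply: le_bin_mean => // k _; rewrite ler_nat.
by case: (leqP k i) => // ki; rewrite (leq_trans ki ij).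
Qed.

Lemma bin_cdf1 n j : (n <= j)%N -> bin_cdf n j = 1.
Proof.
move=> nj; rewrite -[RHS](bin_mean_cst q0 q1 n); apply: eq_bin_mean => k kn.
by rewrite (leq_trans kn nj).
Qed.

Lemma bin_quantile_le_size n u : (bin_quantile n u <= n)%N.
Proof.
rewrite -[leqRHS]card_ord -sum1_card; apply: leq_sum => j _.
by case: (_ < u).
Qed.

Lemma bin_quantileE n u j : u <= 1 -> (bin_quantile n u <= j)%N = (u <= bin_cdf n j).
Proof.
move=> u1; case: (ltnP j n) => [jn|nj]; last first.
  by rewrite bin_cdf1 // u1 (leq_trans (bin_quantile_le_size n u) nj).
have [h|h] := leP u (bin_cdf n j).
  apply: (@leq_trans (\sum_(k < n | (k < j)%N) 1)); last first.
    by rewrite -(big_ord_widen n (fun=> 1%N)) ?sum1_card ?card_ord // ltnW.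
  rewrite [leqRHS]big_mkcond; apply: leq_sum => k _.
  case: ltnP => [_|jk]; first by case: (_ < u).
  by rewrite ltNge (le_trans h) ?bin_cdf_le.
apply/negbTE; rewrite -ltnNge.
apply: (@leq_trans (\sum_(k < n | (k < j.+1)%N) 1)).
  by rewrite -(big_ord_widen n (fun=> 1%N)) ?sum1_card ?card_ord.
rewrite [leqLHS]big_mkcond; apply: leq_sum => k _; case: ifP => // kj.
by rewrite (le_lt_trans _ h) // bin_cdf_le.
Qed.

Let W (n j : nat) : R := (j%:R - n%:R * p) / Num.sqrt n%:R.
Let G n x := bin_mean q n (fun j => (W n j <= x)%R%:R).
Let s2 := p * q.
Let s2_gt0 : 0 < s2. Proof. by rewrite mulr_gt0. Qed.

(** As [r] tends to 0, the smoothing by a Gaussian of variance [r] and its error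
    at distance [d] both disappear. *)
Lemma Phi_smoothing_lb (a d : R) : forall v, v < Phi (a / Num.sqrt s2) -> 0 < d ->
  exists2 r, 0 < r & v < Phi (a / Num.sqrt (r + s2)) - Phi (- d / Num.sqrt r).
Proof.
move=> v hv d0.
pose r (m : nat) : R := (m.+1%:R)^-1 ^+ 2.
have r_cvg : (fun m => r m + s2) @ \oo --> 0 ^+ 2 + s2.
  apply: cvgD; last exact: cvg_cst.
  by apply: cvgM; exact: cvg_harmonic.
have c1 : (fun m => Phi (a / Num.sqrt (r m + s2))) @ \oo --> Phi (a / Num.sqrt s2).
  apply: continuous_cvg; first exact: Phi_continuous.
  apply: cvgMl_tmp; apply: cvgV; first by rewrite gt_eqF // sqrtr_gt0.
  apply: continuous_cvg; first exact: sqrt_continuous.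
  by move: r_cvg; rewrite expr0n add0r.
have c2 : (fun m => Phi (- d / Num.sqrt (r m))) @ \oo --> (0 : R).
  apply/cvgrPdist_lt => e e0; have /cvgrPdist_lt /(_ e e0) [N _ hN] := @ncdf_cvgNy R 1.
  near=> n; rewrite sub0r normrN ger0_norm; last by case/andP: (Phi_bounds (- d / Num.sqrt (r n))).
  have := hN N (leqnn N); rewrite /= sub0r normrN ger0_norm; last by case/andP: (Phi_bounds (- N%:R : R)).
  apply: le_lt_trans; apply: Phi_le.
  rewrite sqrtr_sqr ger0_norm ?invr_ge0 // invrK mulNr lerN2 mulrC -ler_pdivrMr //.
  apply: (@le_trans _ _ n%:R); last by rewrite ler_nat.
  by near: n; exact: nbhs_infty_ger.
have c12 : (fun m => Phi (a / Num.sqrt (r m + s2)) - Phi (- d / Num.sqrt (r m))) @ \oo -->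
    Phi (a / Num.sqrt s2) - 0 by exact: cvgB c1 c2.
rewrite subr0 in c12.
have [N _ /(_ N (leqnn N)) h] := cvgr_gt _ c12 _ hv.
by exists (r N); rewrite // exprn_gt0 // invr_gt0.
Unshelve. all: by end_near. Qed.

(** The indicator of a ray is compared with its smoothing by a Gaussian of
    variance [r], shifted by [d]: beyond that distance the smoothing is at most
    [Phi (- d / sqrt r)]. *)
Lemma bin_law_lb n r d x : 0 < r ->
  bin_mean q n (fun j => Phi ((x - d - 1 * W n j) / Num.sqrt r)) - Phi (- d / Num.sqrt r) <= G n x.
Proof.
move=> r0; rewrite lerBlDr; apply: bin_mean_le_addr => j _; rewrite mul1r.
have sr : 0 < Num.sqrt r by rewrite sqrtr_gt0.
have [h|h] := leP (W n j) x => /=.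
  have /andP [_ h1] := Phi_bounds ((x - d - W n j) / Num.sqrt r).
  by have /andP [h2 _] := Phi_bounds (- d / Num.sqrt r); lra.
by rewrite add0r; apply: Phi_le; rewrite ler_pM2r ?invr_gt0 //; lra.
Qed.

Lemma bin_law_ub n r d x : 0 < r ->
  G n x <= bin_mean q n (fun j => Phi ((x + d - 1 * W n j) / Num.sqrt r)) + Phi (- d / Num.sqrt r).
Proof.
move=> r0; apply: bin_mean_le_addr => j _; rewrite mul1r.
have sr : 0 < Num.sqrt r by rewrite sqrtr_gt0.
have [h|h] := leP (W n j) x => /=.
  have : Phi (d / Num.sqrt r) <= Phi ((x + d - W n j) / Num.sqrt r).
    by apply: Phi_le; rewrite ler_pM2r ?invr_gt0 //; lra.
  by rewrite mulNr PhiN; lra.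
have /andP [h1 _] := Phi_bounds ((x + d - W n j) / Num.sqrt r).
by have /andP [h2 _] := Phi_bounds (- d / Num.sqrt r); rewrite addr_ge0.
Qed.

(** For every [e > 0], the limiting distribution function separates [u] strictly
    from its values at [sqrt s2 * z - e] and [sqrt s2 * z + e]; the binomial ones
    do so too when [n] is large, which traps the quantile. *)
Lemma bin_quantile_cvg u z : 0 < u < 1 -> Phi z = u ->
  (fun n => W n (bin_quantile n u)) @ \oo --> Num.sqrt s2 * z.
Proof.
move=> /andP [u0 u1] zu; pose s := Num.sqrt s2; have s0 : 0 < s by rewrite sqrtr_gt0.
have sE : s2 = s ^+ 2 by rewrite sqr_sqrtr // ltW.
apply/cvgrPdist_le => e e0.
have d0 : 0 < e / 2 by rewrite divr_gt0.
have [r1 r10 hr1] : exists2 r, 0 < r &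
    u < Phi ((s * z + e - e / 2) / Num.sqrt (r + s2)) - Phi (- (e / 2) / Num.sqrt r).
  apply: Phi_smoothing_lb => //; rewrite -zu; apply: Phi_lt.
  rewrite -/s ltr_pdivlMr //; lra.
(* The upper bound is the lower bound for the reflected law. *)
have [r2 r20 hr2] : exists2 r, 0 < r & 1 - u <
    Phi (- (s * z - e + e / 2) / Num.sqrt (r + s2)) - Phi (- (e / 2) / Num.sqrt r).
  apply: Phi_smoothing_lb => //; rewrite -zu -PhiN; apply: Phi_lt.
  rewrite -/s ltr_pdivlMr //; lra.
have c1 := @bin_mean_Phi_cvg R q q0 q1 r1 1 (s * z + e - e / 2) r10.
have c2 := @bin_mean_Phi_cvg R q q0 q1 r2 1 (s * z - e + e / 2) r20.
rewrite expr1n mul1r -/p -/s2 in c1 c2.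
near=> n.
have n0 : 0 < n%:R :> R by rewrite ltr0n; near: n; exact: nbhs_infty_gt.
have sn0 : 0 < Num.sqrt n%:R :> R by rewrite sqrtr_gt0.
have Wle (i j : nat) : (W n i <= W n j) = (i <= j)%N.
  by rewrite /W ler_pM2r ?invr_gt0 // lerD2r ler_nat.
have G1 : u < G n (s * z + e).
  apply: lt_le_trans (bin_law_lb n (e / 2) (s * z + e) r10).
  rewrite ltrBrDr; near: n; apply: (cvgr_gt _ c1); rewrite -ltrBrDr; exact: hr1.
have G2 : G n (s * z - e) < u.
  apply: le_lt_trans (bin_law_ub n (e / 2) (s * z - e) r20) _.
  rewrite -ltrBrDr; near: n; apply: (cvgr_lt _ c2).
  move: hr2; rewrite !mulNr !PhiN -subr_gt0 => h; rewrite -subr_gt0.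
  by apply: (lt_le_trans h); rewrite le_eqVlt; apply/orP; left; apply/eqP; ring.
set b := bin_quantile n u.
have bE j : (b <= j)%N = (u <= bin_cdf n j) by apply: bin_quantileE; exact: ltW.
rewrite distrC ler_distl; apply/andP; split.
  rewrite leNgt; apply/negP => h.
  have : u <= bin_cdf n b by rewrite -bE.
  apply/negP; rewrite -ltNge; apply: le_lt_trans G2.
  apply: le_bin_mean => // j _; rewrite ler_nat; apply: leq_of_bool => jb.
  by apply: le_trans (ltW h); rewrite Wle.
rewrite leNgt; apply/negP => h.
have Wb j : W n j <= s * z + e -> (j < b)%N.
  by move=> jb; rewrite ltnNge -Wle -ltNge; exact: le_lt_trans h.
suff : G n (s * z + e) <= u by rewrite leNgt G1.
case E : b => [|b'].
  apply: le_trans (ltW u0); rewrite -(bin_mean_cst q0 q1 n 0).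
  apply: le_bin_mean => // j _; rewrite -[leRHS]/(0%N%:R) ler_nat.
  by apply: (@leq_of_bool _ false) => /Wb; rewrite E.
have : ~~ (b <= b')%N by rewrite E ltnn.
rewrite bE -ltNge => /ltW; apply: le_trans.
apply: le_bin_mean => // j _; rewrite ler_nat; apply: leq_of_bool => /Wb.
by rewrite E ltnS.
Unshelve. all: by end_near. Qed.
End Quantile.

(** * Binary digits of a uniform variable *)

Section JointLaw.
Local Open Scope classical_set_scope.
Local Open Scope ring_scope.
Context d (T : measurableType d) (R : realType) (P : probability T R).
Variables (S : set T) (mS : measurable S) (X : {mfun T >-> measurableTypeR R}).

Definition law_on : set (measurableTypeR R) -> \bar R := pushforward (mrestr P mS) X.

Let law_on0 : law_on set0 = 0%E.
Proof. exact: measure0. Qed.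

Let law_on_ge0 A : (0 <= law_on A)%E.
Proof. exact: measure_ge0. Qed.

Let law_on_sigma_additive : semi_sigma_additive law_on.
Proof. exact: measure_semi_sigma_additive. Qed.

HB.instance Definition _ := isMeasure.Build _ _ _ law_on
  law_on0 law_on_ge0 law_on_sigma_additive.

End JointLaw.

Section Rays.
Local Open Scope classical_set_scope.
Local Open Scope ring_scope.
Variable R : realType.

(** Rays are stable under intersection and generate the Borel sets. *)
Lemma eq_measure_rays (m1 m2 : {measure set (measurableTypeR R) -> \bar R}) :
  (forall x : R, (m1 `]-oo, x]%classic < +oo)%E) ->
  (forall x : R, m1 `]-oo, x]%classic = m2 `]-oo, x]%classic) ->
  forall A : set (measurableTypeR R), measurable A -> m1 A = m2 A.
Proof.
move=> fin1 E A mA.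
pose G : set (set (measurableTypeR R)) := [set A | exists x : R, A = `]-oo, x]%classic].
apply: (@g_sigma_algebra_measure_unique _ _ _ G _ (fun n : nat => `]-oo, n%:R]%classic)).
- by move=> _ [x ->]; exact: measurable_itv.
- by move=> n; exists n%:R.
- rewrite -subTset => x _; exists (Num.bound `|x|) => //=; rewrite in_itv /=.
  by apply: le_trans (ler_norm _) _; apply: ltW; exact: archi_boundP.
- move=> _ _ [x ->] [y ->]; exists (Num.min x y).
  by apply/seteqP; split => z; rewrite /= !in_itv /= le_min => /andP.
- by move=> _ [x ->]; exact: E.
- by move=> k; exact: fin1.
suff -> : <<s G >> = @measurable _ (measurableTypeR R) by [].
apply/seteqP; split.
  by apply: smallest_sub; [exact: sigma_algebra_measurable | move=> _ [x ->]; exact: measurable_itv].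
apply: smallest_sub; first exact: smallest_sigma_algebra.
move=> _ [[a b] _ <-] /=.
have -> : `]a, b]%classic = `]-oo, b]%classic `\` `]-oo, a]%classic.
  apply/seteqP; split => z; rewrite /= !in_itv /=.
    by move=> /andP [h1 h2]; split => //; apply/negP; rewrite -ltNge.
  by move=> [h1 /negP]; rewrite -ltNge => ->.
apply: (@measurableD _ (g_sigma_algebraType G)); apply: sub_sigma_algebra.
  by exists b.
by exists a.
Qed.

(** The distribution function of the uniform law. *)
Definition clip (t : R) : R := Num.max 0 (Num.min 1 t).

Lemma clip_le0 (t : R) : t <= 0 -> clip t = 0.
Proof. by move=> t0; rewrite /clip (min_idPr (le_trans t0 ler01)) (max_idPl t0). Qed.

Lemma clip_ge1 (t : R) : 1 <= t -> clip t = 1.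
Proof. by move=> t1; rewrite /clip (min_idPl t1) (max_idPr ler01). Qed.

Lemma clip_id (t : R) : 0 <= t <= 1 -> clip t = t.
Proof. by case/andP => h0 h1; rewrite /clip (min_idPr h1) (max_idPr h0). Qed.

Lemma clip01 (t : R) : 0 <= clip t <= 1.
Proof.
case: (leP t 0) => [/clip_le0 ->|t0]; first by rewrite lexx ler01.
case: (leP 1 t) => [/clip_ge1 ->|t1]; first by rewrite lexx ler01.
by rewrite clip_id !ltW.
Qed.

(** The uniform law is the average of its copies on the two halves of the
    interval; the next two identities describe each of the copies. *)
Lemma clip_half (t : R) : clip t = (clip (2 * t) + clip (2 * t - 1)) / 2.
Proof.
case: (leP t 0) => [t0|t0]; first by rewrite !clip_le0; lra.
case: (leP t (1 / 2)) => [t1|t1].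
  by rewrite (clip_le0 (t := 2 * t - 1)) ?clip_id ?clip_id; lra.
case: (leP 1 t) => [t2|t2]; first by rewrite !clip_ge1; lra.
by rewrite (clip_ge1 (t := 2 * t)) ?clip_id ?clip_id; lra.
Qed.

Lemma clip_lower_half (x : R) : 2 * clip (Num.min (1 / 2) (x / 2)) = clip x.
Proof.
case: (leP x 0) => [x0|x0].
  by rewrite (clip_le0 x0) clip_le0 ?mulr0 // ge_min; apply/orP; right; lra.
case: (leP 1 x) => [x1|x1].
  by rewrite (clip_ge1 x1) (min_idPl _) ?clip_id; lra.
by rewrite (min_idPr _) ?(clip_id (t := x)) ?clip_id; lra.
Qed.

Lemma clip_upper_half (x : R) :
  2 * (clip (Num.max (1 / 2) ((x + 1) / 2)) - clip (1 / 2)) = clip x.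
Proof.
have -> : clip (1 / 2) = 1 / 2 by rewrite clip_id; lra.
case: (leP x 0) => [x0|x0].
  by rewrite (clip_le0 x0) (max_idPl _) ?clip_id; lra.
rewrite (max_idPr _); last lra.
case: (leP 1 x) => [x1|x1]; first by rewrite (clip_ge1 x1) clip_ge1; lra.
by rewrite (clip_id (t := x)) ?clip_id; lra.
Qed.

Notation unif := (uniform_prob (@ltr01 R)).

Lemma unif_ray (t : R) : unif `]-oo, t]%classic = (clip t)%:E.
Proof.
rewrite /uniform_prob integral_uniform_pdf.
rewrite (eq_integral (fun=> 1%:E)); last first.
  by move=> x /[!inE] -[_]; rewrite /= in_itv /= /uniform_pdf => ->; rewrite subr0 invr1.
rewrite integral_cst; last by apply: measurableI; exact: measurable_itv.
rewrite mul1e.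
have -> : `]-oo, t]%classic `&` `[0, 1]%classic = `[0, Num.min 1 t]%classic :> set R.
  apply/seteqP; split => z; rewrite /= !in_itv /= le_min.
    by move=> [h1 /andP [-> ->]].
  by move=> /andP [-> /andP [-> ->]].
transitivity (lebesgue_measure ([set` `[0, Num.min 1 t]] : set R)); first by [].
rewrite lebesgue_measure_itv /= lte_fin.
case: ifPn => h; first by rewrite /clip sube0 (max_idPr (ltW h)).
by rewrite /clip (max_idPl _) // leNgt.
Qed.

Definition bit (x : R) : R := \1_(`]1/2, +oo[%classic : set R) x.
(** Deletion of the first binary digit. *)
Definition shift_bits (x : R) : R := 2 * x - bit x.

Lemma bitE (x : R) : bit x = (1 / 2 < x)%R%:R.
Proof. by rewrite /bit indicE mem_setE in_itv /= andbT. Qed.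

Lemma measurable_bit : measurable_fun setT bit.
Proof. apply: measurable_indic; exact: measurable_itv. Qed.

Lemma measurable_shift_bits : measurable_fun setT shift_bits.
Proof. by apply: measurable_funB; [exact: measurable_funM | exact: measurable_bit]. Qed.

Let D0 : set (measurableTypeR R) := `]-oo, 1/2]%classic.
Let D1 : set (measurableTypeR R) := ~` D0.
Let mD0 : measurable D0. Proof. exact: measurable_itv. Qed.
Let mD1 : measurable D1. Proof. exact: measurableC. Qed.

Let shiftT : measurableTypeR R -> measurableTypeR R := shift_bits.
HB.instance Definition _ := @isMeasurableFun.Build _ _ _ _ shiftT measurable_shift_bits.

Let nng2 : {nonneg R} := 2%:nng.

(** Deleting the first binary digit preserves the uniform measure, whatever the
    value of that digit; by [eq_measure_rays] it suffices to compare
    distribution functions. *)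
Lemma unif_shift_half (b : bool) (A : set (measurableTypeR R)) : measurable A ->
  unif ((if b then D1 else D0) `&` shift_bits @^-1` A) = ((2%:R^-1)%:E * unif A)%E.
Proof.
move=> mA.
pose nu := law_on unif (if b as b return measurable (if b then D1 else D0) then mD1 else mD0) (shiftT : {mfun _ >-> _}).
(* [nu] is the law of the remaining digits on the event of the first digit,
   of probability [1 / 2]. *)
have nuE (B : set (measurableTypeR R)) : mscale nng2 nu B =
    (2%:E * unif (shift_bits @^-1` B `&` (if b then D1 else D0)))%E by [].
have hE : forall x : R, mscale nng2 nu `]-oo, x]%classic = (clip x)%:E.
  move=> x; rewrite nuE.
  case: b {nu nuE}.
    have -> : shift_bits @^-1` `]-oo, x]%classic `&` D1 =
        `]-oo, Num.max (1 / 2) ((x + 1) / 2)]%classic `\` D0.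
      apply/seteqP; split => z; rewrite /D1 /D0 /= !in_itv /= /shift_bits bitE.
        move=> [+ /negP]; rewrite -ltNge => + z2; rewrite z2 /= => h; split; last by apply/negP; rewrite -ltNge.
        by rewrite le_max; apply/orP; right; lra.
      move=> [+ /negP]; rewrite -ltNge le_max => + z2; rewrite z2 leNgt z2 /= => h.
      by split; first lra.
    rewrite (@measureD _ (measurableTypeR R) R unif) ?setIidr //=; last 2 first.
    - by move=> z; rewrite /D0 /= !in_itv /= le_max => ->.
    - exact: (le_lt_trans (probability_le1 _ _)) (ltry _).
    by rewrite !unif_ray -EFinB -EFinM clip_upper_half.
  have -> : shift_bits @^-1` `]-oo, x]%classic `&` D0 =
        `]-oo, Num.min (1 / 2) (x / 2)]%classic.
    apply/seteqP; split => z; rewrite /D0 /= !in_itv /= /shift_bits bitE.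
      by move=> [+ z2]; rewrite ltNge z2 /= le_min => h; apply/andP; split; lra.
    by rewrite le_min => /andP [z2 h]; rewrite ltNge z2 /=; split; lra.
  by rewrite unif_ray -EFinM clip_lower_half.
have E : mscale nng2 nu A = unif A.
  apply: eq_measure_rays mA => x; last exact: etrans (hE x) (esym (unif_ray x)).
  by rewrite -[X in (X < _)%E]/(mscale nng2 nu `]-oo, x]%classic) hE ltry.
by rewrite -E nuE muleA -EFinM mulVf // mul1e setIC.
Qed.

(** Ranks start at 0, so the first digit has even rank. *)
Fixpoint even_digits_trunc (n : nat) (x : R) : R :=
  if n is n'.+1 then (bit x + even_digits_trunc n' (shift_bits (shift_bits x))) / 2 else 0.

Lemma even_digits_trunc_bounds n x : 0 <= even_digits_trunc n x <= 1.
Proof.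
elim: n x => [|n IH] x /=; first by rewrite lexx ler01.
have /andP [h1 h2] := IH (shift_bits (shift_bits x)).
by rewrite bitE; case: (1 / 2 < x); apply/andP; split => /=; lra.
Qed.

Lemma even_digits_trunc_nd x : nondecreasing_seq (even_digits_trunc ^~ x).
Proof.
apply/nondecreasing_seqP => n; elim: n x => [|n IH] x /=.
  by case/andP: (even_digits_trunc_bounds 1 x).
by have := IH (shift_bits (shift_bits x)); rewrite /=; lra.
Qed.

Definition even_digits (x : R) : R := limn (even_digits_trunc ^~ x).
Definition odd_digits (x : R) : R := even_digits (shift_bits x).

Lemma even_digits_cvg x : even_digits_trunc n x @[n --> \oo] --> even_digits x.
Proof.
apply: nondecreasing_is_cvgn; first exact: even_digits_trunc_nd.
by exists 1 => _ [n _ <-]; case/andP: (even_digits_trunc_bounds n x).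
Qed.

Lemma even_digitsE x : even_digits x = (bit x + odd_digits (shift_bits x)) / 2.
Proof.
have h1 : even_digits_trunc n.+1 x @[n --> \oo] --> even_digits x.
  by rewrite (cvg_shiftS (even_digits_trunc ^~ x)); exact: even_digits_cvg.
have h2 : (fun n => even_digits_trunc n.+1 x) @ \oo --> (bit x + odd_digits (shift_bits x)) / 2.
  apply: cvgMr_tmp; apply: cvgD; [exact: cvg_cst | exact: even_digits_cvg].
exact: (cvg_unique _ h1 h2).
Qed.

Lemma even_digits_bounds x : 0 <= even_digits x <= 1.
Proof.
apply/andP; split.
  by apply: limr_ge; [apply/cvg_ex; exists (even_digits x); exact: even_digits_cvg
    | near=> n; case/andP: (even_digits_trunc_bounds n x)].
by apply: limr_le; [apply/cvg_ex; exists (even_digits x); exact: even_digits_cvg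
    | near=> n; case/andP: (even_digits_trunc_bounds n x)].
Unshelve. all: by end_near. Qed.

Lemma measurable_even_digits : measurable_fun setT even_digits.
Proof.
apply: (@measurable_fun_cvg _ _ _ _ even_digits_trunc); last by move=> x _; exact: even_digits_cvg.
elim=> [|n IH]; first exact: measurable_cst.
apply: measurable_funM; last exact: measurable_cst.
apply: measurable_funD; first exact: measurable_bit.
apply: measurableT_comp; first exact: IH.
by apply: measurableT_comp; exact: measurable_shift_bits.
Qed.

Lemma measurable_odd_digits : measurable_fun setT odd_digits.
Proof. exact: measurableT_comp measurable_even_digits measurable_shift_bits. Qed.
End Rays.

(** * Independence of even and odd digits *)

Section DigitsIndependence.
Local Open Scope classical_set_scope.
Local Open Scope ring_scope.
Variable R : realType.
Notation unif := (uniform_prob (@ltr01 R)).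
Notation TR := (measurableTypeR R).

Let evenT : TR -> TR := @even_digits R.
Let oddT : TR -> TR := @odd_digits R.
HB.instance Definition _ := @isMeasurableFun.Build _ _ _ _ evenT (@measurable_even_digits R).
HB.instance Definition _ := @isMeasurableFun.Build _ _ _ _ oddT (@measurable_odd_digits R).

Let Ev (s : R) : set TR := [set x | even_digits x <= s].
Let Od (t : R) : set TR := [set x | odd_digits x <= t].
Let D0 : set TR := `]-oo, 1/2]%classic.

Lemma mEv s : measurable (Ev s).
Proof.
have -> : Ev s = evenT @^-1` `]-oo, s]%classic.
  by apply/seteqP; split => x; rewrite /Ev /= in_itv.
by rewrite -[X in measurable X]setTI; apply: (@measurable_even_digits R) => //; exact: measurable_itv.
Qed.

Lemma mOd s : measurable (Od s).
Proof.
have -> : Od s = oddT @^-1` `]-oo, s]%classic.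
  by apply/seteqP; split => x; rewrite /Od /= in_itv.
by rewrite -[X in measurable X]setTI; apply: (@measurable_odd_digits R) => //; exact: measurable_itv.
Qed.

(** An event is described on each half of the interval by an event on the
    remaining digits. *)
Lemma bit_split (S A0 A1 : set TR) : measurable S -> measurable A0 -> measurable A1 ->
  (forall x, bit x = 0 -> S x <-> A0 (shift_bits x)) ->
  (forall x, bit x = 1 -> S x <-> A1 (shift_bits x)) ->
  fine (unif S) = (fine (unif A0) + fine (unif A1)) / 2.
Proof.
move=> mS mA0 mA1 h0 h1.
have mD0 : measurable D0 by exact: measurable_itv.
have bit0 x : D0 x -> bit x = 0 by rewrite /D0 /= in_itv /= bitE ltNge => ->.
have bit1 x : (~` D0) x -> bit x = 1.
  by rewrite /D0 /= in_itv /= bitE ltNge => /negP ->.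
have E0 : D0 `&` S = D0 `&` (@shift_bits R : TR -> TR) @^-1` A0.
  by apply/seteqP; split => x /= [xD]; move: (h0 x (bit0 x xD)) => [a b] ?; split => //; [exact: a|exact: b].
have E1 : ~` D0 `&` S = ~` D0 `&` (@shift_bits R : TR -> TR) @^-1` A1.
  by apply/seteqP; split => x /= [xD]; move: (h1 x (bit1 x xD)) => [a b] ?; split => //; [exact: a|exact: b].
have u0 : unif (D0 `&` (@shift_bits R : TR -> TR) @^-1` A0) = ((2%:R^-1)%:E * unif A0)%E.
  exact: (@unif_shift_half R false A0 mA0).
have u1 : unif (~` D0 `&` (@shift_bits R : TR -> TR) @^-1` A1) = ((2%:R^-1)%:E * unif A1)%E.
  exact: (@unif_shift_half R true A1 mA1).
have E : unif S = ((2%:R^-1)%:E * unif A0 + (2%:R^-1)%:E * unif A1)%E.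
  rewrite -u0 -u1 -E0 -E1 -[in LHS](setTI S) -(setUv D0) setIUl.
  apply: (@measureU _ _ _ unif).
  - exact: measurableI.
  - by apply: measurableI => //; exact: measurableC.
  - by rewrite setIACA setICr set0I.
rewrite E fineD ?fin_numM ?fin_num_measure // !fineM ?fin_num_measure //=.
by rewrite -mulrDr mulrC.
Qed.

Definition cdf1 (t : R) : R := fine (unif (Ev t)).
Definition cdf2 (s t : R) : R := fine (unif (Ev s `&` Od t)).

Lemma fine_unif01 (A : set TR) : measurable A -> 0 <= fine (unif A) <= 1.
Proof.
move=> mA; rewrite -!lee_fin fineK ?fin_num_measure // measure_ge0 /=.
exact: probability_le1.
Qed.

Lemma cdf1_out (t : R) : (t < 0) || (1 <= t) -> cdf1 t = clip t.
Proof.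
case/orP => h; rewrite /cdf1.
  have -> : Ev t = set0.
    rewrite -subset0 => x; rewrite /Ev /= => xt.
    by have /andP [] := even_digits_bounds x; rewrite leNgt (le_lt_trans xt).
  by rewrite measure0 clip_le0 // ltW.
have -> : Ev t = setT.
  rewrite -subTset => x _; rewrite /Ev /=.
  by have /andP [_] := even_digits_bounds x; move/le_trans; apply.
by rewrite probability_setT clip_ge1.
Qed.

Lemma cdf2_out (s t : R) : (t < 0) || (1 <= t) -> cdf2 s t = cdf1 s * clip t.
Proof.
case/orP => h; rewrite /cdf2 /cdf1.
  have -> : Od t = set0.
    rewrite -subset0 => x; rewrite /Od /= => xt.
    by have /andP [] := even_digits_bounds (shift_bits x); rewrite leNgt (le_lt_trans xt).
  by rewrite (clip_le0 (ltW h)) setI0 measure0 mulr0.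
have -> : Od t = setT.
  rewrite -subTset => x _; rewrite /Od /=.
  by have /andP [_] := even_digits_bounds (shift_bits x); move/le_trans; apply.
by rewrite (clip_ge1 h) setIT mulr1.
Qed.

Lemma odd_law t : fine (unif (Od t)) = cdf1 t.
Proof.
rewrite (@bit_split (Od t) (Ev t) (Ev t)) //; try exact: mEv; try exact: mOd.
by rewrite -/(cdf1 t); field.
Qed.

Lemma even_le (x s b : R) : bit x = b ->
  (even_digits x <= s) = (odd_digits (shift_bits x) <= 2 * s - b).
Proof. by move=> bx; rewrite even_digitsE bx; apply/idP/idP; lra. Qed.

Lemma cdf1_rec t : cdf1 t = (cdf1 (2 * t) + cdf1 (2 * t - 1)) / 2.
Proof.
rewrite {1}/cdf1 -!odd_law; apply: bit_split; try exact: mEv; try exact: mOd.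
  by move=> x bx; rewrite /Ev /= (even_le _ bx) subr0.
by move=> x bx; rewrite /Ev /= (even_le _ bx).
Qed.

(** Deleting the first digit turns the digits of odd rank into those of even
    rank and conversely, hence the exchange of the arguments. *)
Lemma cdf2_rec s t : cdf2 s t = (cdf2 t (2 * s) + cdf2 t (2 * s - 1)) / 2.
Proof.
have m u v : measurable (Ev u `&` Od v) by apply: measurableI; [exact: mEv|exact: mOd].
apply: bit_split => //.
  by move=> x bx; rewrite /Ev /Od /= (even_le _ bx) subr0; split => -[].
by move=> x bx; rewrite /Ev /Od /= (even_le _ bx); split => -[].
Qed.

(** A bounded discrepancy between the two sides satisfies a recursion which
    halves it, because one of its two terms always vanishes. *)
Lemma cdf1E t : cdf1 t = clip t.
Proof.
suff h k : forall t, `|cdf1 t - clip t| <= 2^-1 ^+ k.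
  apply/eqP; rewrite -subr_eq0 -normr_eq0 eq_le normr_ge0 andbT.
  have c : (fun k : nat => 2^-1 ^+ k : R) @ \oo --> (0 : R).
    by apply: cvg_expr; rewrite ger0_norm ?invr_ge0 // invf_lt1 // ltr1n.
  rewrite -(cvg_lim (@Rhausdorff R) c); apply: limr_ge; first by apply/cvg_ex; exists 0.
  by near=> k; exact: h.
elim: k => [|k IH] {}t.
  have /andP [h1 h2] := fine_unif01 (mEv t).
  have /andP [h3 h4] := clip01 t.
  by rewrite expr0 ler_norml; apply/andP; split; rewrite /cdf1; lra.
rewrite cdf1_rec (clip_half t).
have -> : (cdf1 (2 * t) + cdf1 (2 * t - 1)) / 2 - (clip (2 * t) + clip (2 * t - 1)) / 2 =
  ((cdf1 (2 * t) - clip (2 * t)) + (cdf1 (2 * t - 1) - clip (2 * t - 1))) * 2^-1 by ring.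
rewrite normrM (@ger0_norm _ 2^-1) ?invr_ge0 // exprSr ler_wpM2r ?invr_ge0 //.
have [h|h] := leP 1 (2 * t).
  by rewrite (@cdf1_out (2 * t)) ?h ?orbT // subrr add0r; exact: IH.
rewrite (@cdf1_out (2 * t - 1)) ?subrr ?addr0; first exact: IH.
by apply/orP; left; lra.
Unshelve. all: by end_near. Qed.

(** The same contraction as for [cdf1E]. *)
Lemma cdf2E s t : cdf2 s t = clip s * clip t.
Proof.
suff h k : forall s t, `|cdf2 s t - clip s * clip t| <= 2^-1 ^+ k.
  apply/eqP; rewrite -subr_eq0 -normr_eq0 eq_le normr_ge0 andbT.
  have c : (fun k : nat => 2^-1 ^+ k : R) @ \oo --> (0 : R).
    by apply: cvg_expr; rewrite ger0_norm ?invr_ge0 // invf_lt1 // ltr1n.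
  rewrite -(cvg_lim (@Rhausdorff R) c); apply: limr_ge; first by apply/cvg_ex; exists 0.
  by near=> k; exact: h.
elim: k => [|k IH] {}s {}t.
  have /andP [h1 h2] : 0 <= cdf2 s t <= 1.
    by apply: fine_unif01; apply: measurableI; [exact: mEv|exact: mOd].
  have /andP [h3 h4] := clip01 s; have /andP [h5 h6] := clip01 t.
  have h7 : 0 <= clip s * clip t by exact: mulr_ge0.
  have h8 : clip s * clip t <= 1 by exact: mulr_ile1.
  by rewrite expr0 ler_norml; apply/andP; split; lra.
rewrite cdf2_rec (clip_half s).
have -> : (cdf2 t (2 * s) + cdf2 t (2 * s - 1)) / 2 -
    (clip (2 * s) + clip (2 * s - 1)) / 2 * clip t =
  ((cdf2 t (2 * s) - clip t * clip (2 * s)) +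
   (cdf2 t (2 * s - 1) - clip t * clip (2 * s - 1))) * 2^-1 by ring.
rewrite normrM (@ger0_norm _ 2^-1) ?invr_ge0 // exprSr ler_wpM2r ?invr_ge0 //.
have [h|h] := leP 1 (2 * s).
  by rewrite (@cdf2_out t (2 * s)) ?h ?orbT // cdf1E subrr add0r; exact: IH.
rewrite (@cdf2_out t (2 * s - 1)) ?cdf1E ?subrr ?addr0; first exact: IH.
by apply/orP; left; lra.
Unshelve. all: by end_near. Qed.

Lemma law_on_digits (A B : set TR) : measurable A -> measurable B ->
  unif (evenT @^-1` A `&` oddT @^-1` B) = (unif A * unif B)%E.
Proof.
move=> mA mB.
have mOB : measurable (oddT @^-1` B).
  by rewrite -[X in measurable X]setTI; exact: measurable_odd_digits.
(* First for a ray [A], then in general. *)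
have step s : unif (Ev s `&` oddT @^-1` B) = ((clip s)%:E * unif B)%E.
  have /andP [c0 _] := clip01 s.
  pose nu := law_on unif (mEv s) (oddT : {mfun TR >-> TR}).
  pose nu' := mscale (NngNum c0) unif.
  have hE x : nu `]-oo, x]%classic = nu' `]-oo, x]%classic.
    apply: (@etrans _ _ (clip s * clip x)%:E); last first.
      by rewrite /nu' /mscale /= unif_ray EFinM.
    rewrite -cdf2E /cdf2 fineK ?fin_num_measure //; last first.
      by apply: measurableI; [exact: mEv|exact: mOd].
    have oE : oddT @^-1` `]-oo, x]%classic = Od x.
      by apply/seteqP; split => z; rewrite /Od /= in_itv.
    have -> : nu `]-oo, x]%classic = unif (oddT @^-1` `]-oo, x]%classic `&` Ev s) by [].
    by rewrite oE setIC.
  have -> : unif (Ev s `&` oddT @^-1` B) = nu B by rewrite setIC.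
  apply: (@eq_measure_rays R nu nu') mB => // x.
  apply: (@le_lt_trans _ _ 1%E); last by rewrite ltry.
  by apply: probability_le1; apply: measurableI; [|exact: mEv];
     rewrite -[X in measurable X]setTI; apply: measurable_odd_digits => //; exact: measurable_itv.
have fB : unif B \is a fin_num by rewrite fin_num_measure.
have b0 : 0 <= fine (unif B) by exact: fine_ge0.
pose nu := law_on unif mOB (evenT : {mfun TR >-> TR}).
pose nu' := mscale (NngNum b0) unif.
have hE x : nu `]-oo, x]%classic = nu' `]-oo, x]%classic.
  apply: (@etrans _ _ ((clip x)%:E * unif B)%E); last first.
    by rewrite /nu' /mscale /= unif_ray fineK // muleC.
  have eE : evenT @^-1` `]-oo, x]%classic = Ev x.
    by apply/seteqP; split => z; rewrite /Ev /= in_itv.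
  have -> : nu `]-oo, x]%classic = unif (evenT @^-1` `]-oo, x]%classic `&` oddT @^-1` B) by [].
  by rewrite eE step.
have -> : unif (evenT @^-1` A `&` oddT @^-1` B) = nu A by [].
transitivity (nu' A); last by rewrite /nu' /mscale /= fineK // muleC.
apply: (@eq_measure_rays R nu nu') mA => // x.
 apply: (@le_lt_trans _ _ 1%E); last by rewrite ltry.
by apply: probability_le1; apply: measurableI => //;
   rewrite -[X in measurable X]setTI; apply: measurable_even_digits => //; exact: measurable_itv.
Qed.
End DigitsIndependence.

(** * Integration over the digits *)

Section DigitsFubini.
Local Open Scope classical_set_scope.
Local Open Scope ring_scope.
Variable R : realType.
Notation unif := (uniform_prob (@ltr01 R)).
Notation TR := (measurableTypeR R).

Let pairT : TR -> TR * TR := fun w => (even_digits w, odd_digits w).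

Lemma measurable_pairT : measurable_fun setT pairT.
Proof. exact: measurable_fun_pair (@measurable_even_digits R) (@measurable_odd_digits R). Qed.

HB.instance Definition _ := @isMeasurableFun.Build _ _ _ _ pairT measurable_pairT.

(** The two families of digits are independent and uniform, so the joint law of
    the two numbers is the product measure. *)
Lemma integral_digits (f : TR * TR -> \bar R) : measurable_fun setT f ->
  (forall z, 0 <= f z)%E ->
  (\int[unif]_w f (even_digits w, odd_digits w) = \int[unif]_u \int[unif]_w f (u, w))%E.
Proof.
move=> mf f0.
have -> : (\int[unif]_w f (even_digits w, odd_digits w) =
    \int[distribution unif (pairT : {mfun TR >-> _})]_z f z)%E.
  by rewrite ge0_integral_distribution.
rewrite (@eq_measure_integral _ _ _ setT (unif \x unif)%E); first exact: fubini_tonelli1.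
move=> A mA _; apply/esym; apply: product_measure_unique mA => X Y mX mY.
rewrite /= -(law_on_digits mX mY); congr (unif _).
Qed.

Lemma unif_point (t : R) : unif [set t] = 0%E.
Proof.
have /null_content_dominatesP := @dominates_uniform_prob R 0 1 ltr01.
by apply; [exact: measurable_set1 | exact: lebesgue_measure_set1].
Qed.

Lemma unif_open_ray (t : R) : unif `]-oo, t[%classic = (clip t)%:E.
Proof.
rewrite -unif_ray.
have -> : `]-oo, t]%classic = `]-oo, t[%classic `|` [set t] :> set R.
  apply/seteqP; split => z; rewrite /= !in_itv /=.
    by rewrite le_eqVlt => /orP [/eqP ->|]; [right|left].
  by move=> [/ltW//|->].
have E : unif (`]-oo, t[%classic `|` [set t]) = (unif `]-oo, t[%classic + unif [set t])%E.
  apply: (@measureU _ _ _ unif); [exact: measurable_itv | exact: measurable_set1 |].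
  by rewrite -subset0 => z [/=]; rewrite in_itv /= => h zt; move: h; rewrite zt ltxx.
by rewrite E unif_point adde0.
Qed.

Let I01 : set TR := `]0, 1[%classic.
Let mI01 : measurable I01. Proof. exact: measurable_itv. Qed.

Lemma unif_I01C : unif (~` I01) = 0%E.
Proof.
have E : unif I01 = 1%E.
  have -> : I01 = (`]-oo, 1[%classic : set TR) `\` `]-oo, 0]%classic.
    apply/seteqP; split => z; rewrite /I01 /= !in_itv /=.
      by move=> /andP [h1 h2]; split => //; apply/negP; rewrite -ltNge.
    by move=> [h1 /negP]; rewrite -ltNge => ->.
  rewrite (@measureD _ TR R unif) ?setIidr //=; last 2 first.
  - by move=> z /=; rewrite !in_itv /= => /le_lt_trans; apply.
  - by apply: (@le_lt_trans _ _ 1%E); rewrite ?ltry //; apply: probability_le1; exact: measurable_itv.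
  rewrite unif_open_ray unif_ray -EFinB; congr (_%:E).
  by rewrite clip_ge1 // clip_le0 // subr0.
apply: etrans (@probability_setC _ _ _ unif _ mI01) _.
by apply: etrans (congr1 (fun x => 1 - x)%E E) _; rewrite subee.
Qed.

Lemma unif_setI01 (S : set TR) : measurable S -> unif S = unif (S `&` I01).
Proof.
move=> mS; have -> : S = (S `&` I01) `|` (S `&` ~` I01) by rewrite -setIUr setUv setIT.
have mC : measurable (S `&` ~` I01) by apply: measurableI => //; exact: measurableC.
have E : unif ((S `&` I01) `|` (S `&` ~` I01)) = (unif (S `&` I01) + unif (S `&` ~` I01))%E.
  apply: (@measureU _ _ _ unif) => //; first exact: measurableI.
  by rewrite setIACA setICr setI0.
rewrite {1}E (_ : unif (S `&` ~` I01) = 0%E) ?adde0; last first.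
  apply/eqP; rewrite eq_le measure_ge0 andbT -unif_I01C le_measure ?inE //.
  exact: measurableC.
by rewrite setIUl -!setIA setIid setICl setI0 setU0.
Qed.

(** Uniform variables take values in the open unit interval almost surely;
    moving the others there makes the quantile functions finite. *)
Definition uclip (u : R) : R := if (0 < u) && (u < 1) then u else 1 / 2.

Lemma uclip_bounds u : 0 < uclip u < 1.
Proof. by rewrite /uclip; case: ifP => // _; apply/andP; split; lra. Qed.

Lemma measurable_uclip : measurable_fun setT uclip.
Proof.
apply: measurable_fun_ifT; [|exact: measurable_id|exact: measurable_cst].
by apply: measurable_and; apply: measurable_fun_ltr; (exact: measurable_cst || exact: measurable_id).
Qed.

Lemma measurable_uclip_le t : measurable ([set u | uclip u <= t] : set TR).
Proof.
rewrite (_ : [set u | _] = uclip @^-1` `]-oo, t]%classic); last first.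
  by apply/seteqP; split => u /=; rewrite in_itv.
by rewrite -[X in measurable X]setTI; apply: measurable_uclip => //; exact: measurable_itv.
Qed.

Lemma measurable_uclip_lt t : measurable ([set u | uclip u < t] : set TR).
Proof.
rewrite (_ : [set u | _] = uclip @^-1` `]-oo, t[%classic); last first.
  by apply/seteqP; split => u /=; rewrite in_itv.
by rewrite -[X in measurable X]setTI; apply: measurable_uclip => //; exact: measurable_itv.
Qed.

Lemma unif_uclip_le t : unif [set u | uclip u <= t] = (clip t)%:E.
Proof.
rewrite -unif_ray unif_setI01; last exact: measurable_uclip_le.
rewrite [RHS]unif_setI01; last exact: measurable_itv.
congr (unif _); apply/seteqP; split => u; rewrite /I01 /= !in_itv /= /uclip => -[h1 h2].
  by move: h1; rewrite h2.
by rewrite h2.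
Qed.

Lemma unif_uclip_lt t : unif [set u | uclip u < t] = (clip t)%:E.
Proof.
rewrite -unif_open_ray unif_setI01; last exact: measurable_uclip_lt.
rewrite [RHS]unif_setI01; last exact: measurable_itv.
congr (unif _); apply/seteqP; split => u; rewrite /I01 /= !in_itv /= /uclip => -[h1 h2].
  by move: h1; rewrite h2.
by rewrite h2.
Qed.

End DigitsFubini.

(** * Binomial and Gaussian variables on the unit interval *)

Section Coupling.
Local Open Scope classical_set_scope.
Local Open Scope ring_scope.
Variables (R : realType) (q : R).
Hypotheses (q0 : 0 < q) (q1 : q < 1).
Notation unif := (uniform_prob (@ltr01 R)).
Notation TR := (measurableTypeR R).
Let p := 1 - q.
Let p0 : 0 < p. Proof. by rewrite subr_gt0. Qed.
Let sigma := Num.sqrt (p * q).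
Let sigma_gt0 : 0 < sigma. Proof. by rewrite sqrtr_gt0 mulr_gt0. Qed.

Definition bin_rv (n : nat) (u : TR) : nat := bin_quantile q n (uclip u).

Lemma bin_rv_le_size n u : (bin_rv n u <= n)%N.
Proof. exact: bin_quantile_le_size. Qed.

Lemma bin_cdf01 n j : 0 <= bin_cdf q n j <= 1.
Proof.
apply/andP; split; first by apply: bin_mean_ge0.
rewrite -(bin_mean_cst q0 q1 n 1); apply: le_bin_mean => // i _.
by case: (i <= j)%N.
Qed.

Lemma bin_rv_leE n j : [set u : TR | (bin_rv n u <= j)%N] = [set u : TR | uclip u <= bin_cdf q n j].
Proof.
apply/seteqP; split => u /=; rewrite bin_quantileE //;
  by have /andP [_ /ltW] := uclip_bounds u.
Qed.

Lemma bin_rv_cdf n j : unif [set u | (bin_rv n u <= j)%N] = (bin_cdf q n j)%:E.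
Proof. by rewrite bin_rv_leE unif_uclip_le clip_id // bin_cdf01. Qed.

Lemma measurable_bin_rv_le n j : measurable [set u : TR | (bin_rv n u <= j)%N].
Proof. by rewrite bin_rv_leE; exact: measurable_uclip_le. Qed.

Lemma bin_rv_eqE n j : [set u : TR | bin_rv n u = j] =
  if j is j'.+1 then [set u : TR | (bin_rv n u <= j)%N] `\` [set u : TR | (bin_rv n u <= j')%N]
  else [set u : TR | (bin_rv n u <= 0)%N].
Proof.
case: j => [|j]; apply/seteqP; split => u /=.
- by move=> ->.
- by rewrite leqn0 => /eqP.
- by move=> ->; split => //; apply/negP; rewrite -ltnNge.
- by move=> [h1 /negP]; rewrite -ltnNge => h2; apply/eqP; rewrite eqn_leq h1.
Qed.

Lemma measurable_bin_rv_eq n j : measurable [set u : TR | bin_rv n u = j].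
Proof.
rewrite bin_rv_eqE; case: j => [|j]; first exact: measurable_bin_rv_le.
by apply: measurableD; exact: measurable_bin_rv_le.
Qed.

Lemma measurable_bin_rv n : measurable_fun setT (bin_rv n).
Proof.
move=> _ Y _; rewrite setTI.
have -> : bin_rv n @^-1` Y = \bigcup_(j in Y) [set u | bin_rv n u = j].
  by apply/seteqP; split => u /=; [exists (bin_rv n u)|move=> [j Yj ->]].
by apply: bigcup_measurable => j _; exact: measurable_bin_rv_eq.
Qed.

Lemma measurable_bin_rv_comp n (h : nat -> R) : measurable_fun setT (fun u => h (bin_rv n u)).
Proof. by move=> mT Y mY; exact: (@measurable_bin_rv n mT (h @^-1` Y) I). Qed.

Lemma bin_rv_pmf n j : unif [set u | bin_rv n u = j] = (binom_weight q n j)%:E.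
Proof.
have wE : binom_weight q n j = bin_mean q n (fun i => (i == j)%:R).
  case: (leqP j n) => [jn|nj].
    rewrite /bin_mean (bigD1 (Ordinal (jn : (j < n.+1)%N))) //= eqxx mulr1 big1 ?addr0 //.
    by move=> i /negbTE; rewrite -val_eqE /= => ->; rewrite mulr0.
  rewrite /binom_weight bin_small // mul0r /bin_mean big1 // => i _.
  by rewrite ltn_eqF ?mulr0 // (leq_trans (ltn_ord i)).
rewrite bin_rv_eqE wE; case: j {wE} => [|j].
  by rewrite bin_rv_cdf; congr (_%:E); apply: eq_bin_mean => i _; rewrite leqn0.
rewrite (@measureD _ TR R unif); last 3 first.
- exact: measurable_bin_rv_le.
- exact: measurable_bin_rv_le.
- by apply: (@le_lt_trans _ _ 1%E); rewrite ?ltry //; apply: probability_le1; exact: measurable_bin_rv_le.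
rewrite setIidr; last by move=> u /= h; exact: leqW.
apply: etrans (congr2 (fun x y => x - y)%E (bin_rv_cdf n j.+1) (bin_rv_cdf n j)) _.
rewrite -EFinB; congr (_%:E); rewrite /bin_cdf -bin_meanB.
apply: eq_bin_mean => i _; rewrite leq_eqVlt ltnS.
by case: eqP => [->|_] /=; rewrite ?ltnn ?subr0 ?subrr.
Qed.

Lemma integral_bin_rv n (h : nat -> R) : (forall j, 0 <= h j) ->
  (\int[unif]_u (h (bin_rv n u))%:E = (bin_mean q n h)%:E)%E.
Proof.
move=> h0.
pose f (j : 'I_n.+1) (u : TR) : \bar R := ((h j)%:E * (\1_[set u | bin_rv n u = j] u)%:E)%E.
have mf (j : 'I_n.+1) : measurable_fun setT (fun u : TR => (\1_[set u | bin_rv n u = j] u)%:E : \bar R).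
  by apply/measurable_EFinP; apply: measurable_indic; exact: measurable_bin_rv_eq.
have -> : (\int[unif]_u (h (bin_rv n u))%:E = \int[unif]_u \sum_(j < n.+1) f j u)%E.
  apply: eq_integral => u _; have jn := bin_rv_le_size n u.
  rewrite (bigD1 (Ordinal (jn : (bin_rv n u < n.+1)%N))) //= big1 ?adde0.
    by rewrite /f /= indicE mem_set // mule1.
  move=> i; rewrite -val_eqE /= => ij; rewrite /f indicE memNset ?mule0 //=.
  by move/eqP; rewrite eq_sym (negbTE ij).
rewrite ge0_integral_sum //=; last 2 first.
- by move=> j; apply: measurable_funeM; exact: mf.
- by move=> j u _; rewrite /f mule_ge0 ?lee_fin.
rewrite /bin_mean -sumEFin; apply: eq_bigr => j _.
rewrite /f ge0_integralZl //; last by rewrite lee_fin.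
rewrite integral_indic //; last exact: measurable_bin_rv_eq.
rewrite setIT; apply: etrans (congr1 (fun x => (h j)%:E * x)%E (bin_rv_pmf n j)) _.
by rewrite -EFinM mulrC.
Qed.

(** The Gaussian quantile of the uniform variable; the default value 0 is never
    taken, by [Phi_surj] and [uclip_bounds]. *)
Definition gauss_rv (u : TR) : R := xget 0 [set z | Phi z = uclip u].

Lemma Phi_gauss_rv u : Phi (gauss_rv u) = uclip u.
Proof.
have [z hz] := Phi_surj (uclip_bounds u).
exact: (@xgetPex _ 0 [set z | Phi z = uclip u] (ex_intro _ z hz)).
Qed.

Lemma bin_rv_cvg u : (fun n => ((bin_rv n u)%:R - n%:R * (1 - q)) / Num.sqrt n%:R) @ \oo -->
  sigma * gauss_rv u.
Proof. exact: (bin_quantile_cvg q0 q1 (uclip_bounds u) (Phi_gauss_rv u)). Qed.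

(** As a pointwise limit of measurable binomial variables. *)
Lemma measurable_gauss_rv : measurable_fun setT gauss_rv.
Proof.
have -> : gauss_rv = fun u => sigma^-1 * (sigma * gauss_rv u).
  by apply/funext => u; rewrite mulrA mulVf ?mul1r // gt_eqF.
apply: measurable_funM => //.
pose f (n : nat) (u : TR) := ((bin_rv n u)%:R - n%:R * (1 - q)) / Num.sqrt n%:R.
apply: (@measurable_fun_cvg _ _ _ _ f) => [n|u _]; last exact: bin_rv_cvg.
exact: (measurable_bin_rv_comp n (fun j => (j%:R - n%:R * (1 - q)) / Num.sqrt n%:R)).
Qed.

Lemma gauss_rv_leE t u : (gauss_rv u <= t) = (uclip u <= Phi t).
Proof.
rewrite -Phi_gauss_rv; apply/idP/idP => [|h]; first exact: Phi_le.
by rewrite leNgt; apply/negP => /Phi_lt; rewrite ltNge h.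
Qed.

Lemma gauss_rv_cdf t : unif [set u | gauss_rv u <= t] = (Phi t)%:E.
Proof.
rewrite (_ : [set u | _] = [set u | uclip u <= Phi t]).
  by rewrite unif_uclip_le clip_id // Phi_bounds.
by apply/seteqP; split => u; rewrite /= gauss_rv_leE.
Qed.

Lemma gauss_rv_ge t : unif [set u | t <= gauss_rv u] = (Phi (- t))%:E.
Proof.
rewrite (_ : [set u | _] = ~` [set u | uclip u < Phi t]); last first.
  apply/seteqP; split => u; rewrite /= -Phi_gauss_rv.
    by move=> h; apply/negP; rewrite -leNgt; exact: Phi_le.
  by move/negP; rewrite -leNgt => h; rewrite leNgt; apply/negP => /Phi_lt; rewrite ltNge h.
apply: etrans (@probability_setC _ _ _ unif _ (@measurable_uclip_lt R (Phi t))) _.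
apply: etrans (congr1 (fun x => 1 - x)%E (@unif_uclip_lt R (Phi t))) _.
by rewrite -EFinB clip_id ?Phi_bounds // PhiN.
Qed.

Lemma gauss_rv_scale_cdf c t : c != 0 ->
  unif [set u | c * gauss_rv u <= t] = (ncdf `|c| t)%:E.
Proof.
move=> c0; rewrite ncdf_scale ?normr_gt0 //.
have [cpos|cneg] := ltP 0 c.
  rewrite (gtr0_norm cpos) -gauss_rv_cdf; congr (unif _).
  by apply/seteqP; split => u /=; rewrite ler_pdivlMr // mulrC.
have {}cneg : c < 0 by rewrite lt_neqAle c0.
rewrite (ltr0_norm cneg) invrN mulrN -gauss_rv_ge; congr (unif _).
by apply/seteqP; split => u /=; rewrite ler_ndivrMr // mulrC.
Qed.

(** Convolution of two Gaussian laws, read off the heat flow along the binomial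
    approximation of [gauss_rv]. *)
Lemma gauss_rv_convolution c s t : 0 < s ->
  (\int[unif]_u (ncdf s (t - c * gauss_rv u))%:E = (ncdf (Num.sqrt (c ^+ 2 + s ^+ 2)) t)%:E)%E.
Proof.
move=> s0.
have r0 : 0 < s ^+ 2 by rewrite exprn_gt0.
have S0 : 0 < Num.sqrt (c ^+ 2 + s ^+ 2) by rewrite sqrtr_gt0 ltr_wpDl ?sqr_ge0.
have sE : Num.sqrt (s ^+ 2) = s by rewrite sqrtr_sqr gtr0_norm.
pose k := c / sigma.
pose g n (j : nat) := Phi ((t - k * ((j%:R - n%:R * p) / Num.sqrt n%:R)) / s).
have lim1 : (fun n => (bin_mean q n (g n))%:E) @ \oo --> (ncdf (Num.sqrt (c ^+ 2 + s ^+ 2)) t)%:E.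
  apply: cvg_EFin; first by near=> n.
  have := @bin_mean_Phi_cvg R q q0 q1 (s ^+ 2) k t r0; rewrite sE.
  rewrite (ncdf_scale _ S0) (_ : s ^+ 2 + _ = c ^+ 2 + s ^+ 2) //.
  rewrite addrC; congr (_ + _); rewrite /k -/p -(sqr_sqrtr (ltW (mulr_gt0 p0 q0))) -/sigma.
  by field; rewrite gt_eqF.
pose f n (u : TR) : \bar R := (g n (bin_rv n u))%:E.
have mf n : measurable_fun setT (f n).
  by apply/measurable_EFinP; exact: (measurable_bin_rv_comp n (g n)).
have fcvg u : setT u -> f ^~ u @ \oo --> (ncdf s (t - c * gauss_rv u))%:E.
  move=> _; rewrite (ncdf_scale _ s0).
  have H : (fun n => g n (bin_rv n u)) @ \oo --> Phi ((t - c * gauss_rv u) / s).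
    apply: continuous_cvg; first exact: Phi_continuous.
    apply: cvgMr_tmp; apply: cvgB; first exact: cvg_cst.
    have -> : c * gauss_rv u = k * (sigma * gauss_rv u).
      by rewrite /k mulrA divfK // gt_eqF.
    by apply: cvgMl_tmp; exact: bin_rv_cvg.
  apply: cvg_EFin; first by near=> n.
  exact: H.
have lim2 : (\int[unif]_u f n u)%E @[n --> \oo] --> (\int[unif]_u (ncdf s (t - c * gauss_rv u))%:E)%E.
  apply: (@dominated_cvg _ _ _ unif setT measurableT f _ (cst 1%E)) => //.
    exact: finite_measure_integrable_cst.
  move=> n u _; rewrite /f /=; have /andP [h1 h2] := Phi_bounds ((t - k * (((bin_rv n u)%:R - n%:R * p) / Num.sqrt n%:R)) / s).
  by rewrite lee_fin ger0_norm.
have E : (fun n => \int[unif]_u f n u)%E = fun n => (bin_mean q n (g n))%:E.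
  apply/funext => n; apply: integral_bin_rv => j.
  by case/andP: (Phi_bounds ((t - k * ((j%:R - n%:R * p) / Num.sqrt n%:R)) / s)).
rewrite E in lim2.
exact: cvg_unique lim2 lim1.
Unshelve. all: by end_near. Qed.
End Coupling.

(** * The variance of the Gaussian variable *)

Section SecondMoment.
Local Open Scope classical_set_scope.
Local Open Scope ring_scope.
Variables (R : realType) (q : R).
Hypotheses (q0 : 0 < q) (q1 : q < 1).
Notation unif := (uniform_prob (@ltr01 R)).
Notation TR := (measurableTypeR R).
Let p := 1 - q.
Let p0 : 0 < p. Proof. by rewrite subr_gt0. Qed.
Let sigma := Num.sqrt (p * q).
(** The fourth central moment of a single trial. *)
Let kappa4 := p * q ^+ 4 + q * p ^+ 4.

Let bin_mean_comb n (x4 x3 x2 x1 : nat -> R) a b c d :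
  bin_mean q n (fun j => x4 j + a * x3 j + b * x2 j + c * x1 j + d) =
  bin_mean q n x4 + a * bin_mean q n x3 + b * bin_mean q n x2 + c * bin_mean q n x1 + d.
Proof. by rewrite !bin_meanD !bin_meanZ bin_mean_cst. Qed.

Lemma bin_mean_fourth n : bin_mean q n (fun j => (j%:R - n%:R * p) ^+ 4) =
  3 * n%:R * (n%:R - 1) * (p * q) ^+ 2 + n%:R * kappa4.
Proof.
elim: n => [|n IH]; first by rewrite bin_mean0; ring.
pose X (j : nat) : R := j%:R - n%:R * p.
have m1 : bin_mean q n X = 0.
  by rewrite (bin_meanB q n (fun j => j%:R) (fun=> n%:R * p)) bin_mean_id // bin_mean_cst // subrr.
have E (a : R) : bin_mean q n (fun j => (X j + a) ^+ 4) =
    bin_mean q n (fun j => X j ^+ 4) + 4 * a * bin_mean q n (fun j => X j ^+ 3)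
     + 6 * a ^+ 2 * (n%:R * (p * q)) + a ^+ 4.
  rewrite -(bin_mean_var q0 q1 n) -[X in _ = _ + X]add0r -(mulr0 (4 * a ^+ 3)) -m1.
  rewrite [RHS]addrA -bin_mean_comb; apply: eq_bin_mean => j _; rewrite -/p -/(X j); ring.
rewrite bin_meanS //=.
have -> : bin_mean q n ((fun j : nat => (j%:R - n.+1%:R * p) ^+ 4) \o succn) =
   bin_mean q n (fun j => (X j + q) ^+ 4).
  by apply: eq_bin_mean => j _ /=; rewrite /X -[j.+1%:R]natr1 -[n.+1%:R]natr1 /p; ring.
have -> : bin_mean q n (fun j : nat => (j%:R - n.+1%:R * p) ^+ 4) =
   bin_mean q n (fun j => (X j + - p) ^+ 4).
  by apply: eq_bin_mean => j _ /=; rewrite /X -[n.+1%:R]natr1; ring.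
rewrite !E IH -[n.+1%:R]natr1 /kappa4 -/p.
by move: (bin_mean q n _) => m3; rewrite /p; ring.
Qed.

Let W n (u : TR) : R := ((bin_rv q n u)%:R - n%:R * p) / Num.sqrt n%:R.
Let w n (j : nat) : R := (j%:R - n%:R * p) / Num.sqrt n%:R.

Let w2_mean n : (0 < n)%N -> bin_mean q n (fun j => w n j ^+ 2) = p * q.
Proof.
move=> n0; have nR : 0 < n%:R :> R by rewrite ltr0n.
rewrite (@eq_bin_mean _ _ _ _ (fun j => n%:R^-1 * (j%:R - n%:R * (1 - q)) ^+ 2)); last first.
  by move=> j _; rewrite /w exprMn exprVn sqr_sqrtr // mulrC.
by rewrite (bin_meanZ q n n%:R^-1) bin_mean_var // mulKf // gt_eqF.
Qed.

Let w4_mean n : (0 < n)%N -> bin_mean q n (fun j => w n j ^+ 4) <= 3 * (p * q) ^+ 2 + kappa4.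
Proof.
move=> n0; have nR : 1 <= n%:R :> R by rewrite ler1n.
have nR0 : 0 < n%:R :> R by rewrite ltr0n.
rewrite (@eq_bin_mean _ _ _ _ (fun j => n%:R^-1 ^+ 2 * (j%:R - n%:R * p) ^+ 4)); last first.
  move=> j _; rewrite /w exprMn exprVn mulrC; congr (_ * _).
  by rewrite exprVn; congr (_^-1); rewrite (exprM _ 2 2) sqr_sqrtr.
rewrite (bin_meanZ q n (n%:R^-1 ^+ 2)) bin_mean_fourth exprVn ler_pdivrMl ?exprn_gt0 //.
have k0 : 0 <= kappa4 by rewrite addr_ge0 // mulr_ge0 // ?exprn_ge0 // ltW.
have s0 : 0 <= (p * q) ^+ 2 by exact: sqr_ge0.
have h : 0 <= n%:R * (3 * (p * q) ^+ 2 + kappa4 * (n%:R - 1)).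
  apply: mulr_ge0 => //; apply: addr_ge0; first by apply: mulr_ge0.
  by apply: mulr_ge0 => //; rewrite subr_ge0.
by rewrite -subr_ge0; apply: (le_trans h); rewrite le_eqVlt; apply/orP; left; apply/eqP; ring.
Qed.

Let trunc (m : R) (x : R) := Num.min x m.

Let trunc_cvg m u : 0 <= m -> (fun n => trunc m (W n u ^+ 2)) @ \oo --> trunc m ((sigma * gauss_rv u) ^+ 2).
Proof.
move=> m0; have h := @bin_rv_cvg R q q0 q1 u.
have h2 : (fun n => W n u ^+ 2) @ \oo --> (sigma * gauss_rv u) ^+ 2 by apply: cvgM; exact: h.
have tE x : trunc m x = (x + m - `|x - m|) / 2.
  by rewrite /trunc; case: (lerP x m) => h'; lra.
rewrite tE (_ : (fun n => _) = fun n => (W n u ^+ 2 + m - `|W n u ^+ 2 - m|) / 2); last first.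
  by apply/funext => n; rewrite tE.
apply: cvgMr_tmp; apply: cvgB; first by apply: cvgD => //; exact: cvg_cst.
by apply: cvg_norm; apply: cvgB => //; exact: cvg_cst.
Qed.

Let measurable_sq : measurable_fun setT (fun u : TR => (sigma * gauss_rv u) ^+ 2).
Proof. by apply: measurable_funX; apply: measurable_funM => //; exact: (measurable_gauss_rv q0 q1). Qed.

(** The second moments of the binomial approximations pass to the limit, being
    uniformly integrable thanks to the fourth moments. *)
Lemma gauss_rv_second_moment : (\int[unif]_u ((sigma * gauss_rv u) ^+ 2)%:E = (p * q)%:E)%E.
Proof.
pose K := 3 * (p * q) ^+ 2 + kappa4.
pose t (m : nat) (u : TR) := trunc m.+1%:R ((sigma * gauss_rv u) ^+ 2).
have t0 m (x : R) : 0 <= x -> 0 <= trunc m.+1%:R x by move=> x0; rewrite /trunc le_min x0 /=.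
have tm m (x : R) : trunc m.+1%:R x <= m.+1%:R by rewrite /trunc ge_min lexx orbT.
have lim m : (fun n => (bin_mean q n (fun j => trunc m.+1%:R (w n j ^+ 2)))%:E) @ \oo -->
    (\int[unif]_u (t m u)%:E)%E.
  have E : (fun n => \int[unif]_u (trunc m.+1%:R (W n u ^+ 2))%:E)%E =
      fun n => (bin_mean q n (fun j => trunc m.+1%:R (w n j ^+ 2)))%:E.
    apply/funext => n; apply: (@integral_bin_rv R q q0 q1 n (fun j => trunc m.+1%:R (w n j ^+ 2))).
    by move=> j; apply: t0; exact: sqr_ge0.
  rewrite -E; apply: (@dominated_cvg _ _ _ unif setT measurableT _ _ (cst m.+1%:R%:E)) => //.
  - by move=> n; apply/measurable_EFinP;
      exact: (measurable_bin_rv_comp q0 q1 n (fun j => trunc m.+1%:R (w n j ^+ 2))).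
  - by move=> u _; apply: cvg_EFin; [near=> n | exact: trunc_cvg].
  - exact: finite_measure_integrable_cst.
  - by move=> n u _ /=; rewrite lee_fin ger0_norm ?t0 ?sqr_ge0.
(* [x - x ^+ 2 / M <= Num.min x M] for [x >= 0], so that truncation at [M]
   loses at most [K / M] of the second moment. *)
have bounds m : ((p * q - K / m.+1%:R)%:E <= \int[unif]_u (t m u)%:E <= (p * q)%:E)%E.
  apply/andP; split.
    apply: (cvge_ge _ (lim m)) => //; near=> n.
    have n0 : (0 < n)%N by near: n; exact: nbhs_infty_gt.
    rewrite lee_fin -(w2_mean n0).
    have w4 : m.+1%:R^-1 * bin_mean q n (fun j => w n j ^+ 4) <= K / m.+1%:R.
      by rewrite mulrC ler_wpM2r ?invr_ge0 // w4_mean.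
    apply: (@le_trans _ _ (bin_mean q n (fun j => w n j ^+ 2) -
         bin_mean q n (fun j => m.+1%:R^-1 * w n j ^+ 4))).
      by rewrite (bin_meanZ q n m.+1%:R^-1) lerD2l lerN2.
    rewrite -(bin_meanB q n (fun j => w n j ^+ 2)); apply: le_bin_mean => // j _.
    rewrite (_ : w n j ^+ 4 = (w n j ^+ 2) ^+ 2); last by rewrite -exprM.
    move: (w n j ^+ 2) (sqr_ge0 (w n j)) => x x0; rewrite /trunc.
    have M0 : 0 < m.+1%:R :> R by rewrite ltr0n.
    have Mi : 0 < m.+1%:R^-1 :> R by rewrite invr_gt0.
    case: (lerP x m.+1%:R) => h.
      by rewrite gerBl mulr_ge0 ?sqr_ge0 // ltW.
    rewrite mulrC lerBlDr -subr_ge0.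
    have -> : m.+1%:R + x ^+ 2 / m.+1%:R - x = (m.+1%:R ^+ 2 + x ^+ 2 - x * m.+1%:R) / m.+1%:R :> R.
      by field; rewrite gt_eqF.
    by rewrite divr_ge0 // ?(ltW M0) //; nra.
  apply: (cvge_le _ (lim m)) => //; near=> n.
  have n0 : (0 < n)%N by near: n; exact: nbhs_infty_gt.
  rewrite lee_fin -(w2_mean n0); apply: le_bin_mean => // j _.
  by rewrite /trunc ge_min lexx.
have mono : (\int[unif]_u (t m u)%:E)%E @[m --> \oo] --> (\int[unif]_u ((sigma * gauss_rv u) ^+ 2)%:E)%E.
  have lt u : (fun m => (t m u)%:E) @ \oo --> ((sigma * gauss_rv u) ^+ 2)%:E.
    apply: cvg_near_cst; near=> m.
    have hm : (sigma * gauss_rv u) ^+ 2 <= m.+1%:R.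
      apply: (@le_trans _ _ m%:R); last by rewrite ler_nat.
      near: m; exact: nbhs_infty_ger.
    by rewrite /t /trunc; move: hm; case: leP.
  have -> : (\int[unif]_u ((sigma * gauss_rv u) ^+ 2)%:E =
      \int[unif]_u (limn (fun m => (t m u)%:E)))%E.
    by apply: eq_integral => u _; apply/esym/cvg_lim => //; exact: lt.
  apply: cvg_monotone_convergence => //.
  - move=> m; apply/measurable_EFinP; apply: measurable_minr => //.
  - by move=> m u _; rewrite lee_fin t0 // sqr_ge0.
  - move=> u _ m m' mm'; rewrite lee_fin /t /trunc le_min ge_min lexx /=.
    by rewrite ge_min ler_nat ltnS mm' orbT.
have sq : (\int[unif]_u (t m u)%:E)%E @[m --> \oo] --> (p * q)%:E.
  apply: (@squeeze_cvge _ _ _ _ (fun m => (p * q - K / m.+1%:R)%:E) _ (cst (p * q)%:E)).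
  - by near=> m; exact: bounds.
  - apply: cvg_EFin; first by near=> m.
    rewrite -[X in _ --> X]subr0; apply: cvgB; first exact: cvg_cst.
    exact: (cvg0_scale K cvg_harmonic).
  - exact: cvg_cst.
exact: cvg_unique mono sq.
Unshelve. all: by end_near. Qed.
End SecondMoment.

(** * Coupled rows and their pointwise limit *)

Section Chain.
Local Open Scope classical_set_scope.
Local Open Scope ring_scope.
Variables (R : realType) (q : R).
Hypotheses (q0 : 0 < q) (q1 : q < 1).
Notation unif := (uniform_prob (@ltr01 R)).
Notation TR := (measurableTypeR R).
Let p := 1 - q.
Let p0 : 0 < p. Proof. by rewrite subr_gt0. Qed.
Let sigma := Num.sqrt (p * q).

(** Each row uses the digits of even rank and hands those of odd rank over to
    the next rows, so that all draws are independent. *)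
Fixpoint row_rv (i n : nat) (w : TR) : nat :=
  let j := bin_rv q n (even_digits w) in
  if i is i'.+1 then row_rv i' (n - j) (odd_digits w) else j.

(** The factor [sqrt q] is there because a fraction [q] of the boxes is left for
    the other rows, and the last term is the effect on row [i] of the fluctuation
    of the first row. *)
Fixpoint limit_rv (i : nat) (w : TR) : R :=
  if i is i'.+1 then
    Num.sqrt q * limit_rv i' (odd_digits w)
      - p * q ^+ i' * (sigma * gauss_rv (even_digits w))
  else sigma * gauss_rv (even_digits w).

Definition rows_rv (k n : nat) (w : TR) : seq nat := mkseq (fun i => row_rv i n w) k.

Lemma rows_rv_cons k n w : rows_rv k.+1 n w =
  bin_rv q n (even_digits w) :: rows_rv k (n - bin_rv q n (even_digits w)) (odd_digits w).
Proof. by rewrite /rows_rv /mkseq /= (iotaDl 1 0) -map_comp. Qed.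

(** A finite sum over the values of the binomial variable. *)
Lemma measurable_bin_rv_glue n (G : nat -> TR -> R) : (forall j, measurable_fun setT (G j)) ->
  measurable_fun setT (fun z : TR * TR => G (bin_rv q n z.1) z.2).
Proof.
move=> mG.
have -> : (fun z : TR * TR => G (bin_rv q n z.1) z.2) =
    fun z => \sum_(j < n.+1) (j == bin_rv q n z.1 :> nat)%:R * G j z.2.
  apply/funext => z; pose j0 : 'I_n.+1 := Ordinal (bin_rv_le_size q n z.1 : (_ < n.+1)%N).
  rewrite (bigD1 j0) //= eqxx mul1r big1 ?addr0 // => j jn.
  by rewrite (_ : (j == bin_rv q n z.1 :> nat) = false) ?mul0r //; apply: negbTE; exact: jn.
apply: measurable_sum => j; apply: measurable_funM.
  have mI : measurable_fun setT (fun u : TR => ((j : nat) == bin_rv q n u)%:R : R).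
    exact: (measurable_bin_rv_comp q0 q1 n (fun i => ((j : nat) == i)%:R)).
  exact: (measurableT_comp mI measurable_fst).
exact: (measurableT_comp (mG j) measurable_snd).
Qed.

Lemma measurable_rows_rv k n (F : seq nat -> R) : measurable_fun setT (fun w => F (rows_rv k n w)).
Proof.
elim: k n F => [|k IH] n F; first exact: (@measurable_cst _ _ _ _ setT (F [::])).
have -> : (fun w => F (rows_rv k.+1 n w)) =
   (fun z : TR * TR => F (bin_rv q n z.1 :: rows_rv k (n - bin_rv q n z.1) z.2)) \o
   (fun w => (even_digits w, odd_digits w)).
  by apply/funext => w; rewrite rows_rv_cons.
apply: measurableT_comp (@measurable_pairT R).
apply: (@measurable_bin_rv_glue n (fun j w => F (j :: rows_rv k (n - j) w))) => j.
exact: (IH (n - j)%N (fun s => F (j :: s))).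
Qed.

Lemma rows_mean_ge0 k n (F : seq nat -> R) : (forall s, 0 <= F s) -> 0 <= rows_mean q k n F.
Proof.
by elim: k n F => [|k IH] n F F0 //=; apply: bin_mean_ge0 => // j; apply: IH => s; exact: F0.
Qed.

(** Independence of the digits turns the integral into iterated ones, one for
    each draw. *)
Lemma integral_rows_rv k n (F : seq nat -> R) : (forall s, 0 <= F s) ->
  (\int[unif]_w (F (rows_rv k n w))%:E = (rows_mean q k n F)%:E)%E.
Proof.
elim: k n F => [|k IH] n F F0.
  rewrite (integral_cst unif measurableT (F [::])%:E).
  by rewrite [X in (_ * X)%E]probability_setT mule1.
pose G z := F (bin_rv q n z.1 :: rows_rv k (n - bin_rv q n z.1) z.2).
have mG : measurable_fun setT G.
  apply: (@measurable_bin_rv_glue n (fun j w => F (j :: rows_rv k (n - j) w))) => j.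
  exact: (measurable_rows_rv k (n - j) (fun s => F (j :: s))).
under eq_integral do rewrite rows_rv_cons.
rewrite (@integral_digits R (fun z => (G z)%:E)); last 2 first.
- apply/measurable_EFinP; exact: mG.
- by move=> z; rewrite lee_fin; exact: F0.
rewrite /= -(@integral_bin_rv R q q0 q1 n (fun j => rows_mean q k (n - j) (fun s => F (j :: s)))).
  by apply: eq_integral => u _; rewrite /G /= (IH _ (fun s => F (_ :: s))).
by move=> j; apply: rows_mean_ge0.
Qed.

Let scaled (i : nat) (n x : nat) : R := Num.sqrt n%:R * (x%:R / n%:R - p * q ^+ i).

(** If [m = n - j] boxes are left and the row in question has length [x], then
    its rescaled length is [sqrt (m / n)] times the one computed at size [m],
    minus [alpha i] times the rescaled length of the first row; and [m / n]
    tends to [q]. *)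
Lemma row_rv_cvg i w : (fun n => scaled i n (row_rv i n w)) @ \oo --> limit_rv i w.
Proof.
have dev u : (fun n => Num.sqrt n%:R * ((bin_rv q n u)%:R / n%:R - p)) @ \oo --> sigma * gauss_rv u.
  apply: cvg_trans (@bin_rv_cvg R q q0 q1 u); apply: near_eq_cvg; near=> n.
  have n0 : 0 < n%:R :> R by rewrite ltr0n; near: n; exact: nbhs_infty_gt.
  rewrite -/p; move: (sqr_sqrtr (ltW n0)) (n0).
  by rewrite -sqrtr_gt0; move: (Num.sqrt n%:R) => s <- s0; field; rewrite gt_eqF.
elim: i w => [|i IH] w; rewrite /scaled /=.
  by under eq_fun do rewrite expr0 mulr1; exact: dev.
set N := fun n => bin_rv q n (even_digits w).
have devN := dev (even_digits w).
have fracN : (fun n => (n - N n)%N%:R / n%:R : R) @ \oo --> q.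
  have h : (fun n => 1 - (p + (Num.sqrt n%:R)^-1 * (Num.sqrt n%:R * ((N n)%:R / n%:R - p)))) @ \oo -->
      1 - (p + 0 * (sigma * gauss_rv (even_digits w))).
    apply: cvgB; first exact: cvg_cst.
    apply: cvgD; first exact: cvg_cst.
    by apply: cvgM => //; exact: inv_sqrt_nat_cvg0.
  have E : 1 - (p + 0 * (sigma * gauss_rv (even_digits w))) = q by rewrite /p; ring.
  rewrite E in h; apply: cvg_trans h; apply: near_eq_cvg; near=> n.
  have n0 : 0 < n%:R :> R by rewrite ltr0n; near: n; exact: nbhs_infty_gt.
  rewrite natrB ?bin_rv_le_size //.
  have : Num.sqrt n%:R != 0 :> R by rewrite gt_eqF // sqrtr_gt0.
  move: (Num.sqrt _) => s s0; rewrite mulKf //; field; by rewrite gt_eqF.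
have cvgm : (fun n => (n - N n)%N) @ \oo --> \oo.
  apply/cvgnyPge => A.
  have half : q / 2 < q by rewrite ltr_pdivrMr // ltr_pMr // ltr1n.
  have ev : \forall n \near \oo, q / 2 < (n - N n)%N%:R / n%:R.
    exact: (cvgr_gt q fracN (q / 2) half).
  near=> n.
  have n0 : 0 < n%:R :> R by rewrite ltr0n; near: n; exact: nbhs_infty_gt.
  have h1 : q / 2 < (n - N n)%N%:R / n%:R by near: n.
  have h2 : A%:R / (q / 2) <= n%:R by near: n; exact: nbhs_infty_ger.
  rewrite ltr_pdivlMr // in h1; rewrite ler_pdivrMr ?divr_gt0 // in h2.
  by rewrite -(ler_nat R); apply: (le_trans h2); rewrite mulrC ltW.
have IHm : (fun n => scaled i (n - N n) (row_rv i (n - N n) (odd_digits w))) @ \oo --> limit_rv i (odd_digits w).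
  exact: (cvg_comp (fun n => (n - N n)%N) (fun m => scaled i m (row_rv i m (odd_digits w))) cvgm (IH _)).
have sq : (fun n => Num.sqrt ((n - N n)%N%:R / n%:R) : R) @ \oo --> Num.sqrt q.
  by apply: continuous_cvg; [exact: sqrt_continuous | exact: fracN].
have H : (fun n => Num.sqrt ((n - N n)%N%:R / n%:R) *
       scaled i (n - N n) (row_rv i (n - N n) (odd_digits w))
       - p * q ^+ i * (Num.sqrt n%:R * ((N n)%:R / n%:R - p))) @ \oo -->
    Num.sqrt q * limit_rv i (odd_digits w) - p * q ^+ i * (sigma * gauss_rv (even_digits w)).
  by apply: cvgB; [exact: cvgM | apply: cvgMl_tmp].
apply: cvg_trans H; apply: near_eq_cvg; near=> n.
have n0 : 0 < n%:R :> R by rewrite ltr0n; near: n; exact: nbhs_infty_gt.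
have m0 : 0 < (n - N n)%N%:R :> R.
  rewrite ltr0n; near: n.
  exact: (cvgm _ (nbhs_infty_gt 0)).
rewrite -/(N n) /scaled; move: (row_rv i _ _) => r.
have NE : (N n)%:R = n%:R - (n - N n)%N%:R :> R.
  by rewrite natrB ?bin_rv_le_size // opprB addrC subrK.
rewrite NE sqrtrM ?ltW // sqrtrV ?ltW //.
move: (n - N n)%N m0 {NE} => m m0.
have := sqr_sqrtr (ltW n0); have := sqr_sqrtr (ltW m0).
move: (m0) (n0); rewrite -(sqrtr_gt0 m%:R) -(sqrtr_gt0 n%:R).
move: (Num.sqrt m%:R) (Num.sqrt n%:R) => a b a0 b0 <- <-.
rewrite (exprS q i) /p; field; by rewrite !gt_eqF.
Unshelve. all: by end_near. Qed.

Lemma measurable_limit_rv i : measurable_fun setT (limit_rv i).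
Proof.
elim: i => [|i IH] /=.
  apply: measurable_funM => //; apply: measurableT_comp (@measurable_even_digits R).
  exact: (measurable_gauss_rv q0 q1).
apply: measurable_funB.
  by apply: measurable_funM => //; apply: measurableT_comp (@measurable_odd_digits R).
do 2 apply: measurable_funM => //; apply: measurableT_comp (@measurable_even_digits R).
exact: (measurable_gauss_rv q0 q1).
Qed.
End Chain.

(** * The law of linear combinations of the limit *)

Section LimitLaw.
Local Open Scope classical_set_scope.
Local Open Scope ring_scope.
Variables (R : realType) (q : R).
Hypotheses (q0 : 0 < q) (q1 : q < 1).
Notation unif := (uniform_prob (@ltr01 R)).
Notation TR := (measurableTypeR R).
Let p := 1 - q.
Let p0 : 0 < p. Proof. by rewrite subr_gt0. Qed.
Let sigma := Num.sqrt (p * q).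
Let sigma_gt0 : 0 < sigma. Proof. by rewrite sqrtr_gt0 mulr_gt0. Qed.

Definition lin_rv (k : nat) (c : nat -> R) (w : TR) : R := \sum_(i < k) c i * limit_rv q i w.

Definition lin_var (k : nat) (c : nat -> R) : R :=
  \sum_(i < k) (p * q ^+ i) * c i ^+ 2 - (\sum_(i < k) (p * q ^+ i) * c i) ^+ 2.

(** The coefficient of the first Gaussian variable in [lin_rv]. *)
Let drift k (c : nat -> R) : R := sigma * (c 0%N - \sum_(i < k) (p * q ^+ i) * c i.+1).

Lemma lin_rvS k c w : lin_rv k.+1 c w =
  drift k c * gauss_rv (even_digits w) + Num.sqrt q * lin_rv k (c \o succn) (odd_digits w).
Proof.
rewrite /lin_rv big_ord_recl /= /drift.
have -> : \sum_(i < k) c (bump 0 i) * (Num.sqrt q * limit_rv q i (odd_digits w)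
      - (1 - q) * q ^+ i * (Num.sqrt ((1 - q) * q) * gauss_rv (even_digits w))) =
    Num.sqrt q * (\sum_(i < k) (c \o succn) i * limit_rv q i (odd_digits w))
    - (\sum_(i < k) p * q ^+ i * c i.+1) * (sigma * gauss_rv (even_digits w)).
  rewrite mulr_sumr mulr_suml -sumrB; apply: eq_bigr => i _.
  by rewrite /bump /= add1n -/p -/sigma; ring.
by rewrite -/p -/sigma; ring.
Qed.

Lemma lin_varS k c : lin_var k.+1 c = drift k c ^+ 2 + q * lin_var k (c \o succn).
Proof.
rewrite /lin_var /drift !big_ord_recl /= expr0 mulr1 exprMn sqr_sqrtr ?mulr_ge0 ?ltW //.
have -> : \sum_(i < k) p * q ^+ bump 0 i * c (bump 0 i) ^+ 2 =
    q * \sum_(i < k) p * q ^+ i * c i.+1 ^+ 2.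
  by rewrite mulr_sumr; apply: eq_bigr => i _; rewrite /bump /= add1n exprS; ring.
have -> : \sum_(i < k) p * q ^+ bump 0 i * c (bump 0 i) =
    q * \sum_(i < k) p * q ^+ i * c i.+1.
  by rewrite mulr_sumr; apply: eq_bigr => i _; rewrite /bump /= add1n exprS; ring.
by move: (\sum_(i < k) _) (\sum_(i < k) _) => a b; rewrite /p; ring.
Qed.

Lemma lin_var_ge0 k c : 0 <= lin_var k c.
Proof.
elim: k c => [|k IH] c; first by rewrite /lin_var !big_ord0 expr0n subr0.
by rewrite lin_varS addr_ge0 ?sqr_ge0 // mulr_ge0 // ltW.
Qed.

(** Each summand of [lin_varS] vanishes. The combination is zero at every point,
    not only almost surely, because the limits are constructed pointwise. *)
Lemma lin_rv_degenerate k c w : lin_var k c = 0 -> lin_rv k c w = 0.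
Proof.
elim: k c w => [|k IH] c w; first by rewrite /lin_rv big_ord0.
rewrite lin_varS lin_rvS => /eqP.
rewrite paddr_eq0 ?sqr_ge0 // ?mulr_ge0 ?lin_var_ge0 ?(ltW q0) //.
move=> /andP[]; rewrite sqrf_eq0 => /eqP ->; rewrite mulf_eq0 (gt_eqF q0) /= => /eqP v0.
by rewrite mul0r add0r IH ?mulr0.
Qed.

Lemma measurable_lin_rv k c : measurable_fun setT (lin_rv k c).
Proof.
apply: measurable_sum => i; apply: measurable_funM => //.
exact: (measurable_limit_rv q0 q1).
Qed.

Let le_ind (f : TR -> R) t : measurable_fun setT f ->
  unif [set w | f w <= t] = (\int[unif]_w ((f w <= t)%R%:R)%:E)%E.
Proof.
move=> mf; have mA : measurable [set w : TR | f w <= t].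
  have -> : [set w : TR | f w <= t] = setT `&` f @^-1` `]-oo, t]%classic.
    by rewrite setTI; apply/seteqP; split => w /=; rewrite in_itv.
  exact: mf.
rewrite -[in LHS](setIT [set w | _]) -integral_indic //.
by apply: eq_integral => w _; rewrite indicE; congr ((nat_of_bool _)%:R%:E); apply/idP/idP; rewrite inE.
Qed.

(** The first Gaussian variable depends on the digits of even rank and the rest
    on those of odd rank; the rest is Gaussian by induction, and
    [gauss_rv_convolution] adds the two. *)
Lemma lin_rv_cdf k c t : 0 < lin_var k c ->
  unif [set w | lin_rv k c w <= t] = (ncdf (Num.sqrt (lin_var k c)) t)%:E.
Proof.
elim: k c t => [|k IH] c t.
  by rewrite /lin_var !big_ord0 expr0n subr0 ltxx.
move=> V0; set c' := c \o succn; set a := drift k c.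
pose X (z : TR * TR) : R := a * gauss_rv z.1 + Num.sqrt q * lin_rv k c' z.2.
have mX : measurable_fun setT X.
  apply: measurable_funD; apply: measurable_funM => //.
    exact: (measurableT_comp (measurable_gauss_rv q0 q1) measurable_fst).
  exact: (measurableT_comp (measurable_lin_rv k c') measurable_snd).
have mle : measurable_fun setT (fun z => ((X z <= t)%R%:R)%:E : \bar R).
  apply/measurable_EFinP.
  have -> : (fun z => (X z <= t)%R%:R) = (fun b : bool => b%:R : R) \o (fun z => X z <= t) by [].
  apply: measurableT_comp => //; apply: measurable_fun_ler => //.
rewrite le_ind; last exact: measurable_lin_rv.
under eq_integral do rewrite lin_rvS -/a -/c'.
rewrite (@integral_digits R (fun z => ((X z <= t)%R%:R)%:E) mle); last by move=> z; rewrite lee_fin.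
have sq0 : 0 < Num.sqrt q by rewrite sqrtr_gt0.
have inner u : (\int[unif]_w ((X (u, w) <= t)%R%:R)%:E =
    unif [set w | (lin_rv k c' w <= (t - a * gauss_rv u) / Num.sqrt q)%R])%E.
  rewrite le_ind; last exact: measurable_lin_rv.
  by apply: eq_integral => w _; rewrite /X /= addrC -lerBrDr -ler_pdivlMl // mulrC.
under eq_integral do rewrite inner.
rewrite lin_varS -/a -/c' in V0 *.
have [Vp|] := ltP 0 (lin_var k c').
  have qV : 0 < Num.sqrt (q * lin_var k c') by rewrite sqrtr_gt0 mulr_gt0.
  under eq_integral => u _.
    rewrite IH // ncdf_scale ?sqrtr_gt0 // -mulrA -invfM -sqrtrM ?(ltW q0) // -ncdf_scale //.
    over.
  have qV0 : 0 <= q * lin_var k c' by rewrite mulr_ge0 // ltW.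
  by rewrite (@gauss_rv_convolution R q q0 q1 a _ t qV) (sqr_sqrtr qV0).
(* The other variables cancel, and only the first Gaussian one is left. *)
move=> Vn; have V'0 : lin_var k c' = 0 by apply/eqP; rewrite eq_le Vn lin_var_ge0.
rewrite V'0 mulr0 addr0 in V0 *.
have a0 : a != 0 by apply: contraTneq V0 => ->; rewrite expr0n ltxx.
rewrite sqrtr_sqr -gauss_rv_scale_cdf // le_ind; last first.
  by apply: measurable_funM => //; exact: (measurable_gauss_rv q0 q1).
apply: eq_integral => u _; rewrite /=.
rewrite (_ : [set w | _] = [set _ | a * gauss_rv u <= t]); last first.
  by apply/seteqP; split => w /=; rewrite lin_rv_degenerate // ler_pdivlMr // mul0r subr_ge0.
case: (a * gauss_rv u <= t) => /=.
  by rewrite (_ : [set _ | _] = setT) ?probability_setT //; apply/seteqP; split.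
by rewrite (_ : [set _ | _] = set0) ?measure0 //; apply/seteqP; split.
Qed.

Definition lin_mfun k c : TR -> TR := lin_rv k c.
HB.instance Definition _ k c :=
  isMeasurableFun.Build _ _ _ _ (lin_mfun k c) (@measurable_lin_rv k c).

Definition gauss_mfun (s : R) : TR -> TR := fun u => s * gauss_rv u.
Lemma measurable_gauss_mfun s : measurable_fun setT (gauss_mfun s).
Proof. by apply: measurable_funM => //; exact: (measurable_gauss_rv q0 q1). Qed.
HB.instance Definition _ s :=
  isMeasurableFun.Build _ _ _ _ (gauss_mfun s) (@measurable_gauss_mfun s).

Lemma lin_rv_law k c (A : set TR) : measurable A ->
  unif (lin_mfun k c @^-1` A) = gaussian_law 0 (Num.sqrt (lin_var k c)) A.
Proof.
move=> mA; rewrite /gaussian_law sqrtr_eq0.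
have [V0|V0] := leP (lin_var k c) 0.
  have Ve : lin_var k c = 0 by apply/eqP; rewrite eq_le V0 lin_var_ge0.
  rewrite diracE; have [zA|zA] := boolP (0 \in A).
    rewrite (_ : _ @^-1` _ = setT) ?probability_setT //.
    by apply/seteqP; split => // w _; rewrite /= /lin_mfun lin_rv_degenerate // -inE.
  rewrite (_ : _ @^-1` _ = set0) ?measure0 //.
  apply/seteqP; split => // w; rewrite /= /lin_mfun lin_rv_degenerate // => h.
  by move: zA; rewrite notin_setE.
transitivity (distribution unif (lin_mfun k c : {mfun TR >-> TR}) A); first by [].
rewrite /=; apply: (@eq_measure_rays R (distribution unif (lin_mfun k c : {mfun TR >-> TR}))
    (normal_prob 0 (Num.sqrt (lin_var k c)))) => // x.
  by rewrite (le_lt_trans (probability_le1 _ _)) ?ltry //; exact: measurable_itv.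
apply: etrans _ (ncdfE _ _); rewrite -lin_rv_cdf //; congr (unif _).
Qed.

Lemma lin_rv_same_law k c (A : set TR) : 0 < lin_var k c -> measurable A ->
  distribution unif (lin_mfun k c : {mfun TR >-> TR}) A =
  distribution unif (gauss_mfun (Num.sqrt (lin_var k c)) : {mfun TR >-> TR}) A.
Proof.
move=> V0 mA; apply: eq_measure_rays => // x.
  by rewrite (le_lt_trans (probability_le1 _ _)) ?ltry //; exact: measurable_itv.
have s0 : 0 < Num.sqrt (lin_var k c) by rewrite sqrtr_gt0.
transitivity (unif [set w | lin_rv k c w <= x]).
  by congr (unif _); apply/seteqP; split => w /=; rewrite in_itv.
rewrite lin_rv_cdf // -[Num.sqrt _]gtr0_norm // -gauss_rv_scale_cdf ?gt_eqF //.
rewrite gtr0_norm //; congr (unif _).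
Qed.

(** The combination has the law of a multiple of [gauss_rv]. *)
Lemma lin_rv_second_moment k c : (\int[unif]_w ((lin_rv k c w) ^+ 2)%:E = (lin_var k c)%:E)%E.
Proof.
have [V0|V0] := ltP 0 (lin_var k c); last first.
  have Ve : lin_var k c = 0 by apply/eqP; rewrite eq_le V0 lin_var_ge0.
  rewrite Ve; apply: integral0_eq => w _; rewrite lin_rv_degenerate //; congr (_%:E).
  by rewrite expr0n.
set v := lin_var k c in V0 *.
have msq : measurable_fun setT (fun x : TR => (x ^+ 2)%:E).
  by apply/measurable_EFinP; apply: measurable_funX.
have sq0 (x : R) : (0 <= (x ^+ 2)%:E)%E by rewrite lee_fin sqr_ge0.
transitivity (\int[distribution unif (lin_mfun k c : {mfun TR >-> TR})]_x (x ^+ 2)%:E)%E.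
  by rewrite ge0_integral_distribution.
transitivity (\int[distribution unif (gauss_mfun (Num.sqrt v) : {mfun TR >-> TR})]_x (x ^+ 2)%:E)%E.
  by apply: eq_measure_integral => A mA _; apply: lin_rv_same_law.
rewrite ge0_integral_distribution //=.
rewrite (eq_integral (fun u => ((v / (p * q))%:E * ((sigma * gauss_rv u) ^+ 2)%:E)%E)); last first.
  move=> u _ /=; rewrite -EFinM; congr (_%:E).
  rewrite /gauss_mfun !exprMn !sqr_sqrtr ?mulr_ge0 ?(ltW V0) ?(ltW p0) ?(ltW q0) // [RHS]mulrA divfK //.
  by rewrite gt_eqF // mulr_gt0.
rewrite ge0_integralZl //; last 2 first.
- by apply/measurable_EFinP/measurable_funX; exact: (measurable_gauss_mfun sigma).
- by rewrite lee_fin divr_ge0 // ?mulr_ge0 // ltW.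
by rewrite gauss_rv_second_moment // -EFinM divfK // gt_eqF // mulr_gt0.
Qed.
End LimitLaw.

(** * Moments of the limit process *)

Section LimitMoments.
Local Open Scope classical_set_scope.
Local Open Scope ring_scope.
Variables (R : realType) (q : R).
Hypotheses (q0 : 0 < q) (q1 : q < 1).
Notation unif := (uniform_prob (@ltr01 R)).
Notation TR := (measurableTypeR R).
Notation lin k c := (lin_rv q k c : TR -> R).

Lemma lin_rv_Lfun2 k c : lin k c \in Lfun unif 2%:E.
Proof.
rewrite inE; apply/andP; split; rewrite inE /=; first exact: (measurable_lin_rv q0 q1).
rewrite /finite_norm unlock; apply: poweR_lty.
rewrite (eq_integral (fun w => ((lin_rv q k c w) ^+ 2)%:E)).
  by rewrite (lin_rv_second_moment q0 q1) ltry.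
by move=> w _ /=; rewrite powR_mulrn // real_normK // num_real.
Qed.

Lemma lin_rv_Lfun1 k c : lin k c \in Lfun unif 1.
Proof. by apply: Lfun_subset12 (lin_rv_Lfun2 k c); rewrite fin_num_measure. Qed.

Let lin_m k c : TR -> TR := lin_rv q k c.
HB.instance Definition _ k c :=
  isMeasurableFun.Build _ _ _ _ (lin_m k c) (@measurable_lin_rv R q q0 q1 k c).

Lemma lin_var_opp k (c : nat -> R) : lin_var q k (fun i => - c i) = lin_var q k c.
Proof.
rewrite /lin_var; congr (_ - _); first by apply: eq_bigr => i _; rewrite sqrrN.
by under eq_bigr do rewrite mulrN; rewrite sumrN sqrrN.
Qed.

(** The Gaussian law being symmetric, opposite coefficients give the same law. *)
Lemma lin_rv_expectation k c : 'E_unif[lin k c]%E = 0%:E.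
Proof.
have iL c' : unif.-integrable setT (EFin \o lin k c').
  by apply/Lfun1_integrable; exact: lin_rv_Lfun1.
have int c' : (\int[unif]_w (lin_rv q k c' w)%:E =
    \int[distribution unif (lin_m k c' : {mfun TR >-> TR})]_x (x : R)%:E)%E.
  by rewrite integral_distribution //; exact: iL.
have same : 'E_unif[lin k c]%E = 'E_unif[lin k (fun i => (- c i)%R)]%E.
  rewrite unlock !int; apply: eq_measure_integral => A mA _.
  apply: etrans (lin_rv_law q0 q1 k c mA) _; apply/esym.
  by apply: etrans (lin_rv_law q0 q1 k _ mA) _; rewrite lin_var_opp.
have opp : lin k (fun i => - c i) = (- 1 \o* lin k c)%R.
  apply/funext => w; rewrite /lin_rv /= mulrN1 -sumrN.
  by apply: eq_bigr => i _; rewrite mulNr.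
move: same; rewrite opp (expectationZl _ (lin_rv_Lfun1 k c)).
have := expectation_fin_num (lin_rv_Lfun1 k c).
case: expectation => //= r _; rewrite -EFinM => -[h]; congr (_%:E); lra.
Qed.

Lemma lin_rv_variance k c : 'V_unif[lin k c]%E = (lin_var q k c)%:E.
Proof.
rewrite varianceE ?lin_rv_Lfun2 // lin_rv_expectation expe2 mule0 sube0.
by rewrite unlock -(lin_rv_second_moment q0 q1).
Qed.

Let unit_coef (i : nat) (j : nat) : R := (j == i)%:R.

Let lin_unit i k w : (i < k)%N -> lin_rv q k (unit_coef i) w = limit_rv q i w.
Proof.
move=> ik; rewrite /lin_rv (bigD1 (Ordinal ik)) //= /unit_coef eqxx mul1r big1 ?addr0 // => j jn.
by rewrite (_ : (j == i :> nat) = false) ?mul0r //; apply: negbTE; exact: jn.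
Qed.

Let sum_unit i k (F : nat -> R) : (i < k)%N -> \sum_(m < k) F m * unit_coef i m = F i.
Proof.
move=> ik; rewrite (bigD1 (Ordinal ik)) //= /unit_coef eqxx mulr1 big1 ?addr0 // => m mn.
by rewrite (_ : (m == i :> nat) = false) ?mulr0 //; apply: negbTE; exact: mn.
Qed.

Let lin_var_unit i k : (i < k)%N ->
  lin_var q k (unit_coef i) = (1 - q) * q ^+ i - ((1 - q) * q ^+ i) ^+ 2.
Proof.
move=> ik; rewrite /lin_var (sum_unit (fun m => (1 - q) * q ^+ m) ik); congr (_ - _).
rewrite -[RHS](sum_unit (fun m => (1 - q) * q ^+ m) ik); apply: eq_bigr => m _.
by rewrite /unit_coef; case: eqP; rewrite ?expr1n ?expr0n.
Qed.

Let lin_var_unit2 i j k : i != j -> (i < k)%N -> (j < k)%N ->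
  lin_var q k (fun l => unit_coef i l + unit_coef j l) =
  (1 - q) * q ^+ i + (1 - q) * q ^+ j - ((1 - q) * q ^+ i + (1 - q) * q ^+ j) ^+ 2.
Proof.
move=> ij ik jk; pose a m := (1 - q) * q ^+ m.
have lin : \sum_(m < k) (1 - q) * q ^+ m * (unit_coef i m + unit_coef j m) = a i + a j.
  rewrite -(sum_unit a ik) -(sum_unit a jk) -big_split /=.
  by apply: eq_bigr => m _; rewrite mulrDr.
rewrite /lin_var lin; congr (_ - _).
rewrite -/(a i) -/(a j) -(sum_unit a ik) -(sum_unit a jk) -big_split /=; apply: eq_bigr => m _.
rewrite /unit_coef /a; case: (eqVneq (m : nat) i) => [mi|_].
  by rewrite mi (negbTE ij) /= !addr0 mulr0 expr1n addr0.
by rewrite !add0r mulr0 add0r; case: eqP; rewrite ?expr1n ?expr0n.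
Qed.

Lemma limit_rv_linE i : limit_rv q i = lin i.+1 (unit_coef i).
Proof. by apply/funext => w; rewrite lin_unit. Qed.

Lemma limit_rv_expectation i : 'E_unif[(limit_rv q i : TR -> R)]%E = 0%:E.
Proof. by rewrite limit_rv_linE lin_rv_expectation. Qed.

Lemma limit_rv_second_moment i : 'E_unif[fun w : TR => (limit_rv q i w ^+ 2)%R]%E =
  ((1 - q) * q ^+ i - (1 - q) ^+ 2 * q ^+ (2 * i))%:E.
Proof.
rewrite limit_rv_linE unlock (lin_rv_second_moment q0 q1) lin_var_unit //.
by rewrite exprMn -exprM mulnC.
Qed.

(** Polarisation: the variance of the sum is that of another linear
    combination. *)
Lemma limit_rv_covariance i j : i != j ->
  covariance unif (limit_rv q i : TR -> R) (limit_rv q j) = (- ((1 - q) ^+ 2 * q ^+ (i + j)))%:E.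
Proof.
move=> ij; pose k := (maxn i j).+1.
have ik : (i < k)%N by rewrite ltnS leq_maxl.
have jk : (j < k)%N by rewrite ltnS leq_maxr.
have Ei : limit_rv q i = lin k (unit_coef i) by apply/funext => w; rewrite lin_unit.
have Ej : limit_rv q j = lin k (unit_coef j) by apply/funext => w; rewrite lin_unit.
have S : (lin k (unit_coef i) \+ lin k (unit_coef j))%R =
    lin k (fun l => unit_coef i l + unit_coef j l).
  by apply/funext => w /=; rewrite /lin_rv -big_split; apply: eq_bigr => l _ /=; rewrite mulrDl.
have := varianceD (lin_rv_Lfun2 k (unit_coef i)) (lin_rv_Lfun2 k (unit_coef j)).
rewrite S !lin_rv_variance !lin_var_unit // lin_var_unit2 // Ei Ej.
have := covariance_fin_num (lin_rv_Lfun1 k (unit_coef i)) (lin_rv_Lfun1 k (unit_coef j))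
  (Lfun2_mul_Lfun1 (lin_rv_Lfun2 k (unit_coef i)) (lin_rv_Lfun2 k (unit_coef j))).
case: (covariance _ _ _) => // r _ [h]; congr (_%:E).
have -> : q ^+ (i + j) = q ^+ i * q ^+ j by rewrite exprD.
lra.
Qed.
End LimitMoments.

(** * Convergence of the finite-dimensional laws *)

Section FinalLimit.
Local Open Scope classical_set_scope.
Local Open Scope ring_scope.
Variables (R : realType) (q : R).
Hypotheses (q0 : 0 < q) (q1 : q < 1).
Notation unif := (uniform_prob (@ltr01 R)).
Notation TR := (measurableTypeR R).

Lemma expectation_intpart (d : measure_display) (T : measurableType d) (P : probability T R)
    n (X : {RV P >-> intpart n}) (g : seq nat -> R) :
  (forall l : intpart n, distribution P X [set l] = (qplancherel q l)%:E) ->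
  'E_P[fun w => g (X w)]%E = (qpl_mean q n g)%:E.
Proof.
move=> XE; rewrite unlock.
pose ev (l : seq nat) : set T := [set w | (X w : seq nat) = l].
have mev l : measurable (ev l).
  rewrite (_ : ev l = setT `&` X @^-1` [set x : intpart n | (x : seq nat) = l]); last by rewrite setTI.
  by apply: (measurable_funPT X).
have Pev l : l \in intparts n -> P (ev l) = (qplancherel q l)%:E.
  rewrite mem_intparts => hl; rewrite -(XE (IntPart hl)) /distribution /pushforward.
  congr (P _); apply/seteqP; split => w /= h; first exact: val_inj.
  by rewrite /ev /= h.
transitivity (\int[P]_w \sum_(l <- intparts n) (g l)%:E * (\1_(ev l) w)%:E)%E.
  apply: eq_integral => w _.
  have Xin : (X w : seq nat) \in intparts n by rewrite mem_intparts; case: (X w).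
  rewrite (bigD1_seq (X w : seq nat)) ?undup_uniq //= indicE mem_set // mule1 big1 ?adde0 // => l ln.
  rewrite indicE memNset ?mule0 // => h; move: ln; rewrite -h eqxx //.
have int l : P.-integrable setT (fun w => (g l)%:E * (\1_(ev l) w)%:E)%E.
  by apply: integrableZl => //; exact: integrable_indic.
rewrite integral_sum // /qpl_mean -sumEFin; apply: eq_big_seq => l ln.
rewrite integralZl //; last exact: integrable_indic.
by rewrite integral_indic // setIT mulrC EFinM; congr (_ * _)%E; exact: Pev.
Qed.

Lemma qpl_mean_total0 : qpl_mean q 0 (fun=> 1) = 1.
Proof.
have I0 : perm_eq (intparts 0) [:: [::]].
  apply: uniq_perm; rewrite ?undup_uniq // => l; rewrite mem_intparts inE /is_intpart.
  apply/and3P/eqP => [[_ l0 /eqP s0]|->] //.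
  case: l l0 s0 => // a l /=; rewrite inE negb_or eq_sym => /andP[a0 _] /eqP.
  by rewrite addn_eq0 (negbTE a0).
rewrite /qpl_mean (perm_big _ I0) /= big_seq1 mulr1 /qplancherel /b_stat !big_ord0 expr0 divr1 mulr1.
by rewrite (@dim_partE R [::]) // fact0 mul1r.
Qed.

Lemma rows_meanD k n (F G : seq nat -> R) :
  rows_mean q k n (fun s => F s + G s) = rows_mean q k n F + rows_mean q k n G.
Proof.
elim: k n F G => [|k IH] n F G //=; rewrite -bin_meanD; apply: eq_bin_mean => j _; exact: IH.
Qed.

Lemma rows_mean_cst k n (b : R) : rows_mean q k n (fun=> b) = b.
Proof.
elim: k n => [|k IH] n //=; rewrite (@eq_bin_mean _ _ _ _ (fun=> b)) ?bin_mean_cst // => j _.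
Qed.

(** The nonnegative case applies after adding the bound [B]. *)
Lemma expectation_rows_rv k n (F : seq nat -> R) B : (forall s, `|F s| <= B) ->
  (\int[unif]_w (F (rows_rv q k n w))%:E)%E = (rows_mean q k n F)%:E.
Proof.
move=> FB.
have iF : unif.-integrable setT (fun w => (F (rows_rv q k n w))%:E).
  apply: measurable_bounded_integrable => //; first by rewrite -ge0_fin_numE ?fin_num_measure.
    exact: (measurable_rows_rv q0 q1).
  by exists B; split; [exact: num_real | move=> M BM w _ /=; apply: (le_trans (FB _)); exact: ltW].
have F0 s : 0 <= F s + B by have := FB s; rewrite ler_norml => /andP[h _]; lra.
have := @integral_rows_rv R q q0 q1 k n (fun s => F s + B) F0.
rewrite rows_meanD rows_mean_cst EFinD.
under eq_integral do rewrite EFinD.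
rewrite integralD //; last exact: finite_measure_integrable_cst.
rewrite integral_cst // [X in (_ * X)%E]probability_setT mule1.
have := integrable_fin_num measurableT iF.
by case: integral => // r _; rewrite -!EFinD => -[/addIr ->].
Qed.

Lemma row_cvg k (u : nat -> 'I_k -> R) (l : 'I_k -> R) : (forall j, u ^~ j @ \oo --> l j) ->
  (\row_j u n j : 'rV[R]_k) @[n --> \oo] --> (\row_j l j : 'rV[R]_k).
Proof.
move=> h; apply/cvg_mx_entourageP => A entA.
apply: filter_forall => i; apply: filter_forall => j.
have /cvg_entourageP /(_ A entA) H := h j.
have {}H : \forall n \near \oo, A (l j, u n j) by exact: H.
have : \forall n \near \oo, (((\row_j l j) i j, (\row_j u n j : 'rV[R]_k) i j) \in A).
  by apply: filterS H => n Hn; rewrite !mxE inE.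
by [].
Qed.

Let scale_row (n : nat) (i x : nat) : R := Num.sqrt n%:R * (x%:R / n%:R - (1 - q) * q ^+ i).

(** The laws of the first rows and of their coupled binomial copies merge, and
    the copies converge pointwise. *)
Lemma fdd_limit k (s : 'I_k -> nat) (f : 'rV[R]_k -> R) (M : R) :
  (forall n, qpl_mean q n (fun=> 1) = 1) ->
  continuous f -> (forall x, `|f x| <= M) ->
  (qpl_mean q n (fun l => f (\row_j scale_row n (s j) (nth 0%N l (s j)))))%:E @[n --> \oo] -->
  'E_unif[fun w => f (\row_j (limit_rv q (s j) w))]%E.
Proof.
move=> mean1 cf fM.
have M0 : 0 <= M by apply: le_trans (fM 0).
pose K := (\max_(j < k) s j).+1.
have sK j : (s j < K)%N by rewrite ltnS (leq_bigmax j).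
pose F n (l : seq nat) : R := f (\row_j scale_row n (s j) (nth 0%N l (s j))).
have [u [u0 _ uE]] := qpl_first_rows q0 q1 mean1 K.
have M1 : 0 < M + 1 by lra.
(* [qpl_first_rows] is stated for functions bounded by 1. *)
have close n : `|qpl_mean q n (F n) - rows_mean q K n (F n)| <= (M + 1) * u n.
  have {}uE := uE n (fun l => (M + 1)^-1 * F n l).
  have scal k' m (G : seq nat -> R) b : rows_mean q k' m (fun l => b * G l) = b * rows_mean q k' m G.
    elim: k' m G => [|k' IH] m G //=; rewrite -bin_meanZ; apply: eq_bin_mean => j _; exact: IH.
  have FE : qpl_mean q n (fun l => (M + 1)^-1 * F n (first_rows K l)) = (M + 1)^-1 * qpl_mean q n (F n).
    rewrite -qpl_meanZ; apply: eq_qpl_mean => l _ _; rewrite /F; congr (_ * f _).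
    by apply/rowP => j; rewrite !mxE nth_mkseq.
  rewrite FE scal -mulrBr normrM gtr0_norm ?invr_gt0 // ler_pdivrMl // in uE.
  apply: uE => l; rewrite normrM gtr0_norm ?invr_gt0 // ler_pdivrMl // mulr1.
  by apply: (le_trans (fM _)); lra.
have pointwise w : (fun n => F n (rows_rv q K n w)) @ \oo --> f (\row_j (limit_rv q (s j) w)).
  apply: continuous_cvg; first exact: cf.
  apply: row_cvg => j; under eq_fun do rewrite nth_mkseq //.
  exact: (row_rv_cvg q0 q1).
have mF n : measurable_fun setT (fun w : TR => F n (rows_rv q K n w)).
  exact: (measurable_rows_rv q0 q1).
have coupled : (fun n => \int[unif]_w (F n (rows_rv q K n w))%:E)%E @ \oo -->
    (\int[unif]_w (f (\row_j (limit_rv q (s j) w)))%:E)%E.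
  apply: (@dominated_cvg _ _ _ unif setT measurableT _ _ (cst M%:E)) => //.
  - by move=> n; apply/measurable_EFinP; exact: mF.
  - by move=> w _; apply: cvg_EFin; [near=> n | exact: pointwise].
  - exact: finite_measure_integrable_cst.
  - by move=> n w _ /=; rewrite lee_fin; exact: fM.
rewrite expectation.unlock.
have E : (fun n => \int[unif]_w (F n (rows_rv q K n w))%:E)%E = fun n => (rows_mean q K n (F n))%:E.
  by apply/funext => n; exact: (expectation_rows_rv _ _ (fun l => fM _)).
rewrite E in coupled.
have diff : (fun n => qpl_mean q n (F n) - rows_mean q K n (F n)) @ \oo --> (0 : R).
  apply/norm_cvg0P; apply: (squeeze0 _ (cvg0_scale (M + 1) u0)).
  by near=> n; rewrite normr_ge0 close.
have limfin : (\int[unif]_w (f (\row_j (limit_rv q (s j) w)))%:E)%E \is a fin_num.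
  apply: integrable_fin_num => //; apply: measurable_bounded_integrable => //.
  - by rewrite -ge0_fin_numE ?fin_num_measure.
  - by apply: (@measurable_fun_cvg _ _ _ _ (fun n w => F n (rows_rv q K n w))) => // w _; exact: pointwise.
  - by exists M; split; [exact: num_real | move=> N MN w _ /=; apply: (le_trans (fM _)); exact: ltW].
rewrite -(fineK limfin) in coupled.
have c2 : (fun n => rows_mean q K n (F n)) @ \oo -->
    (fine (\int[unif]_w (f (\row_j (limit_rv q (s j) w)))%:E)%E : R) by exact: (fine_cvg coupled).
have main : (fun n => qpl_mean q n (F n)) @ \oo -->
    (fine (\int[unif]_w (f (\row_j (limit_rv q (s j) w)))%:E)%E : R).
  have h : (fun n => (qpl_mean q n (F n) - rows_mean q K n (F n)) + rows_mean q K n (F n)) @ \oo -->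
    (0 + fine (\int[unif]_w (f (\row_j (limit_rv q (s j) w)))%:E)%E : R) by apply: cvgD; [exact: diff | exact: c2].
  by move: h; rewrite add0r; under eq_fun do rewrite subrK.
have : (fun n => (qpl_mean q n (F n))%:E) @ \oo -->
    (fine (\int[unif]_w (f (\row_j (limit_rv q (s j) w)))%:E)%E)%:E.
  by apply: cvg_EFin; [near=> n | exact: main].
by rewrite (fineK limfin).
Unshelve. all: by end_near. Qed.
End FinalLimit.

Local Open Scope classical_set_scope.
Local Open Scope ring_scope.

Theorem theorem2 (R : realType) (q : R) (q0 : 0 < q) (q1 : q < 1)
    (d : nat -> measure_display) (T : forall n, measurableType (d n))
    (P : forall n, probability (T n) R)
    (lambda : forall n, {RV (P n) >-> intpart n})
    (lambdaE : forall n, (1 <= n)%N -> forall l : intpart n,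
       distribution (P n) (lambda n) [set l] = (qplancherel q l)%:E) :
  exists (dY : measure_display) (TY : measurableType dY)
    (PY : probability TY R) (Y : nat -> {RV PY >-> R}),
    [/\ gaussian_process Y,
        forall i, 'E_PY[Y i]%E = 0%:E,
        forall i, 'E_PY[fun w => (Y i w ^+ 2)%R]%E =
          ((1 - q) * q ^+ i - (1 - q) ^+ 2 * q ^+ (2 * i))%:E,
        forall i j, i != j ->
          covariance PY (Y i) (Y j) = (- ((1 - q) ^+ 2 * q ^+ (i + j)))%:E
      & fdd_cvg (fun n i => (@scaled_row R q n i \o lambda n
                               : {RV (P n) >-> R})) Y].
Proof.
(* For [n >= 1] the weights have sum 1 as they form the law of [lambda n];
   size 0 has the empty partition only. *)
have mean1 n : qpl_mean q n (fun=> 1) = 1.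
  case: n => [|n]; first exact: qpl_mean_total0.
  have := expectation_intpart (fun=> 1) (lambdaE n.+1 isT).
  by rewrite (expectation_cst (P n.+1) 1) => -[].
pose Y (i : nat) : {mfun (measurableTypeR R) >-> R} :=
  HB.pack_for {mfun (measurableTypeR R) >-> R} (limit_rv q i)
    (isMeasurableFun.Build _ _ _ _ (limit_rv q i) (measurable_limit_rv q0 q1 i)).
exists _, (measurableTypeR R), (uniform_prob (@ltr01 R)), Y; split.
- move=> k c; exists 0, (Num.sqrt (lin_var q k c)) => A mA.
  exact: (lin_rv_law q0 q1 k c mA).
- move=> i; exact: limit_rv_expectation.
- move=> i; exact: limit_rv_second_moment.
- move=> i j ij; exact: limit_rv_covariance.
- move=> k s f cf [M fM].
  have := fdd_limit q0 q1 mean1 cf fM (s := s).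
  apply: cvg_trans; apply: near_eq_cvg; near=> n.
  have n0 : (0 < n)%N by near: n; exact: nbhs_infty_gt.
  apply/esym.
  exact: (expectation_intpart (fun l => f (\row_j (Num.sqrt n%:R * ((nth 0%N l (s j))%:R / n%:R - (1 - q) * q ^+ s j)))) (lambdaE n n0)).
Unshelve. all: by end_near. Qed.
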